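(* Let $\mathcal{M}$ be a complete, finite-dimensional, connected Riemannian spin manifold without boundary that admits a convex isometric embedding $N:\mathcal{M}\hookrightarrow\mathbb{R}^n$. Let $\varphi_1,\varphi_2$ be states of $C_0(\mathcal{M})$ with finite moment of order $1$, with associated probability measures $\mu_1,\mu_2$ and mean points $\bar x_1,\bar x_2\in\mathcal{M}$. Then $$d(\bar x_1,\bar x_2)\le d_D(\varphi_1,\varphi_2)\le\int_{\mathcal{M}\times\mathcal{M}} d(x,y)\,d\mu_1(x)\,d\mu_2(y),$$ where $d$ is the geodesic distance of $\mathcal{M}$ and $d_D$ the spectral distance.
   Context: States of $C_0(\mathcal{M})$ correspond to Borel probability measures $\mu$ on $\mathcal{M}$ via $\varphi(f)=\int_{\mathcal{M}} f\,d\mu$. A state has finite moment of order $1$ if $\int_{\mathcal{M}} d(x_0,x)\,d\mu(x)<+\infty$ for some (equivalently every) $x_0\in\mathcal{M}$. An isometric embedding is meant in the Riemannian sense (Nash embedding): a smooth embedding $N$ of $\mathcal{M}$ onto $\widetilde{\mathcal{M}}=N(\mathcal{M})\subset\mathbb{R}^n$ such that the metric of $\mathcal{M}$ is the pull-back of the Euclidean metric. It is convex if $\widetilde{\mathcal{M}}$ is a convex subset of $\mathbb{R}^n$. The mean point of a state with measure $\mu$ is $\bar x:=N^{-1}(\tilde x)$, where $\tilde x=\int_{\mathbb{R}^n}\xi\,d(N_*\mu)(\xi)$ is the barycenter of the push-forward $N_*\mu$, which lies in $\widetilde{\mathcal{M}}$ by convexity. Spectral distance: let $D=-i\gamma^\mu\nabla_\mu$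 be the Dirac operator acting on the Hilbert space $L^2(\mathcal{M},\mathcal{S})$ of square-integrable spinors, where $\nabla$ is the spin connection and the $\gamma^\mu$ are self-adjoint with $\gamma^\mu\gamma^\nu+\gamma^\nu\gamma^\mu=2g^{\mu\nu}\mathbb{I}$, and let functions act by pointwise multiplication. With $C_0^\infty(\mathcal{M})$ the complex smooth functions vanishing at infinity, $$d_D(\varphi_1,\varphi_2)=\sup\{|\varphi_1(f)-\varphi_2(f)| : f\in C_0^\infty(\mathcal{M}),\ \|[D,f]\|_{\mathrm{op}}\le 1\}.$$ *)

(* Defs.v *)
From HB Require Import structures.
From mathcomp Require Import all_boot all_order all_algebra.
From mathcomp Require Import all_classical all_reals all_analysis.
From mathcomp Require Export complex.

Set Implicit Arguments.
Unset Strict Implicit.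
Unset Printing Implicit Defensive.

Import Order.TTheory GRing.Theory Num.Theory.
Import numFieldNormedType.Exports.
Import ComplexField.Normc.

Local Open Scope classical_set_scope.
Local Open Scope ring_scope.

(** * Calculus on open subsets of R^m *)

Section Calculus.
Context {R : realType} {m : nat}.

Definition partial (k : 'I_m) (f : 'rV[R]_m -> R) : 'rV[R]_m -> R :=
  fun y => 'D_(delta_mx 0 k) f y.

(* C^infinity on the open set U: all iterated partial derivatives exist and
   are continuous at every point of U. *)
Definition smooth_on (U : set 'rV[R]_m) (f : 'rV[R]_m -> R) : Prop :=
  forall (s : seq 'I_m) (y : 'rV[R]_m), U y ->
    {for y, continuous (foldr partial f s)} /\
    forall k, derivable (foldr partial f s) y (delta_mx 0 k).

Definition csmooth_on (U : set 'rV[R]_m) (f : 'rV[R]_m -> R[i]) : Prop :=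
  smooth_on U (fun y => complex.Re (f y)) /\
  smooth_on U (fun y => complex.Im (f y)).

Definition cpartial (k : 'I_m) (f : 'rV[R]_m -> R[i]) (y : 'rV[R]_m) : R[i] :=
  Complex (partial k (fun z => complex.Re (f z)) y)
          (partial k (fun z => complex.Im (f z)) y).

End Calculus.

(* Integral over R^m of a nonnegative Borel function with respect to Lebesgue
   measure, as an iterated integral (Tonelli). *)
Fixpoint lebesgue_integral_rV {R : realType} (m : nat) :
    ('rV[R]_m -> \bar R) -> \bar R :=
  match m with
  | 0%N => fun f => f 0
  | m'.+1 => fun f => (\int[lebesgue_measure]_(x in [set: R])
      lebesgue_integral_rV (fun y : 'rV[R]_m' => f (row_mx (x%:M : 'rV_1) y)))%E
  end.

(** * Riemannian manifolds *)

Record chart (R : realType) (M : topologicalType) (m : nat) := Chart {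
  chart_dom : set M;
  chart_coord : M -> 'rV[R]_m;
  chart_inv : 'rV[R]_m -> M;
  chart_dom_open : open chart_dom;
  chart_codom_open : open (chart_coord @` chart_dom);
  coordK : forall x, chart_dom x -> chart_inv (chart_coord x) = x;
  coord_continuous : forall x, chart_dom x -> {for x, continuous chart_coord};
  coord_inv_continuous :
    forall x, chart_dom x -> {for chart_coord x, continuous chart_inv} }.

Definition chart_codom (R : realType) (M : topologicalType) (m : nat)
  (c : chart R M m) : set 'rV[R]_m := chart_coord c @` chart_dom c.

(* The function [chart_at] only selects, for each point, a chart around it;
   everything evaluated in [chart_at x] below is chart independent. *)
Record smooth_atlas (R : realType) (M : topologicalType) (m : nat) := SmoothAtlas {
  chart_index : Type;
  chart_of :> chart_index -> chart R M m;
  chart_at : M -> chart_index;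
  chart_at_dom : forall x, chart_dom (chart_of (chart_at x)) x;
  transition_smooth : forall (i j : chart_index) (l : 'I_m),
    smooth_on
      (chart_coord (chart_of i) @` (chart_dom (chart_of i) `&` chart_dom (chart_of j)))
      (fun y => chart_coord (chart_of j) (chart_inv (chart_of i) y) 0 l) }.

(* Jacobian at x of the coordinate change from chart i to chart j; coordinates
   of tangent vectors are row vectors, mapped by v |-> v *m J. *)
Definition transition_jacobian (R : realType) (M : topologicalType) (m : nat)
    (A : smooth_atlas R M m) (i j : chart_index A) (x : M) : 'M[R]_m :=
  jacobian (fun y => chart_coord (A j) (chart_inv (A i) y)) (chart_coord (A i) x).

Record riemannian_metric (R : realType) (M : topologicalType) (m : nat)
    (A : smooth_atlas R M m) := RiemannianMetric {
  metric_mx :> chart_index A -> 'rV[R]_m -> 'M[R]_m;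
  metric_smooth : forall i k l,
    smooth_on (chart_codom (A i)) (fun y => metric_mx i y k l);
  metric_sym : forall i y, chart_codom (A i) y ->
    (metric_mx i y)^T = metric_mx i y;
  metric_pos : forall i y, chart_codom (A i) y -> forall v : 'rV[R]_m, v != 0 ->
    0 < (v *m metric_mx i y *m v^T) 0 0;
  metric_compat : forall i j x, chart_dom (A i) x -> chart_dom (A j) x ->
    let J := transition_jacobian i j x in
    metric_mx i (chart_coord (A i) x) = J *m metric_mx j (chart_coord (A j) x) *m J^T }.

Notation borel M := (g_sigma_algebraType (@open M)).

Section RiemannianGeometry.
Context {R : realType} {M : ptopologicalType} {m : nat}.
Context {A : smooth_atlas R M m} (g : riemannian_metric A).

(* C^1 on [0, 1], two-sided at the endpoints. *)
Definition C1_curve (c : R -> M) : Prop :=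
  forall t : R, 0 <= t <= 1 ->
    {for t, continuous c} /\
    forall i, chart_dom (A i) (c t) ->
      (\forall s \near t, derivable (fun r => chart_coord (A i) (c r)) s 1) /\
      {for t, continuous (derive1 (fun r => chart_coord (A i) (c r)))}.

Definition speed (c : R -> M) (t : R) : R :=
  let i := chart_at A (c t) in
  let v := derive1 (fun r => chart_coord (A i) (c r)) t in
  Num.sqrt ((v *m g i (chart_coord (A i) (c t)) *m v^T) 0 0).

Definition curve_length (c : R -> M) : \bar R :=
  (\int[lebesgue_measure]_(t in `[0%R, 1%R]) (speed c t)%:E)%E.

(* [joined x y L]: some piecewise C^1 curve from x to y has length L. *)
Inductive joined : M -> M -> \bar R -> Prop :=
| joined_refl x : joined x x 0%E
| joined_step x z y c L : C1_curve c -> c 0 = x -> c 1 = z ->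
    joined z y L -> joined x y (curve_length c + L)%E.

Definition geodesic_dist (x y : M) : \bar R :=
  ereal_inf [set L | joined x y L].

Definition riemannian_complete : Prop :=
  forall u : nat -> M,
    (forall e : R, 0 < e -> exists k : nat, forall p q : nat,
       (k <= p)%N -> (k <= q)%N -> (geodesic_dist (u p) (u q) < e%:E)%E) ->
    exists x : M, forall e : R, 0 < e -> exists k : nat, forall p : nat,
      (k <= p)%N -> (geodesic_dist (u p) x < e%:E)%E.

Definition riemannian_volume (vol : {measure set (borel M) -> \bar R}) : Prop :=
  forall (i : chart_index A) (B : set (borel M)),
    measurable B -> B `<=` chart_dom (A i) ->
    vol B = lebesgue_integral_rV (fun y =>
      (\1_(chart_coord (A i) @` B) y * Num.sqrt (\det (g i y)))%:E).

Record isometric_embedding (n : nat) (N : M -> 'rV[R]_n) : Prop := {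
  embedding_smooth : forall i l,
    smooth_on (chart_codom (A i)) (fun y => N (chart_inv (A i) y) 0 l);
  embedding_inj : injective N;
  embedding_open : forall U : set M, open U ->
    exists2 V : set 'rV[R]_n, open V & U = N @^-1` V;
  embedding_pullback : forall i y, chart_codom (A i) y ->
    let J := jacobian (fun z => N (chart_inv (A i) z)) y in
    g i y = J *m J^T }.

End RiemannianGeometry.

(** * Spin structures and the Dirac operator *)

(* Rank of the spinor bundle; Clifford matrices of this size form an
   irreducible representation. *)
Definition spinor_rank (m : nat) : nat := (2 ^ m./2)%N.

Record clifford_matrices (R : realType) (m : nat) := CliffordMatrices {
  gam :> 'I_m -> 'M[R[i]]_(spinor_rank m);
  gam_selfadjoint : forall a, (map_mx (@conjc R) (gam a))^T = gam a;
  gam_anticomm : forall a b,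
    gam a *m gam b + gam b *m gam a = ((a == b)%:R *+ 2)%:M }.

Definition clifford_mul (R : realType) (m : nat) (gam : clifford_matrices R m)
    (v : 'rV[R]_m) : 'M[R[i]]_(spinor_rank m) :=
  \sum_a (real_complex R (v 0 a)) *: gam a.

(* The image of Spin(m) in the spinor representation: products of an even
   number of Clifford multiplications by unit vectors. *)
Definition spin_group (R : realType) (m : nat) (gam : clifford_matrices R m) :
    set 'M[R[i]]_(spinor_rank m) :=
  [set T | exists s : seq 'rV[R]_m,
    [/\ ~~ odd (size s),
        (forall v, v \in s -> v *m v^T = 1%:M) &
        T = \big[mulmx/1%:M]_(v <- s) clifford_mul gam v] ].

(* A spin structure in local form, over an atlas whose charts trivialize it
   (charts can always be shrunk to balls): on each chart a smooth orthonormal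
   frame, whose a-th vector has coordinates [row a (frame i y)], and on each
   overlap a smooth Spin(m)-valued cocycle [spin_trans i j] lifting the change
   of frames.  Spinor components transform by
   psi_i = spin_trans i j *m psi_j. *)
Record spin_structure (R : realType) (M : topologicalType) (m : nat)
    (A : smooth_atlas R M m) (g : riemannian_metric A) := SpinStructure {
  spin_gam : clifford_matrices R m;
  frame : chart_index A -> 'rV[R]_m -> 'M[R]_m;
  frame_smooth : forall i a k,
    smooth_on (chart_codom (A i)) (fun y => frame i y a k);
  frame_orthonormal : forall i y, chart_codom (A i) y ->
    frame i y *m g i y *m (frame i y)^T = 1%:M;
  spin_trans : chart_index A -> chart_index A -> M -> 'M[R[i]]_(spinor_rank m);
  spin_trans_smooth : forall i j r s,
    csmooth_on (chart_coord (A i) @` (chart_dom (A i) `&` chart_dom (A j)))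
      (fun y => spin_trans i j (chart_inv (A i) y) r s);
  spin_trans_in : forall i j x, chart_dom (A i) x -> chart_dom (A j) x ->
    spin_group spin_gam (spin_trans i j x);
  (* v and w are the components of the same tangent vector in the frames of
     charts j and i *)
  spin_trans_lift : forall i j x, chart_dom (A i) x -> chart_dom (A j) x ->
    forall v w : 'rV[R]_m,
    w *m frame i (chart_coord (A i) x) =
      v *m frame j (chart_coord (A j) x) *m transition_jacobian j i x ->
    spin_trans i j x *m clifford_mul spin_gam v =
      clifford_mul spin_gam w *m spin_trans i j x;
  spin_trans_cocycle : forall i j l x,
    chart_dom (A i) x -> chart_dom (A j) x -> chart_dom (A l) x ->
    spin_trans i j x *m spin_trans j l x = spin_trans i l x }.

Section Dirac.
Context {R : realType} {M : ptopologicalType} {m : nat}.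
Context {A : smooth_atlas R M m} {g : riemannian_metric A}.
Variable S : spin_structure g.
Variable vol : {measure set (borel M) -> \bar R}.

(* Components of a spinor in each chart; the value of [psi i x] is only
   meaningful for x in the domain of chart i. *)
Definition spinor_components := chart_index A -> M -> 'cV[R[i]]_(spinor_rank m).

(* Smooth compactly supported sections of the spinor bundle. *)
Record smooth_spinor_c (psi : spinor_components) : Prop := {
  spinor_compat : forall i j x, chart_dom (A i) x -> chart_dom (A j) x ->
    psi i x = spin_trans S i j x *m psi j x;
  spinor_smooth : forall i r,
    csmooth_on (chart_codom (A i)) (fun y => psi i (chart_inv (A i) y) r 0);
  spinor_compact_support : exists2 K : set M, compact K &
    forall i x, chart_dom (A i) x -> ~ K x -> psi i x = 0 }.

(* Gamma^lam_{mu nu} of the Levi-Civita connection in chart i. *)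
Definition christoffel (i : chart_index A) (y : 'rV[R]_m)
    (lam mu nu : 'I_m) : R :=
  2^-1 * \sum_s invmx (g i y) lam s *
    (partial mu (fun z => g i z s nu) y + partial nu (fun z => g i z s mu) y
     - partial s (fun z => g i z mu nu) y).

(* omega_{mu a b} = g(e_a, nabla_mu e_b). *)
Definition frame_connection (i : chart_index A) (y : 'rV[R]_m)
    (mu a b : 'I_m) : R :=
  \sum_k \sum_l frame S i y a k * g i y k l *
    (partial mu (fun z => frame S i z b l) y
     + \sum_nu christoffel i y l mu nu * frame S i y b nu).

(* nabla_mu = d_mu + 1/4 sum_ab omega_{mu a b} gamma^a gamma^b; with
   gamma^a gamma^b + gamma^b gamma^a = 2 delta_ab this sign makes Clifford
   multiplication parallel. *)
Definition spin_connection_mx (i : chart_index A) (y : 'rV[R]_m) (mu : 'I_m) :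
    'M[R[i]]_(spinor_rank m) :=
  \sum_a \sum_b real_complex R (4^-1 * frame_connection i y mu a b) *:
    (spin_gam S a *m spin_gam S b).

Definition spin_nabla (mu : 'I_m) (psi : spinor_components) :
    spinor_components := fun i x =>
  let y := chart_coord (A i) x in
  \col_r cpartial mu (fun z => psi i (chart_inv (A i) z) r 0) y
  + spin_connection_mx i y mu *m psi i x.

(* gamma^mu = sum_a e_a^mu gamma^a. *)
Definition curved_gamma (i : chart_index A) (y : 'rV[R]_m) (mu : 'I_m) :
    'M[R[i]]_(spinor_rank m) :=
  \sum_a real_complex R (frame S i y a mu) *: spin_gam S a.

Definition dirac_op (psi : spinor_components) : spinor_components := fun i x =>
  - (Complex 0 1 : R[i]) *:
    \sum_mu curved_gamma i (chart_coord (A i) x) mu *m spin_nabla mu psi i x.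

Definition spinor_mul (f : M -> R[i]) (psi : spinor_components) :
  spinor_components := fun i x => f x *: psi i x.

Definition dirac_commutator (f : M -> R[i]) (psi : spinor_components) :
    spinor_components := fun i x =>
  dirac_op (spinor_mul f psi) i x - spinor_mul f (dirac_op psi) i x.

(* The norm of L^2(M, S). *)
Definition spinor_L2norm (psi : spinor_components) : \bar R :=
  Lnorm vol 2%:E (fun x : borel M =>
    (Num.sqrt (\sum_r (normc (psi (chart_at A x) x r 0)) ^+ 2))%:E).

(* Operator norm of [D, f] on the core of D consisting of the smooth compactly
   supported spinors, which are dense in L^2(M, S). *)
Definition dirac_commutator_norm (f : M -> R[i]) : \bar R :=
  ereal_sup [set spinor_L2norm (dirac_commutator f psi) |
    psi in [set psi | smooth_spinor_c psi /\ (spinor_L2norm psi <= 1)%E] ].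

End Dirac.

(** * States, spectral distance, mean points *)

Definition C0 {R : realType} {M : topologicalType} : set (M -> R[i]) :=
  [set f | [/\ continuous (fun x => complex.Re (f x)),
    continuous (fun x => complex.Im (f x)) &
    forall e : R, 0 < e -> exists2 K : set M, compact K &
      forall x, ~ K x -> normc (f x) < e] ].

Definition C0_smooth {R : realType} {M : topologicalType} {m : nat}
    (A : smooth_atlas R M m) : set (M -> R[i]) :=
  [set f | C0 f /\ forall i,
    csmooth_on (chart_codom (A i)) (fun y => f (chart_inv (A i) y))].

(* Positive linear functionals of norm 1 on C_0(M); only the values on C_0(M)
   matter. *)
Record is_state {R : realType} {M : topologicalType}
    (phi : (M -> R[i]) -> R[i]) : Prop := {
  state_linear : forall (a : R[i]) (f h : M -> R[i]), C0 f -> C0 h ->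
    phi (fun x => a * f x + h x) = a * phi f + phi h;
  state_positive : forall f, C0 f -> (forall x, 0 <= f x) -> 0 <= phi f;
  state_norm1 : ereal_sup [set (normc (phi f))%:E |
    f in [set f | C0 f /\ forall x, normc (f x) <= 1] ] = 1%E }.

Section StatesAndDistances.
Context {R : realType} {M : ptopologicalType}.

Definition state_measure (phi : (M -> R[i]) -> R[i])
    (mu : probability (borel M) R) : Prop :=
  forall f, C0 f ->
    phi f = Complex (\int[mu]_x (complex.Re (f x))) (\int[mu]_x (complex.Im (f x))).

Definition spectral_distance {m : nat} {A : smooth_atlas R M m}
    {g : riemannian_metric A} (S : spin_structure g)
    (vol : {measure set (borel M) -> \bar R})
    (phi1 phi2 : (M -> R[i]) -> R[i]) : \bar R :=
  ereal_sup [set (normc (phi1 f - phi2 f))%:E |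
    f in [set f | C0_smooth A f /\ (dirac_commutator_norm S vol f <= 1)%E] ].

Definition finite_first_moment {m : nat} {A : smooth_atlas R M m}
    (g : riemannian_metric A) (mu : probability (borel M) R) : Prop :=
  exists x0 : M, (\int[mu]_x geodesic_dist g x0 x < +oo)%E.

Definition barycenter {n : nat} (N : M -> 'rV[R]_n)
    (mu : probability (borel M) R) : 'rV[R]_n :=
  \row_j fine (\int[pushforward mu (N : borel M -> borel 'rV[R]_n)]_xi
    ((xi : 'rV[R]_n) 0 j)%:E)%E.

Definition mean_point {n : nat} (N : M -> 'rV[R]_n)
    (mu : probability (borel M) R) : M :=
  get [set x | N x = barycenter N mu].

End StatesAndDistances.

(* Main.v *)
(* Since N(M) is convex, the segment joining two points of N(M) pulls back to a
   curve of the same length, so that d(x, y) = |N x - N y|.  By completeness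
   N(M) is closed; projecting the barycenter on this closed convex set shows
   that it belongs to it.

   Lower bound: for a unit vector u, the functions
   f_k = (u.N) / (1 + |N|^2 / (k+1)) vanish at infinity and have gradient of
   norm at most 1, and [D, f] is Clifford multiplication by grad f, which scales
   the norm of a spinor by |grad f|.  By dominated convergence the difference
   of the two states on f_k tends to u.(b1 - b2), b1 and b2 the barycenters.

   Upper bound: if |grad f|^2 > 1 at a point, then, by a trace computation, some
   constant spinor is expanded by the Clifford multiplication near this point;
   multiplying it by a smooth bump function gives a spinor psi with
   |[D, f] psi| > |psi|.  Hence f is 1-Lipschitz if |[D, f]| <= 1, and one
   integrates f(x) - f(y) <= d(x, y). *)

From HB Require Import structures.
Require Import Defs.
From mathcomp Require Import all_boot all_order all_algebra.
From mathcomp Require Import all_classical all_reals all_analysis.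
From mathcomp Require Import perm measurable_realfun.
From mathcomp Require Import ring lra.

Set Implicit Arguments.
Unset Strict Implicit.
Unset Printing Implicit Defensive.
Import Order.TTheory GRing.Theory Num.Theory.
Import numFieldNormedType.Exports.
Import ComplexField.Normc.

Local Open Scope classical_set_scope.
Local Open Scope ring_scope.

(** * Differentiability of C^1 functions *)

(** For a complex [f] the gradient is a complex vector, and Clifford multiplication by it is no
    longer a multiple of an isometry. Its operator norm may exceed the length of the vector, but its
    mean square over the basis spinors is the squared length, and this is the inequality that the
    upper bound needs. It gives |grad Re f|^2 + |grad Im f|^2 <= 1, hence a gradient of norm at most
    1 for every p Re f + q Im f with p^2 + q^2 = 1; the phase (p, q) is then chosen so that the
    modulus of the difference of the states becomes a real difference. The functions u.N have
    gradient at most 1 but need not vanish at infinity. Damping them in terms of |N| cures this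
    because [N] is proper, which rests on the closedness of its range. The charts selected by
    [chart_at] are arbitrary. Estimates made in one fixed chart are moved to the selected one by
    [spin_trans], whose values are isometries of spinors. The inverse metric is always E^T E, with E
    the orthonormal frame of the spin structure. *)

Lemma cvg_fsum {R : realType} {T I : Type} {F : set_system T} {FF : Filter F}
    (r : seq I) (f : I -> T -> R) (l : I -> R) :
  (forall i, f i x @[x --> F] --> l i) ->
  \sum_(i <- r) f i x @[x --> F] --> \sum_(i <- r) l i.
Proof.
move=> fl; elim: r => [|a r IH].
  by rewrite big_nil; under eq_fun do rewrite big_nil; exact: cvg_cst.
by rewrite big_cons; under eq_fun do rewrite big_cons; apply: cvgD.
Qed.

Section LinForm.
Context {R : realType} {m : nat}.

Definition lin_form (D : 'I_m -> R) (h : 'rV[R]_m) : R := \sum_k h 0 k * D k.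

Lemma lin_form_linear D : linear (lin_form D : 'rV[R]_m -> (R : normedModType R)).
Proof.
move=> a u v; rewrite /lin_form scaler_sumr -big_split /=.
by apply: eq_bigr => k _; rewrite !mxE mulrDl -mulrA.
Qed.

HB.instance Definition _ (D : 'I_m -> R) :=
  GRing.isLinear.Build R 'rV[R]_m (R : normedModType R) _ (lin_form D)
    (lin_form_linear D).

Lemma continuous_lin_form (D : 'I_m -> R) : continuous (lin_form D).
Proof.
move=> y; apply: (@cvg_fsum R _ _ (nbhs y) _ _ (fun k (y : 'rV[R]_m) => y 0 k * D k)) =>
  k.
by apply: cvgM; [exact: coord_continuous|exact: cvg_cst].
Qed.

Lemma is_derive_line (f : 'rV[R]_m -> R) (a v : 'rV[R]_m) (s : R) :
  derivable f (a + s *: v) v ->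
  is_derive s 1 (fun t : R => f (a + t *: v)) ('D_v f (a + s *: v)).
Proof.
move=> df.
have E : (fun h : R => h^-1 *: (((fun t : R => f (a + t *: v)) \o shift s) (h *: 1) - f
  (a + s *: v)))
   = (fun h : R => h^-1 *: ((f \o shift (a + s *: v)) (h *: v) - f (a + s *: v))).
  apply/funext => h /=; congr (_ *: (f _ - _)).
  by rewrite scalerDl [h%:A]mulr1 addrCA.
by split; rewrite /derivable /derive E.
Qed.

(** Covers both signs of [t]; of the position of the intermediate point only |c| <= |t| is kept,
    which is what an estimate in a ball uses. *)
Lemma mvt_line (f : 'rV[R]_m -> R) (a v : 'rV[R]_m) (t : R) :
  (forall s : R, `|s| <= `|t| -> derivable f (a + s *: v) v) ->
  exists2 c, `|c| <= `|t| & f (a + t *: v) - f a = t * 'D_v f (a + c *: v).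
Proof.
move=> df; pose phi (s : R) := f (a + s *: v).
have dphi (s : R) : `|s| <= `|t| -> is_derive s 1 phi ('D_v f (a + s *: v)).
  by move=> /df; exact: is_derive_line.
have cphi (s : R) : `|s| <= `|t| -> {for s, continuous phi}.
  by move=> /dphi[d _]; apply: differentiable_continuous; exact/derivable1_diffP.
have p0 : phi 0 = f a by rewrite /phi scale0r addr0.
have [t0|t0] := leP 0 t.
  have nt (s : R) : s \in `[0, t] -> `|s| <= `|t|.
    by rewrite in_itv /= => /andP[s0 st]; rewrite !ger0_norm.
  have [||c /nt ct E] := @MVT_segment _ phi (fun s => 'D_v f (a + s *: v)) 0 t t0.
  - by move=> s st; apply: dphi; apply: nt; exact: subset_itv_oo_cc.
  - by apply: continuous_in_subspaceT => s /set_mem /= st; apply: cphi; exact: nt.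
  by exists c => //; rewrite -p0 -/(phi t) E subr0 mulrC.
have nt (s : R) : s \in `[t, 0] -> `|s| <= `|t|.
  rewrite in_itv /= => /andP[s0 st]; rewrite !ler0_norm ?lerN2// ltW//.
have [||c /nt ct E] := @MVT_segment _ phi (fun s => 'D_v f (a + s *: v)) t 0 (ltW t0).
- by move=> s st; apply: dphi; apply: nt; exact: subset_itv_oo_cc.
- by apply: continuous_in_subspaceT => s /set_mem /= st; apply: cphi; exact: nt.
by exists c => //; rewrite -p0 -/(phi t) -opprB E sub0r mulrN opprK mulrC.
Qed.

Let trunc (n : nat) (h : 'rV[R]_m) : 'rV[R]_m :=
  \row_j (if (j < n)%N then h 0 j else 0).

Lemma coord_le_norm (h : 'rV[R]_m) k : `|h 0 k| <= `|h|.
Proof. by rewrite [leRHS]/Num.Def.normr/= mx_normrE; exact: (le_bigmax _ _ (0, k)). Qed.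

Lemma norm_le_coord (h : 'rV[R]_m) (e : R) : 0 <= e ->
  (forall k, `|h 0 k| <= e) -> `|h| <= e.
Proof.
move=> e0 he; rewrite [leLHS]/Num.Def.normr/= mx_normrE.
by apply/bigmax_le => // -[i j] _ /=; rewrite ord1.
Qed.

Lemma norm_lt_coord (h : 'rV[R]_m) (e : R) : 0 < e ->
  (forall k, `|h 0 k| < e) -> `|h| < e.
Proof.
move=> e0 he; rewrite [ltLHS]/Num.Def.normr/= mx_normrE.
by apply/bigmax_lt => // -[i j] _ /=; rewrite ord1.
Qed.

Lemma trunc_norm n h : `|trunc n h| <= `|h|.
Proof.
apply: norm_le_coord => // k; rewrite mxE.
by case: ifP => _; [exact: coord_le_norm|rewrite normr0].
Qed.

Let trunc_full h : trunc m h = h.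
Proof. by apply/rowP => j; rewrite mxE ltn_ord. Qed.

Let truncS n h (nm : (n < m)%N) :
  trunc n.+1 h = trunc n h + h 0 (Ordinal nm) *: delta_mx 0 (Ordinal nm).
Proof.
apply/rowP => j; rewrite !mxE eqxx /= ltnS leq_eqVlt -val_eqE /=.
have [jn|jn] := eqVneq (j : nat) n; last by rewrite orFb mulr0 addr0.
by rewrite jn ltnn mulr1 add0r orTb; congr (h 0 _); exact/val_inj.
Qed.

Lemma norm_delta_le (k : 'I_m) : `|delta_mx 0 k : 'rV[R]_m| <= 1.
Proof.
apply: norm_le_coord => // j; rewrite mxE eqxx /=.
by case: eqP => _; rewrite ?normr1 ?normr0.
Qed.

Let increment (f : 'rV[R]_m -> R) (y0 : 'rV[R]_m) (n : nat) (h : 'rV[R]_m) : R :=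
  f (y0 + trunc n h) - f y0 - lin_form (fun k => partial k f y0) (trunc n h).

(* Move from [y0] to [y0 + h] one coordinate at a time, and apply the mean
   value theorem to each step. *)
Lemma C1_littleo (f : 'rV[R]_m -> R) (y0 : 'rV[R]_m) (e : R) : 0 < e ->
  (forall k, \forall y \near y0, derivable f y (delta_mx 0 k)) ->
  (forall k, {for y0, continuous (partial k f)}) ->
  \forall h \near (0 : 'rV[R]_m),
    `|f (y0 + h) - f y0 - lin_form (fun k => partial k f y0) h| <= e * `|h|.
Proof.
move=> e0 df cf.
(* There are m steps, each allowed an error e/(m+1) times |h|; [m.+1] keeps the quotient meaningful
   for m = 0. *)
have m0 : 0 < e / m.+1%:R :> R by rewrite divr_gt0.
have : \forall y \near y0, forall k, derivable f y (delta_mx 0 k) /\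
    `|partial k f y - partial k f y0| <= e / m.+1%:R.
  apply: (@filter_forall _ _ _ (nbhs y0)) => k; apply: filterI; first exact: df.
  have /cvgrPdist_le/(_ _ m0) := cf k.
  by apply: filterS => y; rewrite distrC.
move=> /nbhs_ballP[d /= d0 dP].
have {}dP y : `|y - y0| < d -> forall k, derivable f y (delta_mx 0 k) /\
    `|partial k f y - partial k f y0| <= e / m.+1%:R.
  by move=> yd; apply: dP; rewrite -ball_normE /= distrC.
(* Half of the radius is for the truncated increment, half for the next coordinate step. *)
have d2 : 0 < d / 2 by rewrite divr_gt0.
apply/nbhs_ballP; exists (d / 2) => // h; rewrite -ball_normE /= sub0r normrN => hd.
suff H n : (n <= m)%N -> `|increment f y0 n h| <= n%:R * (e / m.+1%:R * `|h|).
  have := H m (leqnn m); rewrite /increment trunc_full => /le_trans; apply.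
  rewrite mulrA ler_wpM2r//.
  by rewrite mulrCA ger_pMr// ler_pdivrMr ?ltr0n// mul1r ler_nat.
elim: n => [_|n IH nm].
  rewrite /increment (_ : trunc 0 h = 0); last by apply/rowP => j; rewrite !mxE.
  by rewrite addr0 linear0 subrr subr0 normr0 mul0r.
have := IH (ltnW nm); set k := Ordinal nm.
have hk := coord_le_norm h k.
have near_tr c : `|c| <= `|h 0 k| -> `|(y0 + trunc n h + c *: delta_mx 0 k) - y0| < d.
  move=> ch; rewrite addrAC (addrAC y0) subrr add0r (le_lt_trans (ler_normD _ _))//.
  rewrite (splitr d) ltr_leD//; first exact: le_lt_trans (trunc_norm _ _) hd.
  rewrite normrZ (le_trans (ler_wpM2l _ (norm_delta_le k)))// mulr1.
  exact: le_trans (le_trans ch hk) (ltW hd).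
have [|c ch E] := @mvt_line f (y0 + trunc n h) (delta_mx 0 k) (h 0 k).
  by move=> s sh; have [] := dP _ (near_tr _ sh) k.
have [_ pk] := dP _ (near_tr _ ch) k.
rewrite /increment truncS -/k linearD linearZ /=.
have -> : lin_form (fun k => partial k f y0) (delta_mx 0 k) = partial k f y0.
  rewrite /lin_form (bigD1 k)//= big1 ?addr0 => [|j jk].
    by rewrite mxE !eqxx mul1r.
  by rewrite mxE eqxx (negbTE jk) mul0r.
move=> IHn; rewrite addrA.
rewrite (_ : _ - _ = (f (y0 + trunc n h) - f y0 -
  lin_form (fun k => partial k f y0) (trunc n h)) + (h 0 k *
  (partial k f (y0 + trunc n h + c *: delta_mx 0 k) - partial k f y0))); last first.
  rewrite mulrBr /partial -E /= /GRing.scale /=; ring.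
rewrite -natr1 mulrDl mul1r (le_trans (ler_normD _ _))// lerD//.
by rewrite normrM mulrC ler_pM.
Qed.

Lemma C1_diff (f : 'rV[R]_m -> R) (y0 : 'rV[R]_m) :
  (forall k, \forall y \near y0, derivable f y (delta_mx 0 k)) ->
  (forall k, {for y0, continuous (partial k f)}) ->
  is_diff y0 f (lin_form (fun k => partial k f y0)).
Proof.
move=> df cf; set D := lin_form _.
have cD : continuous D by exact: continuous_lin_form.
have D1 : f \o shift y0 = cst (f y0) + D +o_ (nbhs (0 : 'rV[R]_m)) id.
  apply/eqaddoP => _/posnumP[e].
  apply: (@filterS _ (nbhs (0 : 'rV[R]_m)) _ _ _ _ (@C1_littleo f y0 e%:num _ df cf)) =>
    // h.
  by rewrite opprD addrA !fctE /= (addrC h).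
have du : 'd f y0 = D :> (_ -> _) by exact: diff_unique.
by split => //; apply/diff_locallyP; rewrite du.
Qed.

End LinForm.

(** * Smooth functions *)

(** Reduces a directional derivative to one real variable, where [is_derive1_comp] serves as chain
    rule. *)
Lemma is_derive_lineP {R : realType} {V W : normedModType R} (f : V -> W) (a v : V)
  (d : W) :
  is_derive a v f d <-> is_derive (0 : R) 1 (fun s : R => f (a + s *: v)) d.
Proof.
have E : (fun h : R => h^-1 *: (((fun t : R => f (a + t *: v)) \o shift 0) (h *: 1) - f
  (a + 0 *: v)))
   = (fun h : R => h^-1 *: ((f \o shift a) (h *: v) - f a)).
  apply/funext => h /=; rewrite scale0r addr0 [h%:A]mulr1 addr0.
  by rewrite (addrC a).
by split => -[dd <-]; split; rewrite /derivable /derive ?E // -E.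
Qed.

Lemma near_open {T : topologicalType} (U : set T) (y : T) (P : T -> Prop) :
  open U -> U y -> (forall z, U z -> P z) -> \forall z \near y, P z.
Proof. by move=> oU Uy UP; apply: filterS (open_nbhs_nbhs (conj oU Uy)). Qed.

Section SmoothOn.
Context {R : realType} {m : nat}.
Implicit Types (U : set 'rV[R]_m) (f g : 'rV[R]_m -> R).

Lemma derivable_eq_on U f g y v : open U -> (forall z, U z -> f z = g z) -> U y ->
  derivable f y v -> derivable g y v.
Proof.
move=> oU fg Uy; apply: near_eq_derivable.
exact: (near_open oU Uy fg).
Qed.

Lemma derive_eq_on U f g y v : open U -> (forall z, U z -> f z = g z) -> U y ->
  'D_v f y = 'D_v g y.
Proof.
move=> oU fg Uy; apply: near_eq_derive.
exact: (near_open oU Uy fg).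
Qed.

Lemma continuous_eq_on U f g y : open U -> (forall z, U z -> f z = g z) -> U y ->
  {for y, continuous f} -> {for y, continuous g}.
Proof.
move=> oU fg Uy; rewrite /prop_for /continuous_at fg// => cf.
apply: cvg_trans cf; apply: (@near_eq_cvg _ _ (nbhs y) _ f g).
exact: (near_open oU Uy fg).
Qed.

(* Class C^n on U, whose stability properties are proved by induction on n. *)
Fixpoint class_C (n : nat) U f : Prop :=
  (forall y, U y -> {for y, continuous f}) /\
  if n is n'.+1 then
    (forall y k, U y -> derivable f y (delta_mx 0 k)) /\
    forall k, class_C n' U (partial k f)
  else True.

Lemma smooth_on_partial U f k : smooth_on U f -> smooth_on U (partial k f).
Proof. by move=> sf s y /(sf (rcons s k)); rewrite foldr_rcons. Qed.

Lemma smooth_onP U f : smooth_on U f <-> forall n, class_C n U f.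
Proof.
split.
  move=> + n; elim: n f => [|n IH] f sf /=.
    by split=> // y /(sf [::])[].
  split; first by move=> y /(sf [::])[].
  split; first by move=> y k /(sf [::])[_]; exact.
  by move=> k; exact/IH/smooth_on_partial.
move=> + s; elim/last_ind: s f => [|s k IH] f Cf y Uy /=.
  have /= [cf [df _]] := Cf 1%N; split; first exact: cf.
  by move=> k; exact: df.
rewrite foldr_rcons; apply: IH => // n.
by have /= [_ [_]] := Cf n.+1; exact.
Qed.

Lemma class_CW n U f : class_C n.+1 U f -> class_C n U f.
Proof.
elim: n f => [|n IH] f /=; first by case.
by move=> [cf [df pf]]; split=> //; split=> // k; exact/IH/pf.
Qed.

Lemma class_C_ext n U f g : open U -> (forall y, U y -> f y = g y) ->
  class_C n U f -> class_C n U g.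
Proof.
move=> oU; elim: n f g => [|n IH] f g fg /=.
  by move=> [cf _]; split=> // y Uy; exact: (continuous_eq_on oU fg Uy (cf _ Uy)).
move=> [cf [df pf]]; split; first by move=> y Uy;
  exact: (continuous_eq_on oU fg Uy (cf _ Uy)).
split; first by move=> y k Uy; exact: (derivable_eq_on oU fg Uy (df _ _ Uy)).
by move=> k; apply: IH (pf k) => y Uy; exact: derive_eq_on oU fg Uy.
Qed.

Lemma class_C_cst n U c : class_C n U (fun=> c).
Proof.
elim: n c => [|n IH] c /=; first by split=> // y _; exact: cst_continuous.
split; first by move=> y _; exact: cst_continuous.
split; first by move=> y k _; exact: derivable_cst.
move=> k; rewrite (_ : partial k _ = fun=> 0) //.
by apply/funext => y; rewrite /partial derive_cst.
Qed.

Lemma class_CD n U f g : open U -> class_C n U f -> class_C n U g ->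
  class_C n U (fun y => f y + g y).
Proof.
move=> oU; elim: n f g => [|n IH] f g /=.
  by move=> [cf _] [cg _]; split=> // y Uy; apply: continuousD; [exact: cf|exact: cg].
move=> [cf [df pf]] [cg [dg pg]].
split; first by move=> y Uy; apply: continuousD; [exact: cf|exact: cg].
split; first by move=> y k Uy; apply: derivableD; [exact: df|exact: dg].
move=> k; apply: class_C_ext (IH _ _ (pf k) (pg k)) => // y Uy.
by rewrite /partial -deriveD//; [exact: df|exact: dg].
Qed.

Lemma class_CM n U f g : open U -> class_C n U f -> class_C n U g ->
  class_C n U (fun y => f y * g y).
Proof.
move=> oU; elim: n f g => [|n IH] f g.
  by move=> [cf _] [cg _]; split=> // y Uy; apply: continuousM; [exact: cf|exact: cg].
move=> Cf Cg; have [/= cf [df pf]] := Cf; have [/= cg [dg pg]] := Cg.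
split; first by move=> y Uy; apply: continuousM; [exact: cf|exact: cg].
split; first by move=> y k Uy; apply: derivableM; [exact: df|exact: dg].
move=> k.
apply: (@class_C_ext _ _ (fun y => f y * partial k g y + g y * partial k f y)) => //.
  by move=> y Uy; rewrite /partial -deriveM//; [exact: df|exact: dg].
apply: class_CD => //; apply: IH; [exact: class_CW|exact: pg|exact: class_CW|exact: pf].
Qed.

Lemma class_CV n U f : open U -> (forall y, U y -> f y != 0) -> class_C n U f ->
  class_C n U (fun y => (f y)^-1).
Proof.
move=> oU f0; elim: n f f0 => [|n IH] f f0.
  by move=> [cf _]; split=> // y Uy; exact: (continuousV (f0 y Uy) (cf y Uy)).
move=> Cf; have [/= cf [df pf]] := Cf.
split; first by move=> y Uy; exact: (continuousV (f0 y Uy) (cf y Uy)).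
split; first by move=> y k Uy; apply: derivableV; [exact: f0|exact: df].
move=> k.
(* The derivative of 1/f contains 1/f itself, to which the induction hypothesis applies in the class
   below. *)
apply: (@class_C_ext _ _ (fun y => (-1 * partial k f y) * ((f y)^-1 * (f y)^-1))) => //.
  move=> y Uy; rewrite /partial deriveV; [|exact: f0|exact: df].
  by rewrite mulN1r mulNr scaleNr /GRing.scale /= mulrC -expr2 exprVn.
have CV := IH _ f0 (class_CW Cf).
exact: (class_CM oU (class_CM oU (class_C_cst _ _ _) (pf k)) (class_CM oU CV CV)).
Qed.

Lemma smooth_on_ext U f g : open U -> (forall y, U y -> f y = g y) ->
  smooth_on U f -> smooth_on U g.
Proof. by move=> oU fg /smooth_onP sf; apply/smooth_onP => n;
  exact: (class_C_ext oU fg (sf n)). Qed.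

Lemma smooth_on_cst U c : smooth_on U (fun=> c).
Proof. by apply/smooth_onP => n; exact: class_C_cst. Qed.

Lemma smooth_onD U f g : open U -> smooth_on U f -> smooth_on U g ->
  smooth_on U (fun y => f y + g y).
Proof. by move=> oU /smooth_onP sf /smooth_onP sg; apply/smooth_onP => n;
  exact: class_CD. Qed.

Lemma smooth_onM U f g : open U -> smooth_on U f -> smooth_on U g ->
  smooth_on U (fun y => f y * g y).
Proof. by move=> oU /smooth_onP sf /smooth_onP sg; apply/smooth_onP => n;
  exact: class_CM. Qed.

Lemma smooth_onV U f : open U -> (forall y, U y -> f y != 0) -> smooth_on U f ->
  smooth_on U (fun y => (f y)^-1).
Proof. by move=> oU f0 /smooth_onP sf; apply/smooth_onP => n; exact: class_CV. Qed.

Lemma smooth_onZ U f c : open U -> smooth_on U f -> smooth_on U (fun y => c * f y).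
Proof. by move=> oU; apply: smooth_onM => //; exact: smooth_on_cst. Qed.

Lemma smooth_on_sum U (I : Type) (r : seq I) (f : I -> 'rV[R]_m -> R) : open U ->
  (forall i, smooth_on U (f i)) -> smooth_on U (fun y => \sum_(i <- r) f i y).
Proof.
move=> oU sf; elim: r => [|a r IH].
  by under eq_fun do rewrite big_nil; exact: smooth_on_cst.
under eq_fun do rewrite big_cons; exact: (smooth_onD oU (sf a) IH).
Qed.

(** Used to glue: a function cut off by a bump is smooth for one reason inside a chart and for
    another outside of it. *)
Lemma smooth_on_nbhs U f :
  (forall y, U y -> exists2 V, V y & smooth_on V f) -> smooth_on U f.
Proof. by move=> H s y /H[V Vy]; exact. Qed.

Lemma smooth_on_continuous U f y : smooth_on U f -> U y -> {for y, continuous f}.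
Proof. by move=> sf /(sf [::])[]. Qed.

Lemma smooth_on_derivable U f y k : smooth_on U f -> U y -> derivable f y (delta_mx 0 k).
Proof. by move=> sf /(sf [::])[_]; exact. Qed.

Lemma smooth_on_diff U f y : open U -> smooth_on U f -> U y ->
  is_diff y f (lin_form (fun k => partial k f y)).
Proof.
move=> oU sf Uy; apply: C1_diff => k.
  by apply: near_open oU Uy _ => z; exact: smooth_on_derivable.
exact: smooth_on_continuous (smooth_on_partial k sf) Uy.
Qed.

End SmoothOn.

Section ChainRule.
Context {R : realType} {p : nat} {V : normedModType R}.

Lemma differentiable_rV (Phi : V -> 'rV[R]_p) (y : V) :
  (forall l, differentiable (fun z => Phi z 0 l) y) -> differentiable Phi y.
Proof.
move=> dPhi.
rewrite (_ : Phi = \sum_(l < p) (fun z => Phi z 0 l *: (delta_mx 0 l : 'rV[R]_p)));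
  last first.
  by apply/funext => z; rewrite fct_sumE {1}[Phi z]row_sum_delta.
apply: differentiable_sum => l; exact: differentiableZl.
Qed.

(** The source is an arbitrary normed space, so that the rule serves curves as well as changes of
    coordinates. *)
Lemma chain_rule (f : 'rV[R]_p -> R) (Phi : V -> 'rV[R]_p) (D : 'I_p -> R) (y v : V) :
  differentiable Phi y -> is_diff (Phi y) f (lin_form D) ->
  is_derive y v (fun z => f (Phi z)) (lin_form D ('D_v Phi y)).
Proof.
move=> dPhi df.
have dc : differentiable (f \o Phi) y by apply: differentiable_comp => //; exact: ex_diff.
split; first exact: diff_derivable.
by rewrite [LHS](deriveE _ dc) diff_comp//= deriveE// diff_val.
Qed.

End ChainRule.

(** * A smooth function that is flat at 0 *)

Section FlatExp.
Context {R : realType}.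

(* t^-k exp (-1/t) extended by 0.  The family is closed under derivation, which
   makes each of its members smooth. *)
Definition flat_exp (k : nat) (t : R) : R :=
  if 0 < t then t^-1 ^+ k * expR (- t^-1) else 0.

Lemma flat_exp_ge0 k t : 0 <= flat_exp k t.
Proof.
rewrite /flat_exp; case: ifPn => // t0.
by rewrite mulr_ge0 ?expR_ge0// exprn_ge0// invr_ge0 ltW.
Qed.

Lemma flat_exp_le0 k t : t <= 0 -> flat_exp k t = 0.
Proof. by rewrite /flat_exp leNgt => /negbTE ->. Qed.

Lemma flat_exp_gt0 k t : 0 < t -> 0 < flat_exp k t.
Proof. by move=> t0; rewrite /flat_exp t0 mulr_gt0 ?expR_gt0// exprn_gt0// invr_gt0. Qed.

(** With u = 1/t this is u^k <= k! e^u, a single term of the exponential series. Uniformity in t is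
    what gives differentiability at 0. *)
Lemma flat_exp_bounded k t : flat_exp k t <= k`!%:R.
Proof.
rewrite /flat_exp; case: ifPn => [t0|_]; last by rewrite ler0n.
have u0 : 0 <= t^-1 by rewrite invr_ge0 ltW.
rewrite expRN ler_pdivrMr ?expR_gt0//.
case: k => [|k]; first by rewrite expr0 mul1r -expR0 ler_expR.
rewrite mulrC -ler_pdivrMr ?ltr0n ?fact_gt0// (le_trans _ (expR_ge1Dxn k u0))//.
by rewrite lerDr.
Qed.

Lemma flat_exp0_le1 t : flat_exp 0 t <= 1.
Proof. exact: (flat_exp_bounded 0 t). Qed.

Lemma flat_expSS k t : flat_exp k t = t ^+ 2 * flat_exp k.+2 t.
Proof.
rewrite /flat_exp; case: ifPn => [t0|_]; last by rewrite mulr0.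
by rewrite mulrA -(addn2 k) exprD mulrCA -exprMn mulfV ?gt_eqF// expr1n mulr1.
Qed.

Lemma is_derive_flat_exp k (t : R) :
  is_derive t 1 (flat_exp k) (flat_exp k.+2 t - k%:R * flat_exp k.+1 t).
Proof.
have [t0|t0|->] := ltgtP t 0.
- rewrite !flat_exp_le0 ?(ltW t0)// mulr0 subr0.
  apply: (@near_eq_is_derive _ _ _ (cst 0)).
  by apply: (@near_open R [set s | s < 0]) => //= s s0; rewrite flat_exp_le0 ?(ltW s0).
- apply: (@near_eq_is_derive _ _ _ ((fun w : R => w ^+ k * expR (- w)) \o (fun s : R =>
  s^-1))).
    by apply: (@near_open R [set s | 0 < s]) => //= s s0; rewrite /flat_exp s0.
  have d1 : is_derive t 1 (fun s : R => s^-1) (- t ^- 2).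
    split; first by apply: derivableV => //; rewrite gt_eqF.
    by rewrite deriveV ?gt_eqF// derive_id /GRing.scale /= mulr1.
  have d2 (w : R) : is_derive w 1 (fun w : R => w ^+ k * expR (- w))
     (k%:R * w ^+ k.-1 * expR (- w) - w ^+ k * expR (- w)).
    have dX : is_derive w 1 (fun w : R => w ^+ k) (k%:R * w ^+ k.-1).
      by split; [exact: exprn_derivable|rewrite exp_derive /GRing.scale /= mulr1].
    have dE : is_derive w 1 (fun w : R => expR (- w)) (- expR (- w)).
      by rewrite -[- expR _]mulrN1; apply: (@is_derive1_comp R expR -%R).
    by apply: is_derive_eq; rewrite /GRing.scale /=; ring.
  apply: (is_derive_eq (@is_derive1_comp R _ _ t _ _ (d2 t^-1) d1)) => /=.
  rewrite /flat_exp t0; case: k {d2} => [|k]; rewrite -exprVn ?expr0 !exprS /=; ring.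
rewrite !flat_exp_le0// mulr0 subr0.
suff H : (h^-1 *: ((flat_exp k \o shift 0) (h *: 1) - flat_exp k 0)) @[h --> 0^'] -->
  (0 : R).
  by split; [apply/cvg_ex; exists 0|exact/cvg_lim].
rewrite flat_exp_le0//.
(* At 0 the difference quotient is h times the bounded function [flat_exp k.+2], so the derivative
   vanishes. *)
apply: (@cvg_trans _ ((fun h => h * flat_exp k.+2 h) @ (0 : R)^')).
  apply: near_eq_cvg; near=> h.
  have h0 : h != 0 by near: h; exact: nbhs_dnbhs_neq.
  by rewrite /= addr0 subr0 [h%:A]mulr1 /GRing.scale /= (flat_expSS k) expr2 -mulrA mulKf.
apply/cvgrPdist_le => e e0; near=> h.
rewrite sub0r normrN normrM (ger0_norm (flat_exp_ge0 _ _)).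
apply: (le_trans (ler_wpM2l (normr_ge0 _) (flat_exp_bounded _ _))).
rewrite -ler_pdivlMr//; near: h; apply: dnbhs0_le.
by rewrite divr_gt0.
Unshelve. all: by end_near. Qed.

Lemma continuous_flat_exp k : continuous (flat_exp k).
Proof.
move=> t; have [d _] := is_derive_flat_exp k t.
by apply: differentiable_continuous; exact/derivable1_diffP.
Qed.

(** The induction on n is uniform in [k], since a derivation brings in the members of index k + 1
    and k + 2 of the family. *)
Lemma class_C_flat_exp m n (U : set 'rV[R]_m) q k : open U -> class_C n U q ->
  class_C n U (fun y => flat_exp k (q y)).
Proof.
move=> oU; elim: n q k => [|n IH] q k.
  by move=> [cq _]; split => // y Uy; apply: continuous_comp;
    [exact: cq|exact: continuous_flat_exp].
move=> Cq; have [/= cq [dq pq]] := Cq.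
have D y l : U y -> is_derive y (delta_mx 0 l) (fun y => flat_exp k (q y))
    ((flat_exp k.+2 (q y) - k%:R * flat_exp k.+1 (q y)) * partial l q y).
  move=> Uy; apply: (iffRL (@is_derive_lineP R _ _ (fun y => flat_exp k (q y)) y
    (delta_mx 0 l) _)).
  have dl : is_derive (0 : R) 1 (fun s : R => q (y + s *: delta_mx 0 l)) (partial l q y).
    apply: (iffLR (@is_derive_lineP R _ _ q y (delta_mx 0 l) _));
      exact: (DeriveDef (dq _ _ Uy) erefl).
  have df := is_derive_flat_exp k (q (y + 0 *: delta_mx 0 l)).
  have := @is_derive1_comp R _ _ 0 _ _ df dl.
  by rewrite scale0r addr0.
split; first by move=> y Uy; apply: continuous_comp;
  [exact: cq|exact: continuous_flat_exp].
split; first by move=> y l /(D y l)[].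
move=> l; apply: (class_C_ext oU (f := fun y =>
   (flat_exp k.+2 (q y) + (- k%:R) * flat_exp k.+1 (q y)) * partial l q y)).
  by move=> y /(D y l)[_]; rewrite /partial => ->; rewrite mulNr.
have Cq' := class_CW Cq.
apply: (class_CM oU _ (pq l)); apply: (class_CD oU (IH _ _ Cq')).
exact: (class_CM oU (class_C_cst _ _ _) (IH _ _ Cq')).
Qed.

Lemma smooth_on_flat_exp m (U : set 'rV[R]_m) q k : open U -> smooth_on U q ->
  smooth_on U (fun y => flat_exp k (q y)).
Proof. by move=> oU /smooth_onP sq; apply/smooth_onP => n; exact: class_C_flat_exp. Qed.

End FlatExp.

(** * Clifford multiplication *)

Section Clifford.
Context {R : realType}.
Local Notation C := R[i].
Local Notation dag A := (map_mx (@conjc R) A)^T.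

Definition sqn {N : nat} (psi : 'cV[C]_N) : R := \sum_r normc (psi r 0) ^+ 2.

Lemma sqr_normcE (z : C) : normc z ^+ 2 = complex.Re z ^+ 2 + complex.Im z ^+ 2.
Proof. by case: z => a b /=; rewrite sqr_sqrtr// addr_ge0 ?sqr_ge0. Qed.

Lemma real_sqr_normc (z : C) : real_complex R (normc z ^+ 2) = conjc z * z.
Proof.
rewrite sqr_normcE; case: z => a b; apply/eqP; rewrite eq_complex /=.
by apply/andP; split; apply/eqP; ring.
Qed.

Lemma sqn_ge0 N (psi : 'cV[C]_N) : 0 <= sqn psi.
Proof. by apply: sumr_ge0 => r _; exact: sqr_ge0. Qed.

Lemma sqnE N (psi : 'cV[C]_N) : real_complex R (sqn psi) = (dag psi *m psi) 0 0.
Proof.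
rewrite rmorph_sum mxE; apply: eq_bigr => r _ /=.
by rewrite real_sqr_normc !mxE.
Qed.

Lemma dagM N P Q (X : 'M[C]_(N, P)) (Y : 'M[C]_(P, Q)) : dag (X *m Y) = dag Y *m dag X.
Proof. by rewrite map_mxM trmx_mul. Qed.

Lemma sqnZ N (a : C) (psi : 'cV[C]_N) : sqn (a *: psi) = normc a ^+ 2 * sqn psi.
Proof.
rewrite /sqn mulr_sumr; apply: eq_bigr => r _.
by rewrite mxE normcM exprMn.
Qed.

(** Clifford multiplication by a vector of the complexified tangent space, where the gradient of a
    complex function lives. *)
Definition clifford_cmul m (gam : clifford_matrices R m) (z : 'I_m -> C) :
    'M[C]_(spinor_rank m) := \sum_a z a *: gam a.

(** Separates real and imaginary parts because [spin_trans_lift] speaks of real vectors. *)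
Lemma clifford_cmulE m (gam : clifford_matrices R m) (z : 'I_m -> C) :
  clifford_cmul gam z = clifford_mul gam (\row_a complex.Re (z a))
    + (Complex 0 1 : C) *: clifford_mul gam (\row_a complex.Im (z a)).
Proof.
rewrite /clifford_mul scaler_sumr -big_split; apply: eq_bigr => a _ /=.
rewrite !mxE scalerA -scalerDl; congr (_ *: _).
by case: (z a) => x y; apply/eqP; rewrite eq_complex /=; apply/andP; split; apply/eqP;
  ring.
Qed.

Lemma dag_cmul m (gam : clifford_matrices R m) (z : 'I_m -> C) :
  dag (clifford_cmul gam z) = clifford_cmul gam (fun a => conjc (z a)).
Proof.
rewrite /clifford_cmul raddf_sum/= raddf_sum/=; apply: eq_bigr => a _.
by rewrite map_mxZ linearZ /= gam_selfadjoint.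
Qed.

(** Exchanging the summation indices writes the square with its factors in either order. The sum of
    the two forms is a sum of anticommutators, of which only the diagonal ones survive. *)
Lemma clifford_sqr m (gam : clifford_matrices R m) (v : 'rV[R]_m) :
  clifford_mul gam v *m clifford_mul gam v = (real_complex R (\sum_a v 0 a ^+ 2))%:M.
Proof.
set X := _ *m _.
have E : X = \sum_a \sum_b real_complex R (v 0 a * v 0 b) *: (gam a *m gam b).
  rewrite /X /clifford_mul mulmx_suml; apply: eq_bigr => a _.
  rewrite mulmx_sumr; apply: eq_bigr => b _.
  by rewrite -scalemxAl -scalemxAr scalerA rmorphM.
have E' : X = \sum_a \sum_b real_complex R (v 0 a * v 0 b) *: (gam b *m gam a).
  rewrite E exchange_big; apply: eq_bigr => a _; apply: eq_bigr => b _.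
  by rewrite (mulrC (v 0 b)).
have two : (2 : C) != 0 by rewrite pnatr_eq0.
apply: (@scalerI _ _ 2) => //.
rewrite scaler_nat mulr2n {1}E E' -big_split /= raddf_sum raddf_sum scaler_sumr /=.
apply: eq_bigr => a _; rewrite -big_split /= (bigD1 a)//= big1 ?addr0.
  by rewrite -scalerDr gam_anticomm eqxx -expr2 !scale_scalar_mx mulrC.
move=> b ba; rewrite -scalerDr gam_anticomm eq_sym (negbTE ba) mul0rn.
by rewrite raddf0 scaler0.
Qed.

Lemma sqn_isometry N (T : 'M[C]_N) (c : R) (psi : 'cV[C]_N) :
  dag T *m T = (real_complex R c)%:M -> sqn (T *m psi) = c * sqn psi.
Proof.
move=> TT; apply: (@complexI R); rewrite rmorphM /= !sqnE dagM -mulmxA (mulmxA (dag T))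
  TT.
by rewrite mul_scalar_mx -scalemxAr mxE.
Qed.

Lemma clifford_mul_cmul m (gam : clifford_matrices R m) (v : 'rV[R]_m) :
  clifford_mul gam v = clifford_cmul gam (fun a => real_complex R (v 0 a)).
Proof. by []. Qed.

Lemma dag_clifford m (gam : clifford_matrices R m) (v : 'rV[R]_m) :
  dag (clifford_mul gam v) = clifford_mul gam v.
Proof.
rewrite !clifford_mul_cmul dag_cmul; apply: eq_bigr => a _.
by rewrite conjc_real.
Qed.

Lemma sqn_clifford m (gam : clifford_matrices R m) (v : 'rV[R]_m) psi :
  sqn (clifford_mul gam v *m psi) = (\sum_a v 0 a ^+ 2) * sqn psi.
Proof. by apply: sqn_isometry; rewrite dag_clifford clifford_sqr. Qed.

(** Clifford multiplication by a unit vector is an isometry. Consequently the pointwise norm of a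
    spinor does not depend on the chart. *)
Lemma sqn_spin m (gam : clifford_matrices R m) T psi :
  spin_group gam T -> sqn (T *m psi) = sqn psi.
Proof.
move=> [s [_ + ->]]; elim: s => [_|v s IH us]; first by rewrite big_nil mul1mx.
rewrite big_cons -mulmxA sqn_clifford IH => [|w ws].
  have /matrixP/(_ 0 0) := us v (mem_head _ _).
  rewrite !mxE eqxx /= => vv; rewrite -[RHS]mul1r; congr (_ * _); apply: etrans vv.
  by apply: eq_bigr => a _; rewrite mxE.
by apply: us; rewrite in_cons ws orbT.
Qed.

(** The trace is cyclic, so twice this trace is the trace of the anticommutator. *)
Lemma gam_trace m (gam : clifford_matrices R m) a b :
  \tr (gam a *m gam b) = ((a == b)%:R * (spinor_rank m)%:R).
Proof.
have two : (2 : C) != 0 by rewrite pnatr_eq0.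
apply: (mulfI two); rewrite [LHS]mulr_natl [LHS]mulr2n [X in _ + X]mxtrace_mulC -raddfD
  /=.
by rewrite gam_anticomm mxtrace_scalar -[LHS]mulr_natr -[X in X * _]mulr_natl mulrA.
Qed.

Lemma sqn_mul_delta N (T : 'M[C]_N) :
  real_complex R (\sum_r sqn (T *m delta_mx r 0)) = \tr (dag T *m T).
Proof.
rewrite rmorph_sum /=; apply: eq_bigr => r _.
rewrite sqnE dagM -mulmxA (mulmxA (dag T)) mulmxA.
rewrite map_delta_mx trmx_delta -rowE -colE !mxE.
by apply: eq_bigr => s _; rewrite !mxE.
Qed.

(* The squared Hilbert-Schmidt norm of Clifford multiplication by z is the rank
   times |z|^2. *)
Lemma clifford_cmul_large m (gam : clifford_matrices R m) (z : 'I_m -> C) :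
  exists r, \sum_a normc (z a) ^+ 2 <= sqn (clifford_cmul gam z *m delta_mx r 0).
Proof.
set W := \sum_a _.
have E : \sum_r sqn (clifford_cmul gam z *m delta_mx r 0) = (spinor_rank m)%:R * W.
  apply: (@complexI R); rewrite sqn_mul_delta dag_cmul rmorphM rmorph_sum /=.
  rewrite rmorph_nat mulr_sumr mulmx_suml raddf_sum /=; apply: eq_bigr => a _.
  rewrite mulmx_sumr raddf_sum (bigD1 a)//= big1 ?addr0.
    rewrite -scalemxAl -scalemxAr scalerA linearZ /= gam_trace eqxx mul1r.
    by rewrite real_sqr_normc mulrC.
  move=> b ba; rewrite -scalemxAl -scalemxAr scalerA linearZ /= gam_trace.
  by rewrite eq_sym (negbTE ba) mul0r mulr0.
apply: contrapT => H.
have lt r : sqn (clifford_cmul gam z *m delta_mx r 0) < W.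
  by rewrite ltNge; apply/negP => Wr; apply: H; exists r.
(* The rank is a power of 2, so there is a basis spinor and the sum of the strict inequalities is
   strict. *)
have r0 : 'I_(spinor_rank m) by apply: (@Ordinal _ 0); rewrite expn_gt0.
have : \sum_(r < spinor_rank m) sqn (clifford_cmul gam z *m delta_mx r 0) <
       \sum_(r < spinor_rank m) W.
  by apply: ltr_sum => //; apply/hasP; exists r0 => //; exact: mem_index_enum.
by rewrite E sumr_const card_ord mulr_natl ltxx.
Qed.

End Clifford.

(** * Integration *)

(* Measurability is not needed, because the integral of a nonnegative function
   is a supremum over the simple functions below it.  The selection [chart_at]
   is arbitrary, so that the integrands defined with it need not be measurable. *)
Lemma le_integral_any d (T : measurableType d) (R : realType)
    (mu : {measure set T -> \bar R}) (D : set T) (f g : T -> \bar R) :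
  (forall x, D x -> (0 <= f x)%E) -> (forall x, D x -> (f x <= g x)%E) ->
  (\int[mu]_(x in D) f x <= \int[mu]_(x in D) g x)%E.
Proof.
move=> f0 fg.
have g0 x : D x -> (0 <= g x)%E by move=> Dx; exact: le_trans (f0 _ Dx) (fg _ Dx).
rewrite !ge0_integralE//; apply: ereal_sup_le => _ [h hf <-]; exists h => // x.
by apply: le_trans (hf x) _; exact: lee_restrict.
Qed.

Section IteratedIntegral.
Context {R : realType}.

Lemma lebesgue_integral_rV_ge0 m (f : 'rV[R]_m -> \bar R) :
  (forall y, (0 <= f y)%E) -> (0 <= lebesgue_integral_rV f)%E.
Proof.
elim: m f => [|m IH] f f0 /=; first exact: f0.
by apply: integral_ge0 => x _; exact: IH.
Qed.

Let rV_subE p (B a : 'rV[R]_p) k : (B - a) 0 k = B 0 k - a 0 k.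
Proof. by rewrite !mxE. Qed.

(** A ball of the sup norm is a cube, hence the product of an interval and a cube of lower
    dimension, which matches the recursion of [lebesgue_integral_rV]. *)
Lemma norm_row_mx_lt m (x : R) (y : 'rV[R]_m) (a : 'rV[R]_(1 + m)) (r : R) : 0 < r ->
  (`|row_mx (x%:M : 'rV_1) y - a| < r) <->
  (`|x - a 0 0| < r /\ `|y - rsubmx a| < r).
Proof.
move=> r0; have e0 : lshift m (0 : 'I_1) = 0 by apply: val_inj.
split=> [H|[H1 H2]].
  split.
    have := le_lt_trans (coord_le_norm _ (lshift m (0 : 'I_1))) H.
    by rewrite rV_subE row_mxEl mxE mulr1n e0.
  apply: norm_lt_coord => // k.
  have := le_lt_trans (coord_le_norm _ (rshift 1 k)) H.
  by rewrite !rV_subE row_mxEr [rsubmx _ _ _]mxE.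
apply: norm_lt_coord => // k; rewrite !mxE; case: splitP => j kj.
  rewrite (ord1 j) mxE mulr1n; suff -> : k = 0 by [].
  by apply: val_inj; rewrite /= kj (ord1 j).
have := le_lt_trans (coord_le_norm _ j) H2; rewrite !mxE.
by suff -> : k = rshift 1 j by []; apply: val_inj.
Qed.

Let cube_itv (a r : R) : [set x | `|x - a| < r] = `]a - r, a + r[%classic.
Proof.
apply/seteqP; split=> x /=; rewrite in_itv /= ltr_distl; first by move=> /andP[-> ->].
by move=> /andP[-> ->].
Qed.

Let integral_cube (a r c : R) : 0 < r ->
  (\int[lebesgue_measure]_(x in [set x : R | (`|x - a| < r)%R]) c%:E
    = (c * (2 * r))%:E)%E.
Proof.
move=> r0; rewrite cube_itv (integral_cst _ _ c%:E)//= lebesgue_measure_itv/= lte_fin.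
rewrite ltrBlDr -addrA ltrDl addr_gt0// -EFinB -EFinM; congr (_ * _)%:E; lra.
Qed.

(** (2r)^m is the volume of the cube. With the companion bound from above, this makes the volumes of
    small coordinate cubes positive and finite. *)
Lemma lebesgue_integral_rV_lower m (f : 'rV[R]_m -> \bar R) (a : 'rV[R]_m) (r c : R) :
  0 < r -> 0 <= c -> (forall y, (0 <= f y)%E) ->
  (forall y, `|y - a| < r -> (c%:E <= f y)%E) ->
  ((c * (2 * r) ^+ m)%:E <= lebesgue_integral_rV f)%E.
Proof.
move=> r0 c0; elim: m f a => [|m IH] f a f0 cf /=.
  by rewrite expr0 mulr1; apply: cf; rewrite (_ : _ - a = 0) ?normr0// thinmx0.
rewrite exprSr mulrA -(@integral_cube (a 0 0)) // integral_mkcond.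
apply: le_integral_any => x _; rewrite /patch.
  by case: ifP => // _; rewrite lee_fin mulr_ge0// exprn_ge0// mulr_ge0// ltW.
case: ifPn => [/set_mem /= xa|_]; last exact: lebesgue_integral_rV_ge0.
apply: (IH _ (rsubmx (a : 'rV_(1 + m)))) => // y ya; apply: cf.
by apply/(@norm_row_mx_lt m x y a r r0).
Qed.

Lemma lebesgue_integral_rV_upper m (f : 'rV[R]_m -> \bar R) (a : 'rV[R]_m) (r c : R) :
  0 < r -> 0 <= c -> (forall y, (0 <= f y)%E) ->
  (forall y, `|y - a| < r -> (f y <= c%:E)%E) ->
  (forall y, ~ (`|y - a| < r) -> f y = 0%E) ->
  (lebesgue_integral_rV f <= (c * (2 * r) ^+ m)%:E)%E.
Proof.
move=> r0 c0; elim: m f a => [|m IH] f a f0 cf zf /=.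
  by rewrite expr0 mulr1; apply: cf; rewrite (_ : _ - a = 0) ?normr0// thinmx0.
rewrite exprSr mulrA -(@integral_cube (a 0 0)) // [X in (_ <= X)%E]integral_mkcond.
apply: le_integral_any => x _; first exact: lebesgue_integral_rV_ge0.
rewrite /patch; case: ifPn => [/set_mem /= xa|/negP xa].
  apply: (IH _ (rsubmx (a : 'rV_(1 + m)))) => // y ya.
    by apply: cf; apply/(@norm_row_mx_lt m x y a r r0).
  by apply: zf; move=> /(@norm_row_mx_lt m x y a r r0)[].
have z y : f (row_mx (x%:M : 'rV_1) y) = 0%E.
  by apply: zf => /(@norm_row_mx_lt m x y a r r0)[xa' _]; apply: xa; exact/mem_set.
rewrite (_ : (fun y => _) = cst 0%E); last by apply/funext => y; rewrite z.
suff -> : lebesgue_integral_rV (cst 0%E : 'rV[R]_m -> \bar R) = 0%E by [].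
elim: {IH cf zf a f f0 xa z} m => //= m ->.
by rewrite integral0.
Qed.

End IteratedIntegral.

Section L2norm.
Context {R : realType} {M : ptopologicalType} {m : nat}.
Context {A : smooth_atlas R M m}.
Variable vol : {measure set (borel M) -> \bar R}.

Lemma spinor_L2norm_sqr (psi : @spinor_components R M m A) :
  (spinor_L2norm vol psi `^ 2 = \int[vol]_x (sqn (psi (chart_at A x) x))%:E)%E.
Proof.
rewrite /spinor_L2norm poweR_Lnorm ?pnatr_eq0//; apply: eq_integral => x _.
by rewrite /= ger0_norm ?sqrtr_ge0// powR_mulrn ?sqrtr_ge0// sqr_sqrtr// sqn_ge0.
Qed.

Lemma spinor_L2norm_le1 (psi : @spinor_components R M m A) :
  (spinor_L2norm vol psi <= 1)%E <->
  (\int[vol]_x (sqn (psi (chart_at A x) x))%:E <= 1)%E.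
Proof.
rewrite -spinor_L2norm_sqr; have := Lnorm_ge0 vol 2%:E (fun x : borel M =>
    (Num.sqrt (\sum_r (normc (psi (chart_at A x) x r 0)) ^+ 2))%:E).
rewrite -/(spinor_L2norm vol psi); case: (spinor_L2norm vol psi) => [t| |]//; last first.
  by rewrite poweRyr ?pnatr_eq0.
rewrite /= !lee_fin => t0; rewrite powR_mulrn//.
by rewrite expr_le1.
Qed.

End L2norm.

(** * Euclidean norm, Jacobians and curves *)

Section Dot.
Context {R : realType} {n : nat}.
Implicit Types u v w : 'rV[R]_n.

(* The norm [`| _ |] of row vectors is the sup norm; [dot] and [enorm] are the
   Euclidean scalar product and norm. *)
Definition dot u v : R := (u *m v^T) 0 0.

Lemma dotE u v : dot u v = \sum_j u 0 j * v 0 j.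
Proof. by rewrite /dot mxE; apply: eq_bigr => j _; rewrite mxE. Qed.

Lemma dotC u v : dot u v = dot v u.
Proof. by rewrite !dotE; apply: eq_bigr => j _; rewrite mulrC. Qed.

Lemma dotDl u v w : dot (u + v) w = dot u w + dot v w.
Proof. by rewrite /dot mulmxDl mxE. Qed.

Lemma dotZl (a : R) u v : dot (a *: u) v = a * dot u v.
Proof. by rewrite /dot -scalemxAl mxE. Qed.

Lemma dotNl u v : dot (- u) v = - dot u v.
Proof. by rewrite /dot mulNmx mxE. Qed.

Lemma dotDr u v w : dot u (v + w) = dot u v + dot u w.
Proof. by rewrite dotC dotDl !(dotC u). Qed.

Lemma dotZr (a : R) u v : dot u (a *: v) = a * dot u v.
Proof. by rewrite dotC dotZl dotC. Qed.

Lemma dotNr u v : dot u (- v) = - dot u v.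
Proof. by rewrite dotC dotNl dotC. Qed.

Lemma dot_ge0 u : 0 <= dot u u.
Proof. by rewrite dotE sumr_ge0// => j _; rewrite -expr2 sqr_ge0. Qed.

Lemma dot_eq0 u : dot u u = 0 -> u = 0.
Proof.
rewrite dotE => /eqP; rewrite psumr_eq0 => [/allP u0|j _]; last by rewrite -expr2 sqr_ge0.
apply/rowP => j; rewrite mxE; apply/eqP.
by have := u0 j (mem_index_enum _); rewrite /= mulf_eq0 orbb.
Qed.

Lemma dot_CS u v : dot u v ^+ 2 <= dot u u * dot v v.
Proof.
have [v0|v0] := eqVneq (dot v v) 0.
  by rewrite v0 mulr0 (dot_eq0 v0) /dot trmx0 mulmx0 mxE expr0n.
have vp : 0 < dot v v by rewrite lt_neqAle eq_sym v0 dot_ge0.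
(* This vector is |v|^2 times the component of u orthogonal to v. *)
have := dot_ge0 (dot v v *: u - dot u v *: v).
rewrite dotDl !dotDr !dotNl !dotNr !dotZl !dotZr (dotC v u).
rewrite (_ : _ + _ = dot v v * (dot u u * dot v v - dot u v ^+ 2)); last by ring.
by rewrite pmulr_rge0// subr_ge0.
Qed.

Definition enorm u : R := Num.sqrt (dot u u).

Lemma enorm_ge0 u : 0 <= enorm u.
Proof. exact: sqrtr_ge0. Qed.

Lemma enorm_sqr u : enorm u ^+ 2 = dot u u.
Proof. by rewrite sqr_sqrtr// dot_ge0. Qed.

Lemma dot_le_enorm u v : dot u v <= enorm u * enorm v.
Proof.
rewrite (le_trans (ler_norm _))// -ler_sqr ?nnegrE ?mulr_ge0 ?enorm_ge0//.
by rewrite exprMn !enorm_sqr real_normK ?num_real// dot_CS.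
Qed.

Lemma enormZ (a : R) u : enorm (a *: u) = `|a| * enorm u.
Proof. by rewrite /enorm dotZl dotZr mulrA -expr2 sqrtrM ?sqr_ge0// sqrtr_sqr. Qed.

Lemma enormN u : enorm (- u) = enorm u.
Proof. by rewrite /enorm dotNl dotNr opprK. Qed.

Lemma coord_le_enorm u j : `|u 0 j| <= enorm u.
Proof.
rewrite -ler_sqr ?nnegrE ?enorm_ge0// enorm_sqr real_normK ?num_real// dotE.
by rewrite (bigD1 j)//= -expr2 lerDl sumr_ge0// => k _; rewrite -expr2 sqr_ge0.
Qed.

Lemma norm_le_enorm u : `|u| <= enorm u.
Proof. by apply: norm_le_coord => [|k]; [exact: enorm_ge0|exact: coord_le_enorm]. Qed.

(** The sharp constant is the square root of n; only the equivalence of the two norms matters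
    here. *)
Lemma enorm_le_norm u : enorm u <= n%:R * `|u|.
Proof.
rewrite -ler_sqr ?nnegrE ?enorm_ge0 ?mulr_ge0// enorm_sqr dotE.
apply: (@le_trans _ _ (\sum_(j < n) `|u| ^+ 2)).
  apply: ler_sum => j _; rewrite -expr2 -[leLHS]real_normK ?num_real//.
  by rewrite ler_sqr ?nnegrE// coord_le_norm.
rewrite sumr_const card_ord exprMn -[leLHS]mulr_natl ler_wpM2r ?sqr_ge0//.
by rewrite -natrX ler_nat expnS expn1; case: (n) => // k; exact: leq_pmulr.
Qed.

End Dot.

Section VectorJacobian.
Context {R : realType} {m p : nat}.

Definition smooth_map (U : set 'rV[R]_m) (Phi : 'rV[R]_m -> 'rV[R]_p) :=
  forall l, smooth_on U (fun y => Phi y 0 l).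

Lemma smooth_map_differentiable U (Phi : 'rV[R]_m -> 'rV[R]_p) y :
  open U -> smooth_map U Phi -> U y -> differentiable Phi y.
Proof.
move=> oU sP Uy; apply: differentiable_rV => l.
have [d _] := smooth_on_diff oU (sP l) Uy. exact: d.
Qed.

Lemma jacobianE U (Phi : 'rV[R]_m -> 'rV[R]_p) y k l :
  open U -> smooth_map U Phi -> U y ->
  jacobian Phi y k l = partial k (fun z => Phi z 0 l) y.
Proof.
move=> oU sP Uy; have dP := smooth_map_differentiable oU sP Uy.
have -> : jacobian Phi y k l = ('D_(delta_mx 0 k) Phi y) 0 l.
  by rewrite deriveEjacobian// -rowE [RHS]mxE.
by rewrite derive_mx ?mxE//; exact: diff_derivable.
Qed.

Lemma lin_form_jacobian U (Phi : 'rV[R]_m -> 'rV[R]_p) y (D : 'I_p -> R) (v : 'rV[R]_m) :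
  open U -> smooth_map U Phi -> U y ->
  lin_form D (v *m jacobian Phi y) =
  lin_form (fun k => \sum_l partial k (fun z => Phi z 0 l) y * D l) v.
Proof.
move=> oU sP Uy; rewrite /lin_form.
under eq_bigr do rewrite mxE mulr_suml.
rewrite exchange_big; apply: eq_bigr => k _; rewrite mulr_sumr.
by apply: eq_bigr => l _; rewrite (jacobianE k l oU sP Uy) mulrA.
Qed.

Lemma partial_comp U V (Phi : 'rV[R]_m -> 'rV[R]_p) (f : 'rV[R]_p -> R) y k :
  open U -> open V -> smooth_map U Phi -> smooth_on V f -> U y -> V (Phi y) ->
  partial k (fun z => f (Phi z)) y =
  \sum_l partial k (fun z => Phi z 0 l) y * partial l f (Phi y).
Proof.
move=> oU oV sP sf Uy Vy.
have dP := smooth_map_differentiable oU sP Uy.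
have [_ E] := chain_rule (delta_mx 0 k) dP (smooth_on_diff oV sf Vy).
rewrite /partial E deriveEjacobian// (lin_form_jacobian _ _ oU sP Uy).
rewrite /lin_form [LHS](bigD1 k)//= [X in _ + X]big1 ?addr0 => [|j jk].
  by rewrite mxE !eqxx mul1r.
by rewrite mxE eqxx (negbTE jk) mul0r.
Qed.

End VectorJacobian.

(* As in the inverse function theorem, the derivability of the composite passes
   to the curve, which is only assumed to be continuous. *)
Lemma is_derive_of_comp {R : realType} {m : nat} (G : 'rV[R]_m -> 'rV[R]_m)
    (c : R -> 'rV[R]_m) (s : R) (D : 'rV[R]_m) :
  {for s, continuous c} ->
  (forall e : R, 0 < e -> \forall y \near c s, `|G y - G (c s) - (y - c s)| <= e * `|y
    - c s|) ->
  is_derive s 1 (fun t => G (c t)) D -> is_derive s 1 c D.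
Proof.
move=> cc Gd [dG vG].
suff H : (h^-1 *: ((c \o shift s) (h *: 1) - c s)) @[h --> (0 : R)^'] --> D.
  by split; [apply/cvg_ex; exists D|exact/cvg_lim].
have cG : (h^-1 *: (((fun t => G (c t)) \o shift s) (h *: 1) - G (c s)))
  @[h --> (0 : R)^'] --> D.
  by rewrite -vG; exact: dG.
apply/cvgrPdist_le => e e0.
have B0 : 0 < 4 * (`|D| + 1) by rewrite mulr_gt0// ltr_wpDl.
(* The bound 1/2 absorbs |q| in |q| <= |p| + |q|/2, whence |q| <= 2 (|D| + 1); the other bound then
   gives eps |q| <= e/2. *)
pose eps := Num.min (2^-1 : R) (e / (4 * (`|D| + 1))).
have eps0 : 0 < eps by rewrite lt_min invr_gt0 ltr0n divr_gt0.
have e2 : 0 < e / 2 by rewrite divr_gt0.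
have shc : c (h + s) @[h --> (0 : R)^'] --> c s.
  have : c (h + s) @[h --> (0 : R)] --> c s.
    have : {for (0 : R), continuous (fun h : R => c (h + s))}.
      apply: continuous_comp; last by rewrite add0r.
      by apply: cvgD; [exact: cvg_id|exact: cvg_cst].
    by rewrite /prop_for /continuous_at add0r.
  by apply: cvg_trans; apply: cvg_app; exact: nbhs_dnbhs.
near=> h.
have h0 : h != 0 by near: h; exact: nbhs_dnbhs_neq.
have H1 : `|G (c (h + s)) - G (c s) - (c (h + s) - c s)| <= eps * `|c (h + s) - c s|.
  by near: h; exact: (shc _ (Gd _ eps0)).
have H2 : `|D - h^-1 *: (G (c (h + s)) - G (c s))| <= e / 2.
  have E (k : R) : G (c (k + s)) = (((fun t => G (c t)) \o shift s) (k *: 1)).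
    by rewrite /= [k%:A]mulr1.
  rewrite E; near: h; by have /cvgrPdist_le := cG; apply.
have H3 : `|D - h^-1 *: (G (c (h + s)) - G (c s))| <= 1.
  have E (k : R) : G (c (k + s)) = (((fun t => G (c t)) \o shift s) (k *: 1)).
    by rewrite /= [k%:A]mulr1.
  rewrite E; near: h; by have /cvgrPdist_le := cG; apply.
rewrite /= [h%:A]mulr1.
set q := h^-1 *: (c (h + s) - c s).
set p := h^-1 *: (G (c (h + s)) - G (c s)) in H2 H3.
have H4 : `|p - q| <= eps * `|q|.
  by rewrite -scalerBr !normrZ mulrCA ler_wpM2l.
have p1 : `|p| <= `|D| + 1.
  rewrite -[p](subrK D) addrC (le_trans (ler_normD _ _))// lerD2l.
  by rewrite distrC.
have q1 : `|q| <= 2 * (`|D| + 1).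
  have : `|q| <= `|p| + 2^-1 * `|q|.
    rewrite -{1}[q](subrK p) addrC (le_trans (ler_normD _ _))// lerD2l distrC.
    by rewrite (le_trans H4)// ler_wpM2r// ge_min lexx.
  lra.
rewrite -(subrKA p) (le_trans (ler_normD _ _))// (splitr e) lerD//.
rewrite (le_trans H4)//.
have : eps <= e / (4 * (`|D| + 1)) by rewrite ge_min lexx orbT.
rewrite ler_pdivlMr// => H5.
have := ler_wpM2l (ltW eps0) q1; lra.
Unshelve. all: by end_near. Qed.

Section Theta.
Context {R : realType}.

(* A parametrization of [0, 1] with values in [0, 1] on the whole line, since
   [C1_curve] is two-sided at the endpoints. *)
Definition theta (t : R) : R := (1 - cos (pi * t)) / 2.
Definition dtheta (t : R) : R := pi * sin (pi * t) / 2.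

Lemma is_derive_theta (t : R) : is_derive t 1 theta (dtheta t).
Proof.
have d1 : is_derive t 1 (fun s : R => pi * s) pi.
  have := @is_deriveZ R _ _ id pi t 1 1 _.
  by rewrite /GRing.scale /= mulr1; apply.
have d2 := @is_derive1_comp R cos _ t _ _ (is_derive_cos _) d1.
have -> : theta = (2^-1 : R) *: (cst 1 - (cos \o (fun s : R => pi * s))).
  by apply/funext => s; rewrite /theta mulrC.
apply: is_derive_eq; rewrite /dtheta /GRing.scale /=; ring.
Qed.

Lemma theta_range t : 0 <= theta t <= 1.
Proof.
by rewrite /theta; have := cos_geN1 (pi * t); have := cos_le1 (pi * t) => *; apply/andP;
  split; lra.
Qed.

Lemma theta0 : theta 0 = 0.
Proof. by rewrite /theta mulr0 cos0 subrr mul0r. Qed.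

Lemma theta1 : theta 1 = 1.
Proof. by rewrite /theta mulr1 cospi; lra. Qed.

Lemma continuous_dtheta : continuous dtheta.
Proof.
move=> t; rewrite /dtheta; apply: cvgM; last exact: cvg_cst.
apply: cvgM; first exact: cvg_cst.
apply: continuous_comp; last exact: continuous_sin.
by apply: cvgM; [exact: cvg_cst|exact: cvg_id].
Qed.

Lemma dtheta_ge0 t : 0 <= t <= 1 -> 0 <= dtheta t.
Proof.
move=> /andP[t0 t1]; rewrite /dtheta divr_ge0// mulr_ge0 ?pi_ge0//.
by apply: sin_ge0_pi; rewrite ?mulr_ge0 ?pi_ge0//= ger_pMr ?pi_gt0//.
Qed.

End Theta.

(** * Lipschitz functions on a Riemannian manifold *)

(** The negative part of [f] can only lower its integral, and the positive part is below [g] since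
    [g] is nonnegative. This covers arbitrary integrands such as [speed], which goes through
    [chart_at]. *)
Lemma le_integral_pos d (T : measurableType d) (R : realType)
    (mu : {measure set T -> \bar R}) (D : set T) (f g : T -> \bar R) :
  (forall x, D x -> (0 <= g x)%E) -> (forall x, D x -> (f x <= g x)%E) ->
  (\int[mu]_(x in D) f x <= \int[mu]_(x in D) g x)%E.
Proof.
move=> g0 fg; rewrite integralE.
apply: (@le_trans _ _ (\int[mu]_(x in D) (f^\+ x))%E).
  rewrite -[leRHS]sube0 leeB// integral_ge0// => x _; exact: funeneg_ge0.
apply: le_integral_any => x Dx; first exact: funepos_ge0.
by rewrite funeposE ge_max fg// g0.
Qed.

Section Charts.
Context {R : realType} {M : ptopologicalType} {m : nat} (c : chart R M m).

Lemma chart_codomI x : chart_dom c x -> chart_codom c (chart_coord c x).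
Proof. by move=> cx; exists x. Qed.

Lemma chart_inv_dom y : chart_codom c y -> chart_dom c (chart_inv c y).
Proof. by move=> [x cx <-]; rewrite coordK. Qed.

Lemma chart_coordK y : chart_codom c y -> chart_coord c (chart_inv c y) = y.
Proof. by move=> [x cx <-]; rewrite coordK. Qed.

Lemma open_codom : open (chart_codom c).
Proof. exact: chart_codom_open. Qed.

Lemma chart_inv_continuous y : chart_codom c y -> {for y, continuous (chart_inv c)}.
Proof. by move=> [x cx <-]; exact: coord_inv_continuous. Qed.

End Charts.

(** * Orthonormal frames, the inverse metric and gradients *)

Section Frames.
Context {R : realType} {M : ptopologicalType} {m : nat}.
Context {A : smooth_atlas R M m} {g : riemannian_metric A} (S : spin_structure g).
Variables (i : chart_index A) (y : 'rV[R]_m).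
Hypothesis iy : chart_codom (A i) y.

Let E := frame S i y.

(** The inverse metric is E^T E: orthonormality E g E^T = 1 is an identity of square matrices, whose
    one-sided inverses are two-sided. *)
Lemma frame_inv_r : g i y *m (E^T *m E) = 1%:M.
Proof. by have := frame_orthonormal S iy; rewrite -mulmxA => /mulmx1C;
  rewrite -mulmxA. Qed.

Lemma frame_inv_l : E^T *m E *m g i y = 1%:M.
Proof. exact: mulmx1C frame_inv_r. Qed.

Lemma metric_det_gt0 : 0 < \det (g i y).
Proof.
have := congr1 determinant (frame_orthonormal S iy).
rewrite !det_mulmx det_tr det1 mulrAC -expr2 => d1.
have : 0 < \det (frame S i y) ^+ 2 * \det (g i y) by rewrite d1 ltr01.
have [->|E0] := eqVneq (\det (frame S i y)) 0; first by rewrite expr0n /= mul0r ltxx.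
by rewrite pmulr_rgt0// lt_neqAle eq_sym expf_neq0//= sqr_ge0.
Qed.

(** v g E^T lists the scalar products of v with the frame vectors, that is, its components in the
    frame. *)
Lemma frame_dot (v : 'rV[R]_m) :
  dot (v *m g i y *m E^T) (v *m g i y *m E^T) = (v *m g i y *m v^T) 0 0.
Proof.
rewrite /dot !trmx_mul trmxK (Defs.metric_sym g iy) !mulmxA -(mulmxA _ E^T)
  -(mulmxA (v *m g i y)).
by rewrite frame_inv_l mulmx1.
Qed.

(** When [d] is the differential of h, these are the components e_a(h) of the gradient of h in the
    orthonormal frame. *)
Definition frame_grad (d : 'I_m -> R) : 'rV[R]_m :=
  \row_a \sum_mu E a mu * d mu.

Lemma frame_gradE d : frame_grad d = (\row_k d k) *m E^T.
Proof.
by apply/rowP => a; rewrite !mxE; apply: eq_bigr => k _; rewrite !mxE mulrC.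
Qed.

Lemma lin_form_frame d (v : 'rV[R]_m) :
  lin_form d v = dot (v *m g i y *m E^T) (frame_grad d).
Proof.
rewrite frame_gradE /dot trmx_mul trmxK !mulmxA -(mulmxA _ E^T) -(mulmxA v).
by rewrite frame_inv_r mulmx1 mxE; apply: eq_bigr => k _; rewrite !mxE.
Qed.

Lemma lin_form_le d (v : 'rV[R]_m) : dot (frame_grad d) (frame_grad d) <= 1 ->
  lin_form d v <= Num.sqrt ((v *m g i y *m v^T) 0 0).
Proof.
move=> d1; rewrite lin_form_frame (le_trans (dot_le_enorm _ _))//.
rewrite {1}/enorm frame_dot ler_piMr ?sqrtr_ge0//.
by rewrite /enorm -sqrtr1 ler_sqrt.
Qed.

(** Test on the gradient itself: the vector w E has length |w| and d(w E) = |w|^2, so that |w|^2 <=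
    |w|. *)
Lemma frame_grad_le1 d :
  (forall v : 'rV[R]_m, lin_form d v <= Num.sqrt ((v *m g i y *m v^T) 0 0)) ->
  dot (frame_grad d) (frame_grad d) <= 1.
Proof.
move=> H; set w := frame_grad d; have := H (w *m E).
rewrite lin_form_frame -frame_dot -(mulmxA _ (g i y)) -mulmxA (mulmxA E).
rewrite frame_orthonormal// mulmx1 -/(enorm w).
have := enorm_ge0 w; rewrite -enorm_sqr => e0 H1.
by have [|e1] := leP (enorm w) 1; nra.
Qed.

End Frames.

Section Curves.
Context {R : realType} {M : ptopologicalType} {m : nat}.
Context {A : smooth_atlas R M m} (g : riemannian_metric A).

Definition smooth_fun (h : M -> R) : Prop :=
  forall i, smooth_on (chart_codom (A i)) (fun y => h (chart_inv (A i) y)).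

Definition chart_grad (h : M -> R) i (y : 'rV[R]_m) : 'I_m -> R :=
  fun k => partial k (fun z => h (chart_inv (A i) z)) y.

Lemma is_derive_along (h : M -> R) (c : R -> M) (s : R) i : smooth_fun h ->
  (\forall r \near s, chart_dom (A i) (c r)) ->
  derivable (fun r => chart_coord (A i) (c r)) s 1 ->
  is_derive s 1 (h \o c) (lin_form (chart_grad h i (chart_coord (A i) (c s)))
    (derive1 (fun r => chart_coord (A i) (c r)) s)).
Proof.
move=> sh near_dom dc.
have cs : chart_dom (A i) (c s) := nbhs_singleton near_dom.
have df := smooth_on_diff (open_codom (c := A i)) (sh i) (chart_codomI cs).
have dPhi : differentiable (fun r => chart_coord (A i) (c r)) s by exact/derivable1_diffP.
have D := chain_rule (1 : R) dPhi df.
apply: near_eq_is_derive; last by rewrite derive1E; exact: D.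
by apply: filterS near_dom => r cr /=; rewrite coordK.
Qed.

Lemma C1_curve_near (c : R -> M) (t : R) i : @C1_curve R M m A c -> 0 <= t <= 1 ->
  chart_dom (A i) (c t) ->
  \forall s \near t, (\forall r \near s, chart_dom (A i) (c r)) /\
    derivable (fun r => chart_coord (A i) (c r)) s 1.
Proof.
move=> C1 t01 ct; have [cc /(_ i ct)[dc _]] := C1 t t01.
apply: filterI => //.
apply: (@nbhs_interior _ t [set r | chart_dom (A i) (c r)]).
by apply: cc; apply: open_nbhs_nbhs; split => //; exact: chart_dom_open.
Qed.

(** Near t the curve stays in one fixed chart, where the derivative is a sum of products of
    continuous functions. *)
Lemma C1_curve_derive (h : M -> R) (c : R -> M) (t : R) :
  smooth_fun h -> @C1_curve R M m A c -> 0 <= t <= 1 ->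
  derivable (h \o c) t 1 /\ {for t, continuous (derive1 (h \o c))}.
Proof.
move=> sh C1 t01; set i := chart_at A (c t).
have ct : chart_dom (A i) (c t) by exact: chart_at_dom.
have Cn := C1_curve_near C1 t01 ct.
split.
  have [nd dd] := nbhs_singleton Cn.
  by have [] := is_derive_along sh nd dd.
pose gam r := chart_coord (A i) (c r).
have [cc /(_ i ct)[_ cd]] := C1 t t01.
have E : \forall s \near t, \sum_k (derive1 gam s) 0 k * chart_grad h i (gam s) k
  = derive1 (h \o c) s.
  apply: filterS Cn => s [nd dd]; rewrite [RHS]derive1E.
  by have [_ ->] := is_derive_along sh nd dd.
rewrite /prop_for /continuous_at -(nbhs_singleton E).
apply: (cvg_trans (near_eq_cvg E)).
apply: (@cvg_fsum R R _ (nbhs t)) => k.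
apply: cvgM.
  by apply: (@continuous_comp _ _ _ (derive1 gam) (fun v : 'rV[R]_m => v 0 k) t cd);
    exact: coord_continuous.
apply: (@continuous_comp _ _ _ gam (fun y => chart_grad h i y k)).
  by apply: continuous_comp => //; exact: Defs.coord_continuous.
apply: smooth_on_continuous (smooth_on_partial k (sh i)) _.
exact: chart_codomI.
Qed.

Lemma speed_ge0 (c : R -> M) t : 0 <= speed g c t.
Proof. exact: sqrtr_ge0. Qed.

(** The condition |grad h| <= 1 by duality, free of the inverse metric: dh(v) <= |v| for all v, the
    other sign being covered by -v. *)
Definition grad_le1 (h : M -> R) := forall i y, chart_codom (A i) y ->
  forall v : 'rV[R]_m, lin_form (chart_grad h i y) v <= Num.sqrt
    ((v *m g i y *m v^T) 0 0).

(** The fundamental theorem of calculus for h along c, whose derivative dh(c') is at most the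
    speed. *)
Lemma curve_length_lower (h : M -> R) (c : R -> M) : smooth_fun h -> grad_le1 h ->
  @C1_curve R M m A c -> ((h (c 1) - h (c 0))%:E <= curve_length g c)%E.
Proof.
move=> sh gh C1; set F := h \o c.
have D t : 0 <= t <= 1 -> derivable F t 1 /\ {for t, continuous (derive1 F)}.
  by move=> t01; exact: C1_curve_derive.
have cF t : 0 <= t <= 1 -> {for t, continuous F}.
  by move=> /D[d _]; apply: differentiable_continuous; exact/derivable1_diffP.
have E : (\int[lebesgue_measure]_(x in `[0%R, 1%R]) (derive1 F x)%:E = (F 1)%:E
  - (F 0)%:E)%E.
  apply: continuous_FTC2 => //.
    apply: continuous_in_subspaceT => t /set_mem/=; rewrite in_itv/= => t01.
    by have [] := D t t01.
  split.
  - move=> t; rewrite in_itv /= => /andP[t0 t1].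
    have t01 : 0 <= t <= 1 by rewrite !ltW.
    exact: (D t t01).1.
  - by apply: cvg_at_right_filter; apply: cF; rewrite lexx ler01.
  - by apply: cvg_at_left_filter; apply: cF; rewrite lexx ler01.
rewrite EFinB -E; apply: le_integral_pos => t /=; rewrite in_itv /= => t01.
  by rewrite lee_fin speed_ge0.
rewrite lee_fin /speed /F; set i := chart_at A (c t).
have ct : chart_dom (A i) (c t) by exact: chart_at_dom.
have [nd dd] := nbhs_singleton (C1_curve_near C1 t01 ct).
have [_ dE] := is_derive_along sh nd dd.
by rewrite derive1E dE; apply: gh; exact: chart_codomI.
Qed.

Lemma geodesic_dist_lower (h : M -> R) x y : smooth_fun h -> grad_le1 h ->
  ((h y - h x)%:E <= geodesic_dist g x y)%E.
Proof.
move=> sh gh; apply: le_ereal_inf_tmp => L /= j.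
elim: j => [z|{}x z {}y c {}L C1 c0 c1 _ IH]; first by rewrite subrr.
have := curve_length_lower sh gh C1; rewrite c0 c1 => H.
by rewrite -(subrKA (h z)) addrC EFinD leeD.
Qed.

End Curves.

Arguments smooth_fun {R M m} A h.

(** * Convex isometric embeddings *)

(** The partial derivatives of the composite involve the composites of [partial l f] with [Phi]. The
    induction on the class is therefore uniform in [f], which is kept smooth throughout. *)
Lemma smooth_on_comp {R : realType} {m p : nat} (U : set 'rV[R]_m) (V : set 'rV[R]_p)
    (Phi : 'rV[R]_m -> 'rV[R]_p) (f : 'rV[R]_p -> R) :
  open U -> open V -> smooth_map U Phi -> (forall y, U y -> V (Phi y)) ->
  smooth_on V f -> smooth_on U (fun y => f (Phi y)).
Proof.
move=> oU oV sP UV sf; apply/smooth_onP => n; elim: n f sf => [|n IH] f sf.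
  split=> // y Uy; apply: (@continuous_comp _ _ _ Phi f).
    by apply: differentiable_continuous; exact: smooth_map_differentiable sP Uy.
  exact: smooth_on_continuous sf (UV y Uy).
split.
  move=> y Uy; apply: (@continuous_comp _ _ _ Phi f).
    by apply: differentiable_continuous; exact: smooth_map_differentiable sP Uy.
  exact: smooth_on_continuous sf (UV y Uy).
split.
  move=> y k Uy; have dP := smooth_map_differentiable oU sP Uy.
  by have [] := chain_rule (delta_mx 0 k) dP (smooth_on_diff oV sf (UV y Uy)).
move=> k.
apply: (class_C_ext oU (f := fun y =>
    \sum_l partial k (fun z => Phi z 0 l) y * partial l f (Phi y))).
  by move=> y Uy; rewrite (partial_comp k oU oV sP sf Uy (UV y Uy)).
elim: (index_enum _) => [|l r IHr].
  by under eq_fun do rewrite big_nil; exact: class_C_cst.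
under eq_fun do rewrite big_cons; apply: class_CD => //; apply: class_CM => //.
  by have /smooth_onP := smooth_on_partial k (sP l).
exact: IH (smooth_on_partial l sf).
Qed.

Lemma smooth_fun_continuous {R : realType} {M : ptopologicalType} {m : nat}
    {A : smooth_atlas R M m} (h : M -> R) : smooth_fun A h -> continuous h.
Proof.
move=> sh x; set i := chart_at A x.
have ix : chart_dom (A i) x by exact: chart_at_dom.
have H : {for x, continuous (fun z => h (chart_inv (A i) (chart_coord (A i) z)))}.
  apply: (@continuous_comp _ _ _ (chart_coord (A i)) (fun y => h (chart_inv (A i) y))).
    exact: Defs.coord_continuous.
  exact: smooth_on_continuous (sh i) (chart_codomI ix).
have E : \forall z \near x, h (chart_inv (A i) (chart_coord (A i) z)) = h z.
  by apply: (near_open (@chart_dom_open _ _ _ (A i)) ix) => z iz; rewrite coordK.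
move: H; rewrite /prop_for /continuous_at (nbhs_singleton E) => H.
exact: cvg_trans (near_eq_cvg E) H.
Qed.

Section Embedding.
Context {R : realType} {M : ptopologicalType} {m n : nat}.
Context {A : smooth_atlas R M m} {g : riemannian_metric A} (S : spin_structure g).
Context (N : M -> 'rV[R]_n) (iso : isometric_embedding g N).

Let J i (y : 'rV[R]_m) : 'M[R]_(m, n) := jacobian (fun z => N (chart_inv (A i) z)) y.

Lemma smooth_comp_embedding (F : 'rV[R]_n -> R) : smooth_on setT F ->
  smooth_fun A (fun x => F (N x)).
Proof.
move=> sF i; apply: smooth_on_comp (embedding_smooth iso (i := i)) _ sF => //.
- exact: open_codom.
- exact: openT.
Qed.

Lemma enorm_jacobian i y (v : 'rV[R]_m) : chart_codom (A i) y ->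
  enorm (v *m J i y) = Num.sqrt ((v *m g i y *m v^T) 0 0).
Proof.
by move=> iy; rewrite /enorm /dot trmx_mul (embedding_pullback iso iy) !mulmxA.
Qed.

Lemma grad_comp_embedding (F : 'rV[R]_n -> R) i y (v : 'rV[R]_m) :
  smooth_on setT F -> chart_codom (A i) y ->
  lin_form (chart_grad (fun x => F (N x)) i y) v =
  dot (v *m J i y) (\row_l partial l F (N (chart_inv (A i) y))).
Proof.
move=> sF iy.
rewrite dotE; under [RHS]eq_bigr do rewrite [X in _ * X]mxE.
rewrite -/(lin_form (fun l => partial l F (N (chart_inv (A i) y))) (v *m J i y)).
rewrite (lin_form_jacobian _ _ (open_codom (c := A i)) (embedding_smooth iso (i := i))
  iy).
apply: eq_bigr => k _; congr (_ * _).
exact: (partial_comp k (open_codom (c := A i)) openT (embedding_smooth iso (i := i)) sF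
  iy).
Qed.

(** By Cauchy-Schwarz dF(v J) <= |v J|, and |v J| is the Riemannian length of v. *)
Lemma grad_le1_comp_embedding (F : 'rV[R]_n -> R) : smooth_on setT F ->
  (forall xi, \sum_l partial l F xi ^+ 2 <= 1) ->
  grad_le1 g (fun x => F (N x)).
Proof.
move=> sF F1 i y iy v; rewrite (grad_comp_embedding _ sF iy).
rewrite (le_trans (dot_le_enorm _ _))// -(enorm_jacobian v iy) ler_piMr ?enorm_ge0//.
rewrite /enorm -[leRHS]sqrtr1 ler_wsqrtr// dotE
  (le_trans _ (F1 (N (chart_inv (A i) y))))//.
by apply: ler_sum => l _; rewrite !mxE expr2.
Qed.

Lemma smooth_coord l (U : set 'rV[R]_n) : open U -> smooth_on U (fun xi => xi 0 l).
Proof.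
move=> oU; apply/smooth_onP => -[|k].
  by split=> // y _; exact: coord_continuous.
have d (y : 'rV[R]_n) j : is_derive y (delta_mx 0 j) (fun xi => xi 0 l)
  ((delta_mx 0 j : 'rV[R]_n) 0 l).
  have dc : differentiable (fun xi : 'rV[R]_n => xi 0 l) y by exact: differentiable_coord.
  split; first exact: diff_derivable.
  have dm : derivable (@idfun 'rV[R]_n) y (delta_mx 0 j) by exact: derivable_id.
  have := derive_mx dm; rewrite derive_id => /matrixP/(_ 0 l).
  by rewrite [X in _ = X -> _]mxE.
split; first by move=> y _; exact: coord_continuous.
split; first by move=> y j _; have [] := d y j.
move=> j; rewrite (_ : partial j _ = fun=> (delta_mx 0 j : 'rV[R]_n) 0 l).
  exact: class_C_cst.
by apply/funext => y; have [_] := d y j.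
Qed.

Lemma partial_coord j l (y : 'rV[R]_n) : partial j (fun xi : 'rV[R]_n => xi 0 l) y
  = (j == l)%:R.
Proof.
have dm : derivable (@idfun 'rV[R]_n) y (delta_mx 0 j) by exact: derivable_id.
have := derive_mx dm; rewrite derive_id => /matrixP/(_ 0 l).
by rewrite [X in _ = X -> _]mxE /partial => <-; rewrite mxE eqxx eq_sym.
Qed.

Lemma smooth_dot (u : 'rV[R]_n) : smooth_on setT (dot u).
Proof.
rewrite (_ : dot u = fun xi => \sum_l u 0 l * xi 0 l); last first.
  by apply/funext => xi; rewrite dotE.
apply: smooth_on_sum => [|l]; first exact: openT.
by apply: smooth_onZ; [exact: openT|exact: smooth_coord openT].
Qed.

Lemma partial_dot (u : 'rV[R]_n) l y : partial l (dot u) y = u 0 l.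
Proof.
have dl j := smooth_on_derivable (k := l) (@smooth_coord j setT openT) (I : setT y).
rewrite /partial (_ : dot u = \sum_j (u 0 j *: (fun xi : 'rV[R]_n => xi 0 j)));
  last first.
  by apply/funext => xi; rewrite dotE fct_sumE.
rewrite derive_sum => [|j]; last exact: derivableZ.
rewrite (bigD1 l)//= big1 ?addr0 => [|j jl]; rewrite deriveZ//.
  by have := partial_coord l l y; rewrite /partial => ->; rewrite eqxx [LHS]mulr1.
by have := partial_coord l j y; rewrite /partial => ->;
  rewrite eq_sym (negbTE jl) [LHS]mulr0.
Qed.

(** The coordinate of [N] in the direction of N y - N x has gradient at most 1 and grows by |N y - N
    x| from x to y. *)
Lemma enorm_le_geodesic x y : ((enorm (N y - N x))%:E <= geodesic_dist g x y)%E.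
Proof.
set w := N y - N x; have [w0|w0] := eqVneq (enorm w) 0.
  (* There is no direction here; the null function shows that the distance is nonnegative. *)
  have sT : smooth_on setT (dot (0 : 'rV[R]_n)) := smooth_dot 0.
  have := geodesic_dist_lower x y (smooth_comp_embedding sT).
  rewrite w0 !(@dotE _ _ 0) !big1 ?subrr => [|j _|j _]; rewrite ?mxE ?mul0r//.
  apply; apply: grad_le1_comp_embedding sT _ => xi.
  by rewrite big1// => l _; rewrite partial_dot mxE expr0n.
have wp : 0 < enorm w by rewrite lt_neqAle eq_sym w0 enorm_ge0.
pose u := (enorm w)^-1 *: w.
have := geodesic_dist_lower x y (smooth_comp_embedding (smooth_dot u)).
rewrite -dotNr -dotDr -/w /u dotZl -enorm_sqr expr2 mulKf//; apply.
apply: grad_le1_comp_embedding (smooth_dot u) _ => xi.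
under eq_bigr do rewrite partial_dot expr2.
by rewrite -dotE dotZl dotZr -enorm_sqr expr2 mulKf// mulVf.
Qed.

Lemma continuous_embedding : continuous N.
Proof.
have cN j : continuous (fun x => N x 0 j).
  by apply: smooth_fun_continuous => i; exact: (embedding_smooth iso).
move=> x; apply/cvgrPdist_lt => e e0.
have : \forall z \near x, forall j, `|N x 0 j - N z 0 j| < e.
  by apply: (@filter_forall _ _ _ (nbhs x)) => j; have /cvgrPdist_lt := cN j x; apply.
by apply: filterS => z zP; apply: norm_lt_coord => // j; rewrite !mxE.
Qed.

End Embedding.

Lemma is_derive_mx {R : realType} {V : normedModType R} {p q : nat}
  (f : V -> 'M[R]_(p, q)) (t v : V)
    (d : 'M[R]_(p, q)) :
  (forall i j, is_derive t v (fun s => f s i j) (d i j)) -> is_derive t v f d.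
Proof.
move=> fd; have df : derivable f t v by apply/derivable_mxP => i j; have [] := fd i j.
by split => //; rewrite derive_mx//; apply/matrixP => i j; rewrite mxE;
  have [_] := fd i j.
Qed.

Lemma continuous_mx_at {R : realType} {T : topologicalType} {p q : nat}
  (f : T -> 'M[R]_(p, q)) (t : T) :
  (forall i j, {for t, continuous (fun s => f s i j)}) -> {for t, continuous f}.
Proof.
move=> cf; apply/cvgrPdist_le => e e0.
have : \forall s \near t, forall ij : 'I_p * 'I_q, `|f t ij.1 ij.2 - f s ij.1 ij.2| <= e.
  by apply: (@filter_forall _ _ _ (nbhs t)) => ij; have /cvgrPdist_le := cf ij.1 ij.2;
    apply.
apply: filterS => s sP; rewrite [leLHS]/Num.Def.normr/= mx_normrE.
apply/bigmax_le => [|ij _]; first exact: ltW.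
by rewrite !mxE; exact: sP.
Qed.

Lemma continuous_mulmx_at {R : realType} {T : topologicalType} {p q r : nat}
    (f : T -> 'M[R]_(p, q)) (h : T -> 'M[R]_(q, r)) (t : T) :
  (forall i j, {for t, continuous (fun s => f s i j)}) ->
  (forall i j, {for t, continuous (fun s => h s i j)}) ->
  forall i j, {for t, continuous (fun s => (f s *m h s) i j)}.
Proof.
move=> cf ch i j; under [X in {for _, continuous X}]eq_fun do rewrite mxE.
rewrite /prop_for /continuous_at.
apply: (@cvg_fsum R T _ (nbhs t) _ _ (fun k s => f s i k * h s k j)) => k.
by apply: cvgM; [exact: cf|exact: ch].
Qed.

Lemma is_derive_affine_theta {R : realType} {p : nat} (a b : 'rV[R]_p) (t : R) :
  is_derive t 1 (fun s => a + theta s *: b) (dtheta t *: b).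
Proof.
apply: is_derive_mx => i j.
rewrite (_ : (fun s => _) = (cst (a i j) + (b i j) *: theta)); last first.
  by apply/funext => s; rewrite !mxE !fctE /GRing.scale /= mulrC.
rewrite mxE mulrC -[X in is_derive _ _ _ X]add0r.
exact: is_deriveD (is_derive_cst (a i j) t 1) (is_deriveZ (b i j) (is_derive_theta t)).
Qed.

(** * Euclidean segments as curves of the manifold *)

Section Segment.
Context {R : realType} {M : ptopologicalType} {m n : nat}.
Context {A : smooth_atlas R M m} {g : riemannian_metric A} (S : spin_structure g).
Context (N : M -> 'rV[R]_n) (iso : isometric_embedding g N).
Hypothesis convN : convex_set (range N).

Let J i (y : 'rV[R]_m) : 'M[R]_(m, n) := jacobian (fun z => N (chart_inv (A i) z)) y.
(** This is J^T g^-1, with g^-1 written through the frame. Since tangent vectors are rows mapped by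
    v |-> v J, it undoes the differential when J L = 1. *)
Let L i (y : 'rV[R]_m) : 'M[R]_(n, m) := (J i y)^T *m ((frame S i y)^T *m frame S i y).

Let smN i : smooth_map (chart_codom (A i)) (fun z => N (chart_inv (A i) z)).
Proof. exact: (embedding_smooth iso). Qed.

Let oc i := open_codom (c := A i).

Let JL i y : chart_codom (A i) y -> J i y *m L i y = 1%:M.
Proof. by move=> iy; rewrite mulmxA -(embedding_pullback iso iy) frame_inv_r. Qed.

Let L_continuous i y p q : chart_codom (A i) y ->
  {for y, continuous (fun z => L i z p q)}.
Proof.
move=> iy; have cE a k : {for y, continuous (fun z => frame S i z a k)}.
  exact: smooth_on_continuous (frame_smooth S (i := i) a k) iy.
apply: continuous_mulmx_at => k l.
  have -> : (fun z => (J i z)^T k l) = (fun z => J i z l k).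
    by apply/funext => z; rewrite [LHS]mxE.
  have := smooth_on_continuous (smooth_on_partial l (@smN i k)) iy.
  apply: (continuous_eq_on (@oc i)) iy => z iz.
  by rewrite /J (jacobianE l k (@oc i) (@smN i) iz).
apply: continuous_mulmx_at => // a b.
have -> : (fun z => (frame S i z)^T a b) = (fun z => frame S i z b a) => //.
by apply/funext => z; rewrite [LHS]mxE.
Qed.

(* [is_derive_of_comp] applies to N composed with J^T g^-1, which is a left
   inverse of the differential J of N. *)
Lemma coord_derivable (c : R -> M) (a w : 'rV[R]_n) (s : R) i :
  {for s, continuous c} -> chart_dom (A i) (c s) ->
  (\forall r \near s, N (c r) = a + theta r *: w) ->
  is_derive s 1 (fun r => chart_coord (A i) (c r))
    (dtheta s *: (w *m L i (chart_coord (A i) (c s)))).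
Proof.
move=> cc ics cN; set y0 := chart_coord (A i) (c s).
have iy0 : chart_codom (A i) y0 by exact: chart_codomI.
(* [L0] is frozen at y0, so that G is a smooth map between spaces of equal dimension with
   differential the identity at y0. *)
pose L0 := L i y0; pose G z := N (chart_inv (A i) z) *m L0.
have dom_near : \forall r \near s, chart_dom (A i) (c r).
  by apply: cc; apply: open_nbhs_nbhs; split => //; exact: chart_dom_open.
have GE k : (fun z => G z 0 k) = fun z => \sum_j L0 j k * N (chart_inv (A i) z) 0 j.
  by apply/funext => z; rewrite mxE; apply: eq_bigr => j _; rewrite mulrC.
have sG : smooth_map (chart_codom (A i)) G.
  move=> k; rewrite GE; apply: smooth_on_sum => [|j]; first exact: oc.
  by apply: smooth_onZ; [exact: oc|exact: smN].
have JG : jacobian G y0 = 1%:M.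
  have dN := smooth_map_differentiable (@oc i) (@smN i) iy0.
  rewrite -(JL iy0); apply/matrixP => k l.
  rewrite (jacobianE k l (@oc i) sG iy0) GE mxE.
  rewrite /partial (_ : (fun z => _) = \sum_j
    (L0 j l *: (fun z => N (chart_inv (A i) z) 0 j))); last first.
    by apply/funext => z; rewrite fct_sumE.
  have dl j : derivable (fun z => N (chart_inv (A i) z) 0 j) y0 (delta_mx 0 k).
    exact: smooth_on_derivable (@smN i j) iy0.
  rewrite derive_sum => [|j]; last exact: derivableZ.
  apply: eq_bigr => j _; rewrite deriveZ//.
  by rewrite /J (jacobianE k j (@oc i) (@smN i) iy0) /GRing.scale /= mulrC.
apply: (@is_derive_of_comp R m G).
- apply: (@continuous_comp _ _ _ c (chart_coord (A i))) => //.
  exact: Defs.coord_continuous.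
- move=> e e0.
  have : \forall h \near (0 : 'rV[R]_m), forall k : 'I_m,
     `|G (y0 + h) 0 k - G y0 0 k - h 0 k| <= e * `|h|.
    apply: (@filter_forall _ _ _ (nbhs (0 : 'rV[R]_m))) => k.
    have dG : forall j, \forall y \near y0, derivable (fun z => G z 0 k) y (delta_mx 0 j).
      by move=> j; apply: (near_open (@oc i) iy0) => z; exact: smooth_on_derivable (sG k).
    have cG : forall j, {for y0, continuous (partial j (fun z => G z 0 k))}.
      by move=> j; exact: smooth_on_continuous (smooth_on_partial j (sG k)) iy0.
    apply: (@filterS _ (nbhs (0 : 'rV[R]_m)) _ _ _ _ (C1_littleo e0 dG cG)) => // h.
    suff -> : lin_form (fun j => partial j (fun z => G z 0 k) y0) h = h 0 k by [].
    rewrite -[h in RHS]mulmx1 -JG mxE; apply: eq_bigr => j _.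
    by rewrite (jacobianE j k (@oc i) sG iy0).
  move=> /nbhs_ballP[d /= d0 dP]; apply/nbhs_ballP; exists d => //= y.
  rewrite -ball_normE /= distrC => yd.
  have := dP (y - y0); rewrite -ball_normE /= sub0r normrN => /(_ yd) H.
  apply: norm_le_coord => [|k]; first by rewrite mulr_ge0// ltW.
  by rewrite !mxE; have := H k; rewrite subrKC !mxE.
- rewrite scalemxAl.
  (* Along the curve G is affine in [theta], which makes the derivative of the composite
     explicit. *)
  apply: (@near_eq_is_derive _ _ _ (fun r => a *m L0 + theta r *: (w *m L0))); last first.
    by rewrite -scalemxAl; exact: is_derive_affine_theta.
  apply: filterS2 dom_near cN => r ir cr.
  by rewrite /G coordK// cr mulmxDl -scalemxAl.
Qed.

Definition embedding_inv (xi : 'rV[R]_n) : M := get [set z | N z = xi].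

Lemma embedding_invK xi : range N xi -> N (embedding_inv xi) = xi.
Proof. by move=> [z _ zxi]; apply: (@getPex _ [set z | N z = xi]); exists z. Qed.

Lemma embeddingK z : embedding_inv (N z) = z.
Proof. by apply: (embedding_inj iso); apply: embedding_invK; exists z. Qed.

(** By [embedding_open] the open sets of M are preimages under N of open sets, so N is a
    homeomorphism onto its range. *)
Lemma embedding_inv_continuous {T : topologicalType} (l : T -> 'rV[R]_n) (t : T) :
  (forall s, range N (l s)) -> {for t, continuous l} ->
  {for t, continuous (fun s => embedding_inv (l s))}.
Proof.
move=> rl cl U /=; rewrite nbhsE => -[B [oB Bt] BU].
have [V oV BV] := embedding_open iso oB.
have Vt : V (l t) by move: Bt; rewrite BV /= embedding_invK.
have : \forall s \near t, V (l s) by apply: cl; exact: open_nbhs_nbhs.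
by apply: filterS => s Vs; apply: BU; rewrite BV /= embedding_invK.
Qed.

Lemma segment_range x y (k : R) : 0 <= k <= 1 -> range N (N x + k *: (N y - N x)).
Proof.
move=> /andP[k0 k1].
have -> : N x + k *: (N y - N x) = k *: N y + (1 - k) *: N x.
  by rewrite scalerBl scale1r scalerBr addrCA addrC -!addrA; congr (_ + _); rewrite addrC.
have := @convN (N y) (N x) (Itv01 k0 k1); rewrite !inE.
exact (fun H => H (ex_intro2 _ _ y I erefl) (ex_intro2 _ _ x I erefl)).
Qed.

Let segment_curve x y (t : R) : M := embedding_inv (N x + theta t *: (N y - N x)).

Let segment_curveE x y t : N (segment_curve x y t) = N x + theta t *: (N y - N x).
Proof. by apply: embedding_invK; apply: segment_range; exact: theta_range. Qed.

Let segment_curve_continuous x y t : {for t, continuous (segment_curve x y)}.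
Proof.
apply: embedding_inv_continuous => [s|].
  by apply: segment_range; exact: theta_range.
have [d _] := is_derive_affine_theta (N x) (N y - N x) t.
by apply: differentiable_continuous; exact/derivable1_diffP.
Qed.

Let segment_coord x y s i : chart_dom (A i) (segment_curve x y s) ->
  is_derive s 1 (fun r => chart_coord (A i) (segment_curve x y r))
    (dtheta s *: ((N y - N x) *m L i (chart_coord (A i) (segment_curve x y s)))).
Proof.
move=> ics; apply: (@coord_derivable (segment_curve x y) (N x) (N y - N x) s i _ ics).
  exact: (@segment_curve_continuous x y s).
by apply: filterE => r; exact: segment_curveE.
Qed.

Lemma segment_C1 x y : @C1_curve R M m A (segment_curve x y).
Proof.
move=> t _; split; first exact: (@segment_curve_continuous x y t).
move=> i ict.
have dom_near : \forall r \near t, chart_dom (A i) (segment_curve x y r).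
  apply: (@segment_curve_continuous x y t); apply: open_nbhs_nbhs; split => //.
  exact: chart_dom_open.
split.
  by apply: filterS dom_near => s ics; have [] := segment_coord ics.
pose D s := dtheta s *: ((N y - N x) *m L i (chart_coord (A i) (segment_curve x y s))).
have E : \forall s \near t, D s = derive1 (fun r =>
  chart_coord (A i) (segment_curve x y r)) s.
  by apply: filterS dom_near => s ics; rewrite derive1E; have [_ ->] := segment_coord ics.
rewrite /prop_for /continuous_at -(nbhs_singleton E).
apply: (cvg_trans (near_eq_cvg E)).
rewrite /D; apply: cvgZ; first exact: continuous_dtheta.
apply: (@continuous_mx_at R R 1 m (fun s => (N y - N x) *m
  L i (chart_coord (A i) (segment_curve x y s))) t).
apply: continuous_mulmx_at => a b.
  exact: cst_continuous.
apply: (@continuous_comp _ _ _ (fun s => chart_coord (A i) (segment_curve x y s))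
  (fun z => L i z a b)).
  apply: (@continuous_comp _ _ _ (segment_curve x y) (chart_coord (A i))).
    exact: (@segment_curve_continuous x y t).
  exact: Defs.coord_continuous.
by apply: L_continuous; exact: chart_codomI.
Qed.

(** [enorm_jacobian] turns the Riemannian norm of the velocity into the Euclidean norm of its image
    under J, and this image is the velocity of the parametrized segment. *)
Lemma segment_speed x y t : 0 <= t <= 1 ->
  speed g (segment_curve x y) t = dtheta t * enorm (N y - N x).
Proof.
move=> t01; rewrite /speed; set i := chart_at A _.
have ict : chart_dom (A i) (segment_curve x y t) by exact: chart_at_dom.
have dom_near : \forall r \near t, chart_dom (A i) (segment_curve x y r).
  apply: (@segment_curve_continuous x y t); apply: open_nbhs_nbhs; split => //.
  exact: chart_dom_open.
have [dd dE] := segment_coord ict.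
rewrite -(enorm_jacobian iso _ (chart_codomI ict)).
rewrite -(ger0_norm (dtheta_ge0 t01)) -enormZ; congr enorm.
rewrite derive1E dE.
have : is_derive t 1 (fun r => N (segment_curve x y r)) (dtheta t *: (N y - N x)).
  under [X in is_derive _ _ X _]eq_fun do rewrite segment_curveE.
  exact: is_derive_affine_theta.
move=> [dN NE]; apply/rowP => j.
have cN : derivable (fun r => N (segment_curve x y r) 0 j) t 1 /\
   'D_1 (fun r => N (segment_curve x y r) 0 j) t = (dtheta t *: (N y - N x)) 0 j.
  split; first exact: (derivable_mxP _ _ _).1 dN 0 j.
  by rewrite -NE derive_mx// mxE.
have sN : smooth_fun A (fun x => N x 0 j) by move=> k; exact: (@smN k j).
have [_ H] := is_derive_along sN dom_near dd.
rewrite -cN.2 [RHS]H derive1E dE mxE.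
apply: eq_bigr => k _; congr (_ * _).
by rewrite /J (jacobianE k j (@oc i) (@smN i) (chart_codomI ict)).
Qed.

(** The length of the curve is |N y - N x| times the integral of [dtheta] over [0, 1], which is
    1. *)
Lemma geodesic_le_enorm x y : (geodesic_dist g x y <= (enorm (N y - N x))%:E)%E.
Proof.
have [c0 c1] : segment_curve x y 0 = x /\ segment_curve x y 1 = y.
  split; apply: (embedding_inj iso); rewrite segment_curveE.
    by rewrite theta0 scale0r addr0.
  by rewrite theta1 scale1r addrC subrK.
have j : joined g x y (curve_length g (segment_curve x y) + 0)%E.
  by apply: joined_step (segment_C1 x y) c0 c1 _; exact: joined_refl.
apply: (le_trans (ereal_inf_lbound j)); rewrite adde0 /curve_length.
have -> : (\int[lebesgue_measure]_(t in `[0%R, 1%R]) (speed g (segment_curve x y) t)%:E =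
    \int[lebesgue_measure]_(t in `[0%R, 1%R]) (dtheta t * enorm (N y - N x))%:E)%E.
  by apply: eq_integral => t; rewrite inE /= in_itv /= => t01; rewrite segment_speed.
have dF (t : R) : is_derive t 1 ((enorm (N y - N x)) *: theta)
  (dtheta t * enorm (N y - N x)).
  have dt := is_derive_theta t; apply: is_derive_eq.
  by rewrite /GRing.scale /= mulrC.
have cF (t : R) : {for t, continuous ((enorm (N y - N x)) *: theta)}.
  by have [d _] := dF t; apply: differentiable_continuous; exact/derivable1_diffP.
rewrite (@continuous_FTC2 _ _ ((enorm (N y - N x)) *: theta)) //.
- by rewrite !fctE theta0 theta1 scaler0 sube0 [_ *: _]mulr1.
- apply: continuous_subspaceT => t; apply: cvgM; last exact: cvg_cst.
  exact: continuous_dtheta.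
- split.
  + by move=> t _; have [] := dF t.
  + by apply: cvg_at_right_filter; exact: cF.
  + by apply: cvg_at_left_filter; exact: cF.
- by move=> t _; rewrite derive1E; have [_ ->] := dF t.
Qed.

Lemma geodesic_distE x y : geodesic_dist g x y = (enorm (N y - N x))%:E.
Proof. by apply/eqP; rewrite eq_le geodesic_le_enorm enorm_le_geodesic. Qed.

End Segment.

Lemma measurable_borel_continuous {R : realType} {T : ptopologicalType} (h : T -> R) :
  continuous h -> measurable_fun [set: borel T] (h : borel T -> R).
Proof.
move=> /continuousP ch; apply: (measurability _ (RGenOpens.measurableE R)) =>
  _ [_ [a [b ->] <-]].
rewrite setTI; apply: sub_sigma_algebra; apply: ch; exact: interval_open.
Qed.

Lemma dot_expand {R : realType} {n : nat} (u w : 'rV[R]_n) (k : R) :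
  dot (u + k *: w) (u + k *: w) = dot u u + k * (2 * dot u w + k * dot w w).
Proof. by rewrite dotDl !dotDr !dotZl !dotZr (dotC w u); ring. Qed.

(** * Properness of the embedding and projection on its range *)

Section ClosedRange.
Context {R : realType} {M : ptopologicalType} {m n : nat}.
Context {A : smooth_atlas R M m} {g : riemannian_metric A} (S : spin_structure g).
Context (N : M -> 'rV[R]_n) (iso : isometric_embedding g N).
Hypothesis convN : convex_set (range N).
Hypothesis complete : riemannian_complete g.

Let dE := geodesic_distE S iso convN.

(** By [geodesic_distE] a sequence of M whose images converge is Cauchy for the geodesic distance;
    the image of its limit is the limit of the images. *)
Lemma closed_range_embedding : closed (range N).
Proof.
move=> xi cxi.
have H (k : nat) : exists x, `|N x - xi| < k.+1%:R^-1.
  have k0 : 0 < k.+1%:R^-1 :> R by rewrite invr_gt0 ltr0n.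
  have [_ [[x _ <-]]] := cxi _ (nbhsx_ballx xi _ k0).
  by rewrite -ball_normE /= distrC => ?; exists x.
have [u uP] := choice H.
(* [n.+1] dominates the constant n of [enorm_le_norm] and stays positive for n = 0. *)
have n0 : 0 < n.+1%:R :> R by rewrite ltr0n.
have bound (e : R) : 0 < e -> exists k, forall p, (k <= p)%N -> n.+1%:R * `|N (u p)
  - xi| < e.
  move=> e0; have [k _ kP] := near_infty_natSinv_lt (PosNum (divr_gt0 e0 n0)).
  exists k => p kp; rewrite mulrC -ltr_pdivlMr//.
  exact: lt_trans (uP p) (kP p kp).
have en (v : 'rV[R]_n) : enorm v <= n.+1%:R * `|v| :> R.
  by rewrite (le_trans (enorm_le_norm v))// ler_wpM2r// ler_nat.
have [e e0|x xP] := complete (u := u).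
  have e2 : 0 < e / 2 by rewrite divr_gt0.
  have [k kP] := bound _ e2; exists k => p q kp kq.
  rewrite dE lte_fin (le_lt_trans (en _))// -(subrKA xi).
  apply: (@le_lt_trans _ _ (n.+1%:R * (`|N (u q) - xi| + `|xi - N (u p)|))).
    by rewrite ler_wpM2l// ler_normD.
  by rewrite mulrDr (splitr e) ltrD// ?kP// distrC kP.
exists x => //; apply/eqP; rewrite -subr_eq0 -normr_eq0; apply/eqP.
apply/eqP; rewrite eq_le normr_ge0 andbT; apply/ler_addgt0Pr => e e0; rewrite add0r.
have e2 : 0 < e / 2 by rewrite divr_gt0.
have [k kP] := bound _ e2; have [l lP] := xP _ e2.
have := lP (maxn k l) (leq_maxr _ _); rewrite dE lte_fin => H1.
have H2 : `|N (u (maxn k l)) - xi| < e / 2.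
  apply: le_lt_trans (kP _ (leq_maxl k l)).
  by rewrite ler_peMl// ler1n.
rewrite -(subrKA (N (u (maxn k l)))) (le_trans (ler_normD _ _))// (splitr e) lerD// ltW//.
exact: le_lt_trans (norm_le_enorm _) H1.
Qed.

(** Properness of N: this set is the image, under the continuous inverse of N, of a closed bounded
    part of the range. *)
Lemma compact_embedding_ball (r : R) : compact [set x | `|N x| <= r].
Proof.
pose K := range N `&` [set xi : 'rV[R]_n | `|xi| <= r].
have cK : compact K.
  apply: bounded_closed_compact.
    exists r; split; first exact: num_real.
    by move=> s rs xi [_ /= H]; rewrite (le_trans H)// ltW.
  apply: closedI; first exact: closed_range_embedding.
  apply: (@preimage_closed _ _ (fun xi : 'rV[R]_n => `|xi|) [set s | s <= r]).
    by move=> xi _; exact: norm_continuous.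
  exact: closed_le.
rewrite (_ : [set x | _] = embedding_inv N @` K); last first.
  apply/seteqP; split=> [x /= xr|_ [_ [[x _ <-] /= xr] <-]].
    by exists (N x); [split => //; exists x|exact: embeddingK iso _].
  by rewrite /= (embeddingK iso).
apply: continuous_compact => //; apply/subspace_continuousP => xi [rxi _].
move=> U /=; rewrite nbhsE => -[B [oB Bt] BU].
have [V oV BV] := embedding_open iso oB.
have Vxi : V xi by move: Bt; rewrite BV /= embedding_invK.
have : \forall z \near xi, V z by exact: open_nbhs_nbhs.
by apply: filterS => z Vz [rz _]; apply: BU; rewrite BV /= embedding_invK.
Qed.

Lemma closed_convex_projection (b : 'rV[R]_n) :
  exists p : M, forall x, 0 <= dot (N p - b) (N x - N p).
Proof.
pose x0 : M := point; pose F (xi : 'rV[R]_n) := dot (xi - b) (xi - b).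
have cF : continuous F.
  have FE : F = fun xi : 'rV[R]_n => \sum_j (xi 0 j - b 0 j) * (xi 0 j - b 0 j).
    by apply/funext => xi; rewrite /F dotE; apply: eq_bigr => j _; rewrite !mxE.
  rewrite FE => xi; apply: (@cvg_fsum R _ _ (nbhs xi) _ _ (fun j (xi : 'rV[R]_n) =>
    (xi 0 j - b 0 j) * (xi 0 j - b 0 j))) => j.
  by apply: cvgM; (apply: cvgB; [exact: coord_continuous|exact: cvg_cst]).
have FN : continuous (F \o N).
  by move=> x; apply: continuous_comp; [exact: continuous_embedding iso x|exact: cF].
(* Beyond this radius the distance to b exceeds that of N x0, so a minimum over the compact set is a
   minimum over the whole range. *)
pose r := `|b| + enorm (N x0 - b).
have nz : [set x | `|N x| <= r] !=set0.
  exists x0 => /=; rewrite -[N x0](subrK b) addrC (le_trans (ler_normD _ _))// lerD2l.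
  exact: norm_le_enorm.
have [|p _ pmin] := @compact_EVT_min _ R (F \o N) _ nz (@compact_embedding_ball r).
  exact: continuous_subspaceT.
have {}pmin x : F (N p) <= F (N x).
  have [xr|xr] := leP `|N x| r; first by apply: pmin; rewrite inE.
  apply: (@le_trans _ _ (F (N x0))).
    apply: pmin; rewrite inE /= -[N x0](subrK b) addrC (le_trans (ler_normD _ _))//
      lerD2l.
    exact: norm_le_enorm.
  rewrite /F -!enorm_sqr ler_sqr ?nnegrE ?enorm_ge0//.
  rewrite (le_trans _ (norm_le_enorm _))//.
  have : `|N x| <= `|b| + `|N x - b|.
    by rewrite -[in leLHS](subrK b (N x)) addrC ler_normD.
  by move: xr; rewrite /r; lra.
exists p => x.
set u := N p - b; set w := N x - N p.
have H (k : R) : 0 <= k <= 1 -> 0 <= k * (2 * dot u w + k * dot w w).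
  move=> k01; have [z _ zE] := segment_range convN p x k01.
  have := pmin z; rewrite /F (_ : N z - b = u + k *: w); last by rewrite zE addrAC.
  by rewrite dot_expand lerDl.
rewrite leNgt; apply/negP => uw.
(* If u.w < 0, moving from p towards x comes closer to b. The optimal step is - u.w / |w|^2,
   replaced by 1 when |w|^2 <= - u.w. *)
have [w0|w0] := leP (dot w w) (- dot u w).
  by have := H 1; rewrite lexx ler01 => /(_ isT); lra.
have wp : 0 < dot w w by apply: lt_trans w0; rewrite oppr_gt0.
pose k := - dot u w / dot w w.
have kp : 0 < k by rewrite divr_gt0 ?oppr_gt0.
have k1 : k <= 1 by rewrite ler_pdivrMr// mul1r ltW.
have := H k; rewrite (ltW kp) k1 => /(_ isT).
rewrite pmulr_rge0// divfK ?gt_eqF//; lra.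
Qed.

End ClosedRange.

(** * Barycenters *)

Lemma measurable_borel_map {T U : ptopologicalType} (h : T -> U) :
  continuous h -> measurable_fun [set: borel T] (h : borel T -> borel U).
Proof.
move=> /continuousP ch; apply: (@measurability _ _ (borel T) (borel U) setT h (@open U))
  => //.
move=> _ [B oB <-]; rewrite setTI; apply: sub_sigma_algebra; exact: ch.
Qed.

Section Moments.
Context {R : realType} {M : ptopologicalType} {m n : nat}.
Context {A : smooth_atlas R M m} {g : riemannian_metric A} (S : spin_structure g).
Context (N : M -> 'rV[R]_n) (iso : isometric_embedding g N).
Hypothesis convN : convex_set (range N).
Hypothesis complete : riemannian_complete g.
Variable mu : probability (borel M) R.
Hypothesis moment : finite_first_moment g mu.

Let dE := geodesic_distE S iso convN.
Let cN := continuous_embedding iso.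

Lemma enorm_continuous : continuous (@enorm R n).
Proof.
have dc : continuous (fun xi : 'rV[R]_n => dot xi xi).
  rewrite (_ : (fun xi : 'rV[R]_n => dot xi xi) = fun xi : 'rV[R]_n =>
    \sum_j xi 0 j * xi 0 j); last first.
    by apply/funext => xi; rewrite dotE.
  move=> xi; apply: (@cvg_fsum R _ _ (nbhs xi) _ _ (fun j (xi : 'rV[R]_n) =>
    xi 0 j * xi 0 j)) => j.
  by apply: cvgM; exact: coord_continuous.
by move=> xi; apply: (@continuous_comp _ _ _ (fun xi : 'rV[R]_n => dot xi xi) Num.sqrt);
  [exact: dc|exact: sqrt_continuous].
Qed.

Lemma continuous_embedding_dist x0 : continuous (fun x => enorm (N x - N x0)).
Proof.
move=> x; apply: (@continuous_comp _ _ _ (fun x => N x - N x0) (@enorm R n)).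
  by apply: cvgB; [exact: cN|exact: cvg_cst].
exact: enorm_continuous.
Qed.

(** |h| is dominated by |h x0| + |N x - N x0|, whose second term is d(x0, x), integrable by the
    moment condition. *)
Lemma integrable_lipschitz (h : M -> R) : continuous h ->
  (forall x y, `|h y - h x| <= enorm (N y - N x)) ->
  mu.-integrable setT (EFin \o (h : borel M -> R)).
Proof.
move=> ch lh; have [x0 x0_fin] := moment.
have mh := measurable_borel_continuous ch.
have md := measurable_borel_continuous (@continuous_embedding_dist x0).
have idist : mu.-integrable setT (EFin \o (fun x : borel M => enorm (N x - N x0))).
  apply/integrableP; split; first exact/measurable_EFinP.
  apply: le_lt_trans x0_fin; apply: le_integral_any => x _ //=.
  by rewrite dE ger0_norm ?enorm_ge0.
have ic := finite_measure_integrable_cst mu `|h x0| (@measurableT _ (borel M)).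
apply: le_integrable (integrableD measurableT ic idist) => //;
  first exact/measurable_EFinP.
move=> x _ /=; rewrite lee_fin [leRHS]ger0_norm ?addr_ge0 ?enorm_ge0//.
by rewrite -{1}(subrKC (h x0) (h x)) (le_trans (ler_normD _ _))// lerD2l.
Qed.

Lemma integrable_coord j : mu.-integrable setT (EFin \o (fun x : borel M => N x 0 j)).
Proof.
apply: (@integrable_lipschitz (fun x => N x 0 j)).
  by move=> x; apply: (@continuous_comp _ _ _ N (fun xi : 'rV[R]_n => xi 0 j));
    [exact: cN|exact: coord_continuous].
by move=> x y; have := coord_le_enorm (N y - N x) j; rewrite !mxE.
Qed.

Lemma barycenter_coord j : barycenter N mu 0 j = \int[mu]_x (N x 0 j).
Proof.
rewrite mxE /Rintegral; congr fine.
rewrite integral_pushforward//.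
- exact: measurable_borel_map.
- apply/measurable_EFinP; apply: measurable_borel_continuous => xi;
  exact: coord_continuous.
- rewrite preimage_setT; exact: integrable_coord.
Qed.

Let dot_sum u : (fun x : borel M => (dot u (N x))%:E) = fun x =>
  (\sum_j (u 0 j * N x 0 j)%:E)%E.
Proof. by apply/funext => x; rewrite dotE -sumEFin. Qed.

Let integrable_term (u : 'rV[R]_n) j : mu.-integrable setT (fun x : borel M =>
  (u 0 j * N x 0 j)%:E).
Proof. under eq_fun do rewrite EFinM; exact: integrableZl (integrable_coord j). Qed.

Lemma integrable_dot u : mu.-integrable setT (fun x : borel M => (dot u (N x))%:E).
Proof. by rewrite dot_sum; apply: integrable_sum => // j _; exact: integrable_term. Qed.

Lemma integral_dot u : (\int[mu]_x (dot u (N x))%:E = (dot u (barycenter N mu))%:E)%E.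
Proof.
rewrite dot_sum (@integral_sum _ _ _ mu _ measurableT _ _ (@integrable_term u)).
rewrite dotE -sumEFin; apply: eq_bigr => j _; rewrite barycenter_coord EFinM.
under eq_integral do rewrite EFinM.
rewrite integralZl//; last exact: integrable_coord.
by rewrite fineK// integrable_fin_num//; exact: integrable_coord.
Qed.

(** With p the projection of b and u = N p - b, integrating u.N p <= u.N x yields u.N p <= u.b, that
    is |u|^2 <= 0. *)
Lemma barycenter_range : range N (barycenter N mu).
Proof.
set b := barycenter N mu.
have [p pP] := closed_convex_projection S iso convN complete b.
set u := N p - b.
have : ((dot u (N p))%:E <= \int[mu]_x (dot u (N x))%:E)%E.
  rewrite -[leLHS](_ : \int[mu]_x (cst (dot u (N p))%:E x) = _)%E; last first.
    rewrite integral_cst// -[RHS]mule1; congr (_ * _)%E; exact: (probability_setT mu).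
  apply: le_integral => //.
  - exact: finite_measure_integrable_cst.
  - exact: integrable_dot.
  - by move=> x _; rewrite /= lee_fin -subr_ge0 -dotNr -dotDr.
rewrite integral_dot lee_fin -/b -subr_ge0 -dotNr -dotDr -opprB dotNr oppr_ge0 => H.
have /eqP u0 : u == 0.
  by apply/eqP/dot_eq0/eqP; rewrite eq_le H dot_ge0.
by exists p => //; apply/eqP; rewrite -subr_eq0 -/u u0.
Qed.

Lemma mean_pointE : N (mean_point N mu) = barycenter N mu.
Proof. exact: (embedding_invK barycenter_range). Qed.

End Moments.

(** * The lower bound: test functions *)

Section TestFunction.
Context {R : realType} {n : nat}.
Variables (u : 'rV[R]_n) (u1 : dot u u <= 1).

Definition damped (e : R) (xi : 'rV[R]_n) : R := dot u xi / (1 + e * dot xi xi).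

Lemma damped_den_gt0 (e : R) (xi : 'rV[R]_n) : 0 <= e -> 0 < 1 + e * dot xi xi.
Proof. by move=> e_ge0; rewrite ltr_pwDl// mulr_ge0// dot_ge0. Qed.

Let den e (xi : 'rV[R]_n) : R := 1 + e * \sum_j xi 0 j * xi 0 j.

Let denE e : (fun xi => 1 + e * dot xi xi) = den e.
Proof. by apply/funext => xi; rewrite dotE. Qed.

Let smooth_den e : smooth_on setT (den e).
Proof.
apply: smooth_onD; [exact: openT|exact: smooth_on_cst|].
apply: smooth_onZ; first exact: openT.
apply: smooth_on_sum; first exact: openT.
by move=> j; apply: smooth_onM; [exact: openT| |]; exact: smooth_coord openT.
Qed.

Let partial_den e l xi : partial l (den e) xi = 2 * e * xi 0 l.
Proof.
have dl j : derivable (fun xi : 'rV[R]_n => xi 0 j) xi (delta_mx 0 l).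
  exact: (smooth_on_derivable (k := l) (@smooth_coord _ _ j setT openT) (I : setT xi)).
have E : den e = cst 1 + e *: (\sum_j ((fun xi : 'rV[R]_n => xi 0 j) *
  (fun xi : 'rV[R]_n => xi 0 j))).
  by apply/funext => z; rewrite /den !fctE fct_sumE.
have dj j : is_derive xi (delta_mx 0 l) ((fun xi : 'rV[R]_n => xi 0 j) *
  (fun xi : 'rV[R]_n => xi 0 j))
   (2 * xi 0 j * (l == j)%:R).
  split; first exact: derivableM.
  rewrite deriveM//; have := partial_coord l j xi; rewrite /partial => ->.
  by rewrite /GRing.scale /=; ring.
rewrite /partial E deriveD; [|exact: derivable_cst|]; last first.
  by apply: derivableZ; apply: derivable_sum => j; have [] := dj j.
rewrite derive_cst add0r deriveZ; last by apply: derivable_sum => j; have [] := dj j.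
rewrite derive_sum => [|j]; last by have [] := dj j.
rewrite (bigD1 l)//= big1 ?addr0 => [|j jl].
  by have [_ ->] := dj l; rewrite eqxx mulr1 /GRing.scale /=; ring.
by have [_ ->] := dj j; rewrite eq_sym (negbTE jl) mulr0.
Qed.

Lemma smooth_damped e : 0 <= e -> smooth_on setT (damped e).
Proof.
move=> e_ge0; apply: smooth_onM; [exact: openT|exact: smooth_dot|].
apply: (smooth_on_ext openT (f := fun y => (den e y)^-1)); first by move=> y _;
  rewrite -denE.
apply: smooth_onV; [exact: openT| |exact: smooth_den].
by move=> xi _; rewrite -denE gt_eqF// damped_den_gt0.
Qed.

Lemma partial_damped e l xi : 0 <= e ->
  partial l (damped e) xi =
  ((1 + e * dot xi xi)^-1 *: u - (2 * e * dot u xi / (1 + e * dot xi xi) ^+ 2) *: xi) 0 l.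
Proof.
move=> e_ge0; have p0 := damped_den_gt0 xi e_ge0.
have E : damped e = dot u * (fun xi => (den e xi)^-1).
  by apply/funext => z; rewrite /damped -denE.
have dd : derivable (den e) xi (delta_mx 0 l).
  exact: smooth_on_derivable (@smooth_den e) (I : setT xi).
have du : derivable (dot u) xi (delta_mx 0 l).
  exact: smooth_on_derivable (smooth_dot u) (I : setT xi).
have d0 : den e xi != 0 by rewrite -denE gt_eqF.
rewrite /partial E (deriveM du (derivableV d0 dd)) (deriveV d0 dd)
  -/(partial l (dot u) xi) -/(partial l (den e) xi) partial_dot partial_den.
rewrite -denE !mxE /GRing.scale /=; field.
by rewrite gt_eqF.
Qed.

(* The gradient is that of a coordinate of the inversion
   [xi / (1 + e |xi|^2)], and its square length is
   [|u|^2 / d^2 - 4 e (u.xi)^2 / d^4] with [d = 1 + e |xi|^2]. *)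
Lemma partial_damped_le1 e xi : 0 <= e -> \sum_l partial l (damped e) xi ^+ 2 <= 1.
Proof.
move=> e_ge0; have p0 := damped_den_gt0 xi e_ge0.
pose w := (1 + e * dot xi xi)^-1 *: u - (2 * e * dot u xi / (1 + e * dot xi xi) ^+ 2) *:
  xi.
rewrite (_ : \sum_l _ = dot w w); last first.
  by rewrite dotE; apply: eq_bigr => l _; rewrite partial_damped// expr2.
rewrite /w; set d := 1 + _ in p0 *.
have dE : e * dot xi xi = d - 1 by rewrite /d addrAC subrr add0r.
rewrite dotDl !dotDr !dotNl !dotNr !dotZl !dotZr (dotC xi u).
rewrite (_ : _ + _ = dot u u / d ^+ 2 - 4 * e * dot u xi ^+ 2 / d ^+ 4); last first.
  (* The intermediate form is the expanded square with e |xi|^2 replaced by d - 1; its terms of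
     order d^-3 then cancel. *)
  rewrite (_ : dot u u / d ^+ 2 - 4 * e * dot u xi ^+ 2 / d ^+ 4 = dot u u / d ^+ 2
     - 4 * e * dot u xi ^+ 2 / d ^+ 3 + 4 * e * dot u xi ^+ 2 * (d - 1) / d ^+ 4).
    rewrite -dE; field; by rewrite gt_eqF.
  field; by rewrite gt_eqF.
have d1 : 1 <= d by rewrite lerDl mulr_ge0// dot_ge0.
apply: (@le_trans _ _ (dot u u / d ^+ 2)).
  rewrite gerBl divr_ge0 ?exprn_ge0 ?(ltW p0)// mulr_ge0 ?sqr_ge0//.
  by rewrite mulr_ge0.
by rewrite ler_pdivrMr ?exprn_gt0// mul1r (le_trans u1)// exprn_ege1.
Qed.

Lemma damped_le e xi : 0 <= e -> `|damped e xi| <= `|dot u xi|.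
Proof.
move=> e_ge0; have p0 := damped_den_gt0 xi e_ge0.
rewrite /damped normrM normfV ler_pdivrMr ?normr_gt0 ?gt_eqF//.
by rewrite ler_peMr// gtr0_norm// lerDl mulr_ge0// dot_ge0.
Qed.

(** |u.xi| <= |xi| while the denominator exceeds e |xi|^2, so the quotient is below 1 / (e |xi|);
    the threshold is where this equals a. *)
Lemma damped_small e (a : R) xi : 0 < e -> 0 < a -> (e * a)^-1 < enorm xi -> `|damped e
  xi| < a.
Proof.
move=> ep a0 xia; have p0 := damped_den_gt0 xi (ltW ep).
have x0 : 0 < enorm xi by apply: lt_trans xia; rewrite invr_gt0 mulr_gt0.
rewrite /damped normrM normfV (gtr0_norm p0) ltr_pdivrMr//.
have ux : `|dot u xi| <= enorm xi.
  have eu : enorm u <= 1 by rewrite /enorm -[leRHS]sqrtr1 ler_wsqrtr.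
  rewrite ler_norml; apply/andP; split.
    rewrite lerNl -dotNr (le_trans (dot_le_enorm _ _))// enormN ler_piMl ?enorm_ge0//.
  by rewrite (le_trans (dot_le_enorm _ _))// ler_piMl ?enorm_ge0.
apply: (le_lt_trans ux); rewrite mulrDr mulr1 -enorm_sqr expr2 !mulrA.
rewrite (mulrC a) ltr_pwDl// ler_peMl ?enorm_ge0// ltW//.
by rewrite -ltr_pdivrMl ?mulr_gt0// mulr1.
Qed.

Lemma damped_cvg xi : (damped k.+1%:R^-1 xi @[k --> \oo]) --> dot u xi.
Proof.
rewrite -[X in _ --> X](divr1 (dot u xi)); apply: cvgM; first exact: cvg_cst.
apply: cvgV; first exact: oner_neq0.
rewrite -[X in _ --> X]addr0; apply: cvgD; first exact: cvg_cst.
rewrite -(mul0r (dot xi xi)); apply: cvgM; last exact: cvg_cst.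
exact: cvg_harmonic.
Qed.

End TestFunction.

(** * The commutator with the Dirac operator *)

Section ComplexSmooth.
Context {R : realType} {m : nat}.
Local Notation C := R[i].
Implicit Types (U : set 'rV[R]_m) (F G : 'rV[R]_m -> C).

Lemma cReM (a b : C) : complex.Re (a * b) = complex.Re a * complex.Re b - complex.Im a *
  complex.Im b.
Proof. by case: a => ? ?; case: b. Qed.

Lemma cImM (a b : C) : complex.Im (a * b) = complex.Re a * complex.Im b + complex.Im a *
  complex.Re b.
Proof. by case: a => ? ?; case: b. Qed.

Lemma cReD (a b : C) : complex.Re (a + b) = complex.Re a + complex.Re b.
Proof. by case: a => ? ?; case: b. Qed.

Lemma cImD (a b : C) : complex.Im (a + b) = complex.Im a + complex.Im b.
Proof. by case: a => ? ?; case: b. Qed.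

Lemma csmooth_on_cst U (c : C) : csmooth_on U (fun=> c).
Proof. by split; exact: smooth_on_cst. Qed.

Lemma csmooth_onD U F G : open U -> csmooth_on U F -> csmooth_on U G ->
  csmooth_on U (fun y => F y + G y).
Proof.
move=> oU [F1 F2] [G1 G2]; split.
  by apply: (smooth_on_ext oU _ (smooth_onD oU F1 G1)) => y _; rewrite cReD.
by apply: (smooth_on_ext oU _ (smooth_onD oU F2 G2)) => y _; rewrite cImD.
Qed.

Lemma csmooth_onM U F G : open U -> csmooth_on U F -> csmooth_on U G ->
  csmooth_on U (fun y => F y * G y).
Proof.
move=> oU [F1 F2] [G1 G2]; split.
  apply: (smooth_on_ext oU _ (smooth_onD oU (smooth_onM oU F1 G1)
    (smooth_onZ (-1) oU (smooth_onM oU F2 G2)))) => y _.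
  by rewrite cReM mulN1r.
apply: (smooth_on_ext oU _ (smooth_onD oU (smooth_onM oU F1 G2) (smooth_onM oU F2 G1)))
  => y _.
by rewrite cImM.
Qed.

Lemma csmooth_on_sum U (I : Type) (r : seq I) (F : I -> 'rV[R]_m -> C) : open U ->
  (forall i, csmooth_on U (F i)) -> csmooth_on U (fun y => \sum_(i <- r) F i y).
Proof.
move=> oU sF; elim: r => [|a r IH].
  by under eq_fun do rewrite big_nil; exact: csmooth_on_cst.
under eq_fun do rewrite big_cons; exact: (csmooth_onD oU (sF a) IH).
Qed.

Lemma csmooth_on_real U (h : 'rV[R]_m -> R) : smooth_on U h ->
  csmooth_on U (fun y => real_complex R (h y)).
Proof. move=> sh; split; [exact: sh|exact: smooth_on_cst]. Qed.

Lemma csmooth_on_ext U F G : open U -> (forall y, U y -> F y = G y) ->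
  csmooth_on U F -> csmooth_on U G.
Proof.
move=> oU FG [F1 F2]; split; first by apply: (smooth_on_ext oU _ F1) => y /FG ->.
by apply: (smooth_on_ext oU _ F2) => y /FG ->.
Qed.

Lemma csmooth_on_nbhs U F :
  (forall y, U y -> exists2 V, V y & csmooth_on V F) -> csmooth_on U F.
Proof.
by move=> H; split; apply: smooth_on_nbhs => y /H[V Vy []]; exists V.
Qed.

Lemma cpartial_smooth U F k : csmooth_on U F -> csmooth_on U (cpartial k F).
Proof. by move=> [F1 F2]; split; exact: smooth_on_partial. Qed.

Lemma cpartialM U F G k y : csmooth_on U F -> csmooth_on U G -> U y ->
  cpartial k (fun z => F z * G z) y = cpartial k F y * G y + F y * cpartial k G y.
Proof.
move=> [F1 F2] [G1 G2] Uy.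
have dF1 := smooth_on_derivable (k := k) F1 Uy.
have dF2 := smooth_on_derivable (k := k) F2 Uy.
have dG1 := smooth_on_derivable (k := k) G1 Uy.
have dG2 := smooth_on_derivable (k := k) G2 Uy.
rewrite /cpartial /partial.
have -> : (fun z => complex.Re (F z * G z)) =
    (fun z => complex.Re (F z)) * (fun z => complex.Re (G z)) - (fun z =>
      complex.Im (F z)) * (fun z => complex.Im (G z)).
  by apply/funext => z; rewrite cReM.
have -> : (fun z => complex.Im (F z * G z)) =
    (fun z => complex.Re (F z)) * (fun z => complex.Im (G z)) + (fun z =>
      complex.Im (F z)) * (fun z => complex.Re (G z)).
  by apply/funext => z; rewrite cImM.
rewrite (deriveB (derivableM dF1 dG1) (derivableM dF2 dG2)).
rewrite (deriveD (derivableM dF1 dG2) (derivableM dF2 dG1)).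
rewrite (deriveM dF1 dG1) (deriveM dF2 dG2) (deriveM dF1 dG2) (deriveM dF2 dG1).
rewrite /GRing.scale /=; case: (F y) (G y) => [a b] [a' b'] /=.
move: ('D__ (fun z => complex.Re (F z)) y) ('D__ (fun z => complex.Im (F z)) y)
  ('D__ (fun z => complex.Re (G z)) y) ('D__ (fun z => complex.Im (G z)) y) =>
    r1 r2 r3 r4.
by apply/eqP; rewrite eq_complex /=; apply/andP; split; apply/eqP; ring.
Qed.

End ComplexSmooth.

Section Commutator.
Context {R : realType} {M : ptopologicalType} {m : nat}.
Context {A : smooth_atlas R M m} {g : riemannian_metric A}.
Variable S : spin_structure g.
Local Notation C := R[i].

Definition frame_cgrad (i : chart_index A) (f : M -> C) (y : 'rV[R]_m) (a : 'I_m) : C :=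
  \sum_mu real_complex R (frame S i y a mu) * cpartial mu (fun z =>
    f (chart_inv (A i) z)) y.

Lemma clifford_cgrad i f y :
  clifford_cmul (spin_gam S) (frame_cgrad i f y) =
  \sum_mu cpartial mu (fun z => f (chart_inv (A i) z)) y *: curved_gamma S i y mu.
Proof.
rewrite /clifford_cmul /frame_cgrad.
under eq_bigr do rewrite scaler_suml.
rewrite exchange_big; apply: eq_bigr => mu _; rewrite scaler_sumr; apply: eq_bigr => a _.
by rewrite scalerA mulrC.
Qed.

(** The connection terms are of order zero and commute with f. The Leibniz rule leaves -i times
    Clifford multiplication by the gradient. *)
Lemma dirac_commutatorE (f : M -> C) (psi : @spinor_components R M m A) i x :
  csmooth_on (chart_codom (A i)) (fun y => f (chart_inv (A i) y)) ->
  (forall r, csmooth_on (chart_codom (A i)) (fun y => psi i (chart_inv (A i) y) r 0)) ->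
  chart_dom (A i) x ->
  dirac_commutator S f psi i x = - (Complex 0 1 : C) *:
    (clifford_cmul (spin_gam S) (frame_cgrad i f (chart_coord (A i) x)) *m psi i x).
Proof.
move=> sf sp ix; have iy := chart_codomI ix; set y := chart_coord (A i) x in iy *.
rewrite /dirac_commutator /dirac_op /spinor_mul -/y.
rewrite scalerA mulrC -scalerA -scalerBr; congr (_ *: _).
rewrite clifford_cgrad mulmx_suml scaler_sumr -sumrB; apply: eq_bigr => mu _.
rewrite -scalemxAl !scalemxAr -mulmxBr; congr (_ *m _).
rewrite /spin_nabla -/y scalerDr -scalemxAr opprD addrACA subrr addr0.
apply/colP => r; rewrite !mxE.
rewrite (_ : (fun z => _) = fun z => f (chart_inv (A i) z) * psi i (chart_inv (A i) z) r
  0); last first.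
  by apply/funext => z; rewrite mxE.
by rewrite (cpartialM mu sf (sp r) iy) /y coordK// addrK.
Qed.

Lemma sqn_dirac_commutator (f : M -> C) (psi : @spinor_components R M m A) i x :
  csmooth_on (chart_codom (A i)) (fun y => f (chart_inv (A i) y)) ->
  (forall r, csmooth_on (chart_codom (A i)) (fun y => psi i (chart_inv (A i) y) r 0)) ->
  chart_dom (A i) x ->
  sqn (dirac_commutator S f psi i x) =
  sqn (clifford_cmul (spin_gam S) (frame_cgrad i f (chart_coord (A i) x)) *m psi i x).
Proof.
move=> sf sp ix; rewrite dirac_commutatorE// sqnZ sqr_normcE /=.
by rewrite oppr0 expr0n add0r sqrrN expr1n mul1r.
Qed.

Lemma frame_cgrad_real (h : M -> R) i y a : chart_codom (A i) y ->
  frame_cgrad i (fun x => real_complex R (h x)) y a =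
  real_complex R (frame_grad S i y (chart_grad h i y) 0 a).
Proof.
move=> iy; rewrite mxE rmorph_sum; apply: eq_bigr => mu _; rewrite rmorphM /=.
congr (_ * _); rewrite /cpartial /=; congr Complex.
by rewrite /partial derive_cst.
Qed.

Lemma dirac_commutator_norm_le1 (vol : {measure set (borel M) -> \bar R}) (h : M -> R) :
  smooth_fun A h -> grad_le1 g h ->
  (dirac_commutator_norm S vol (fun x => real_complex R (h x)) <= 1)%E.
Proof.
move=> sh gh; apply: ge_ereal_sup => _ [psi [sp p1] <-].
apply/spinor_L2norm_le1; move/spinor_L2norm_le1: p1; apply: le_trans.
apply: le_integral_any => x _; rewrite lee_fin ?sqn_ge0//.
have ix := chart_at_dom A x; set i := chart_at A x in ix *.
rewrite sqn_dirac_commutator//; last 2 first.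
- exact: csmooth_on_real (sh i).
- by move=> r; exact: (spinor_smooth sp).
have iy := chart_codomI ix.
have -> : clifford_cmul (spin_gam S) (frame_cgrad i (fun x => real_complex R (h x))
  (chart_coord (A i) x)) =
   clifford_mul (spin_gam S) (frame_grad S i (chart_coord (A i) x)
     (chart_grad h i (chart_coord (A i) x))).
  by apply: eq_bigr => a _; rewrite frame_cgrad_real.
rewrite sqn_clifford ler_piMl ?sqn_ge0//.
rewrite (le_trans _ (frame_grad_le1 S iy (gh _ _ iy)))// dotE.
by apply: ler_sum => a _; rewrite expr2.
Qed.

End Commutator.

(** * Bump functions and bump spinors *)

Lemma cvg_fprod {R : realType} {T I : Type} {F : set_system T} {FF : Filter F}
    (r : seq I) (f : I -> T -> R) (l : I -> R) :
  (forall i, f i x @[x --> F] --> l i) ->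
  \prod_(i <- r) f i x @[x --> F] --> \prod_(i <- r) l i.
Proof.
move=> fl; elim: r => [|a r IH].
  by rewrite big_nil; under eq_fun do rewrite big_nil; exact: cvg_cst.
by rewrite big_cons; under eq_fun do rewrite big_cons; apply: cvgM.
Qed.

Lemma continuous_det_at {R : realType} {T : topologicalType} {m : nat}
  (f : T -> 'M[R]_m) (t : T) :
  (forall i j, {for t, continuous (fun s => f s i j)}) ->
  {for t, continuous (fun s => \det (f s))}.
Proof.
move=> cf; rewrite /determinant /prop_for /continuous_at.
apply: (@cvg_fsum R T _ (nbhs t) _ _ (fun (sg : 'S_m) s =>
  (-1) ^+ sg * \prod_i f s i (sg i))) => sg.
apply: cvgM; first exact: cvg_cst.
by apply: (@cvg_fprod R T _ (nbhs t) _ _ (fun i s => f s i (sg i))) => i; exact: cf.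
Qed.

Section ChartCube.
Context {R : realType} {M : ptopologicalType} {m : nat}.
Context {A : smooth_atlas R M m} {g : riemannian_metric A} (S : spin_structure g).
Variable vol : {measure set (borel M) -> \bar R}.
Hypothesis volg : riemannian_volume g vol.
Variables (i : chart_index A) (y0 : 'rV[R]_m).

Definition chart_cube (r : R) : set M :=
  [set x | chart_dom (A i) x /\ `|chart_coord (A i) x - y0| < r].

Lemma open_chart_cube r : open (chart_cube r).
Proof.
rewrite openE => x [ix xr].
have := @Defs.coord_continuous _ _ _ (A i) x ix.
have o : nbhs (chart_coord (A i) x) [set y | `|y - y0| < r].
  apply: open_nbhs_nbhs; split => //.
  rewrite (_ : [set y | _] = ball y0 r); first exact: ball_open.
  by apply/seteqP; split => y /=; rewrite -ball_normE /= distrC.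
move=> /(_ _ o) H.
have H1 : nbhs x [set z | `|chart_coord (A i) z - y0| < r] by exact: H.
have H2 : nbhs x (chart_dom (A i)).
  by apply: open_nbhs_nbhs; split => //; exact: chart_dom_open.
by apply: filterS (filterI H1 H2) => z [].
Qed.

Lemma image_chart_cube r : (forall y, `|y - y0| < r -> chart_codom (A i) y) ->
  chart_coord (A i) @` chart_cube r = [set y | `|y - y0| < r].
Proof.
move=> sub; apply/seteqP; split => [_ [x [ix xr] <-]//|y /= yr].
have iy := sub y yr; exists (chart_inv (A i) y); last exact: chart_coordK.
by split; [exact: chart_inv_dom|rewrite chart_coordK].
Qed.

Let vol_cubeE r : (forall y, `|y - y0| < r -> chart_codom (A i) y) ->
  vol (chart_cube r) = lebesgue_integral_rV (fun y =>
      (\1_[set y | `|y - y0| < r] y * Num.sqrt (\det (g i y)))%:E).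
Proof.
move=> sub; rewrite (volg (i := i)).
- by rewrite image_chart_cube.
- by apply: sub_sigma_algebra; exact: open_chart_cube.
- by move=> x [].
Qed.

Lemma vol_chart_cube_fin r (c : R) : 0 < r -> 0 <= c ->
  (forall y, `|y - y0| < r -> chart_codom (A i) y /\ Num.sqrt (\det (g i y)) <= c) ->
  (vol (chart_cube r) < +oo)%E.
Proof.
move=> r0 c0 H; rewrite vol_cubeE; last by move=> y /H[].
apply: le_lt_trans (ltry (c * (2 * r) ^+ m)).
apply: (@lebesgue_integral_rV_upper _ _ _ y0) => // y.
- by move=> yr; rewrite indicE mem_set// mul1r lee_fin; have [] := H y yr.
- by move=> yr; rewrite indicE memNset// mul0r.
Qed.

Lemma vol_chart_cube_gt0 r (c : R) : 0 < r -> 0 < c ->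
  (forall y, `|y - y0| < r -> chart_codom (A i) y /\ c <= Num.sqrt (\det (g i y))) ->
  (0 < vol (chart_cube r))%E.
Proof.
move=> r0 c0 H; rewrite vol_cubeE; last by move=> y /H[].
apply: (@lt_le_trans _ _ (c * (2 * r) ^+ m)%:E).
  by rewrite lte_fin mulr_gt0// exprn_gt0// mulr_gt0.
apply: (@lebesgue_integral_rV_lower _ _ _ y0) => //; first exact: ltW.
- by move=> y yr; rewrite indicE mem_set// mul1r lee_fin; have [] := H y yr.
Qed.

End ChartCube.

Section Bump.
Context {R : realType} {M : ptopologicalType} {m : nat}.
Context {A : smooth_atlas R M m}.
Hypothesis hausM : hausdorff_space M.
Variables (i : chart_index A) (y0 : 'rV[R]_m) (rho : R).
Hypothesis rho0 : 0 < rho.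
Hypothesis ball_sub : forall y, `|y - y0| <= rho -> chart_codom (A i) y.
Local Notation C := R[i].

(** The square of the Euclidean norm keeps the argument smooth. The sup norm being smaller, the bump
    is nonzero only inside the cube of radius rho. *)
Definition coord_bump (y : 'rV[R]_m) : R :=
  flat_exp 0 (rho ^+ 2 - dot (y - y0) (y - y0)).

Lemma coord_bump_smooth : smooth_on setT coord_bump.
Proof.
apply: smooth_on_flat_exp; first exact: openT.
apply: (@smooth_on_ext _ _ setT (fun y : 'rV[R]_m =>
  rho ^+ 2 + -1 * \sum_l (y 0 l + - y0 0 l) * (y 0 l + - y0 0 l))); first exact: openT.
  by move=> y _; rewrite dotE mulN1r; congr (_ - _); apply: eq_bigr => l _; rewrite !mxE.
have oT : open [set: 'rV[R]_m] := openT.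
apply: smooth_onD => //; first exact: smooth_on_cst.
apply: smooth_onZ => //; apply: smooth_on_sum => // l.
have sl : smooth_on setT (fun y : 'rV[R]_m => y 0 l + - y0 0 l).
  by apply: smooth_onD => //; [exact: smooth_coord|exact: smooth_on_cst].
exact: smooth_onM.
Qed.

Lemma coord_bump_supp y : coord_bump y != 0 -> `|y - y0| < rho.
Proof.
move=> b0; apply: (le_lt_trans (norm_le_enorm _)).
rewrite -ltr_sqr ?nnegrE ?enorm_ge0 ?(ltW rho0)// enorm_sqr -subr_gt0 ltNge.
by apply: contra b0 => /(flat_exp_le0 0) H; rewrite /coord_bump H.
Qed.

Lemma coord_bump_center : 0 < coord_bump y0.
Proof. by apply: flat_exp_gt0; rewrite subrr /dot mul0mx mxE subr0 exprn_gt0. Qed.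

Definition chart_bump (x : M) : R :=
  if `[< chart_dom (A i) x >] then coord_bump (chart_coord (A i) x) else 0.

Lemma chart_bumpE x : chart_dom (A i) x -> chart_bump x = coord_bump
  (chart_coord (A i) x).
Proof. by move=> ix; rewrite /chart_bump asboolT. Qed.

Lemma chart_bump_out x : ~ chart_dom (A i) x -> chart_bump x = 0.
Proof. by move=> ix; rewrite /chart_bump asboolF. Qed.

Lemma chart_bump_ge0 x : 0 <= chart_bump x.
Proof. by rewrite /chart_bump; case: ifP => // _; exact: flat_exp_ge0. Qed.

Lemma chart_bump_le1 x : chart_bump x <= 1.
Proof. by rewrite /chart_bump; case: ifP => // _; exact: flat_exp0_le1. Qed.

Definition bump_support : set M := chart_inv (A i) @` [set y | `|y - y0| <= rho].

Lemma compact_bump_support : compact bump_support.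
Proof.
apply: continuous_compact.
  apply: continuous_in_subspaceT => y /set_mem /= yr.
  exact/chart_inv_continuous/ball_sub.
apply: bounded_closed_compact.
  exists (`|y0| + rho); split; first exact: num_real.
  move=> s rs y /= yr; rewrite (le_trans _ (ltW rs))//.
  by rewrite -[y](subrK y0) addrC (le_trans (ler_normD _ _))// lerD2l.
rewrite (_ : [set y | _] = closed_ball y0 rho); first exact: closed_ball_closed.
rewrite closed_ballE//; apply/seteqP; split => y /=; rewrite /closed_ball_ /= distrC //.
Qed.

Lemma chart_bump_supp x : ~ bump_support x -> chart_bump x = 0.
Proof.
move=> Kx; have [ix|/chart_bump_out//] := pselect (chart_dom (A i) x).
rewrite chart_bumpE//; apply/eqP; apply: contrapT => /negP b0; apply: Kx.
exists (chart_coord (A i) x); last exact: coordK.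
by apply: ltW; exact: coord_bump_supp.
Qed.

Lemma open_overlap j :
  open (chart_coord (A j) @` (chart_dom (A j) `&` chart_dom (A i))).
Proof.
rewrite openE => _ [x [jx ix] <-].
have jy := chart_codomI jx.
have H1 : nbhs (chart_coord (A j) x) (chart_codom (A j)).
  by apply: open_nbhs_nbhs; split => //; exact: open_codom.
have H2 : nbhs (chart_coord (A j) x) (chart_inv (A j) @^-1` chart_dom (A i)).
  apply: (chart_inv_continuous jy); rewrite coordK//.
  by apply: open_nbhs_nbhs; split => //; exact: chart_dom_open.
apply: filterS2 H1 H2 => z jz iz; exists (chart_inv (A j) z); last exact: chart_coordK.
by split => //; exact: chart_inv_dom.
Qed.

(** Extension by zero: G is smooth on the overlap only, and outside chart i the product vanishes
    near every point. The latter holds because M is Hausdorff, so that the compact [bump_support] is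
    closed. *)
Lemma csmooth_bump_mul j (G : 'rV[R]_m -> C) :
  csmooth_on (chart_coord (A j) @` (chart_dom (A j) `&` chart_dom (A i))) G ->
  csmooth_on (chart_codom (A j)) (fun y =>
    real_complex R (chart_bump (chart_inv (A j) y)) * G y).
Proof.
move=> sG; apply: csmooth_on_nbhs => y jy.
have [iy|iy] := pselect (chart_dom (A i) (chart_inv (A j) y)).
  exists (chart_coord (A j) @` (chart_dom (A j) `&` chart_dom (A i))).
    by exists (chart_inv (A j) y); [split => //;
      exact: chart_inv_dom|exact: chart_coordK].
  apply: (csmooth_onM (@open_overlap j) _ sG); apply: csmooth_on_real.
  apply: (smooth_on_ext (@open_overlap j) (f := fun z =>
    coord_bump (chart_coord (A i) (chart_inv (A j) z)))).
    by move=> _ [x [jx ix] <-]; rewrite coordK// chart_bumpE.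
  apply: (smooth_on_comp (@open_overlap j) openT _ _ coord_bump_smooth) => //.
  by move=> l; exact: transition_smooth.
have Kc : closed bump_support by exact: compact_closed hausM compact_bump_support.
pose V := chart_codom (A j) `&` (chart_inv (A j) @^-1` ~` bump_support).
have oV : open V.
  rewrite openE => z [jz Kz].
  have H1 : nbhs z (chart_codom (A j)).
    by apply: open_nbhs_nbhs; split => //; exact: open_codom.
  have H2 : nbhs z (chart_inv (A j) @^-1` ~` bump_support).
    apply: (chart_inv_continuous jz).
    by apply: open_nbhs_nbhs; split => //; exact: closed_openC.
  exact: filterI H1 H2.
exists V.
  split => // -[z zr zE]; apply: iy; rewrite -zE; apply: chart_inv_dom; exact: ball_sub.
apply: (csmooth_on_ext oV _ (csmooth_on_cst V 0)) => z [_ Kz].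
by rewrite chart_bump_supp// rmorph0 mul0r.
Qed.

Lemma smooth_chart_bump : smooth_fun A chart_bump.
Proof.
move=> j; have [H _] := csmooth_bump_mul (csmooth_on_cst
  (chart_coord (A j) @` (chart_dom (A j) `&` chart_dom (A i))) 1).
apply: (smooth_on_ext _ _ H); first exact: open_codom.
by move=> y _; rewrite mulr1.
Qed.

End Bump.

(** * Change of chart for gradients and Clifford multiplication *)

Section Covariance.
Context {R : realType} {M : ptopologicalType} {m : nat}.
Context {A : smooth_atlas R M m} {g : riemannian_metric A}.
Variable S : spin_structure g.
Local Notation C := R[i].

Lemma chart_grad_transition (h : M -> R) i j x : smooth_fun A h ->
  chart_dom (A i) x -> chart_dom (A j) x ->
  \row_k chart_grad h i (chart_coord (A i) x) k =
  (\row_k chart_grad h j (chart_coord (A j) x) k) *m (transition_jacobian i j x)^T.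
Proof.
move=> sh ix jx; set y := chart_coord (A i) x.
have oO := @open_overlap R M m A j i.
have sP : smooth_map (chart_coord (A i) @` (chart_dom (A i) `&` chart_dom (A j)))
    (fun y => chart_coord (A j) (chart_inv (A i) y)).
  by move=> l; exact: transition_smooth.
have Oy : (chart_coord (A i) @` (chart_dom (A i) `&` chart_dom (A j))) y by exists x.
apply/rowP => k; rewrite [LHS]mxE [RHS]mxE.
under eq_bigr do rewrite [X in X * _]mxE [X in _ * X]mxE mulrC.
have Vy : chart_codom (A j) (chart_coord (A j) (chart_inv (A i) y)).
  by rewrite /y coordK//; exact: chart_codomI.
have := partial_comp k oO (@open_codom _ _ _ (A j)) sP (sh j) Oy Vy.
rewrite /chart_grad /partial => E.
rewrite (derive_eq_on (g := fun z => h (chart_inv (A j)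
  (chart_coord (A j) (chart_inv (A i) z)))) _ oO) //; last first.
  by move=> _ [z [iz jz] <-]; rewrite !coordK.
rewrite E; apply: eq_bigr => l _; rewrite {2}/y coordK//; congr (_ * _).
by rewrite /transition_jacobian (jacobianE k l oO sP Oy).
Qed.

(** The gradient is one tangent vector seen in two frames; the identity has the shape of the premise
    of [spin_trans_lift]. *)
Lemma frame_grad_transition (h : M -> R) i j x : smooth_fun A h ->
  chart_dom (A i) x -> chart_dom (A j) x ->
  let yi := chart_coord (A i) x in let yj := chart_coord (A j) x in
  frame_grad S j yj (chart_grad h j yj) *m frame S j yj =
  frame_grad S i yi (chart_grad h i yi) *m frame S i yi *m transition_jacobian i j x.
Proof.
move=> sh ix jx yi yj; rewrite !frame_gradE (chart_grad_transition sh ix jx) -/yi -/yj.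
set J := transition_jacobian i j x; set d := \row_k _.
have Gi := metric_compat g ix jx; rewrite -/J -/yi -/yj /= in Gi.
have := frame_inv_l S (chart_codomI ix); rewrite -/yi Gi.
set Ei := frame S i yi; set Ej := frame S j yj => H.
have {}H : J^T *m (Ei^T *m Ei) *m J *m g j yj = 1%:M.
  by rewrite -!mulmxA; apply: mulmx1C; rewrite !mulmxA in H *.
have K := frame_inv_r S (chart_codomI jx); rewrite -/yj -/Ej in K.
(* Both sides are inverse to [g j yj]: the inverse metric transforms contravariantly. *)
have {}K : J^T *m (Ei^T *m Ei) *m J = Ej^T *m Ej.
  by rewrite -[LHS]mulmx1 -K mulmxA H mul1mx.
by rewrite -mulmxA -K !mulmxA.
Qed.

Lemma Re_frame_cgrad i (f : M -> C) y :
  \row_a complex.Re (frame_cgrad S i f y a) =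
  frame_grad S i y (chart_grad (fun x => complex.Re (f x)) i y).
Proof.
apply/rowP => a; rewrite !mxE.
rewrite (big_morph _ (@cReD R) (erefl : complex.Re (0 : C) = 0)).
apply: eq_bigr => mu _. by rewrite cReM /= mul0r subr0.
Qed.

Lemma Im_frame_cgrad i (f : M -> C) y :
  \row_a complex.Im (frame_cgrad S i f y a) =
  frame_grad S i y (chart_grad (fun x => complex.Im (f x)) i y).
Proof.
apply/rowP => a; rewrite !mxE.
rewrite (big_morph _ (@cImD R) (erefl : complex.Im (0 : C) = 0)).
by apply: eq_bigr => mu _; rewrite cImM /= mul0r addr0.
Qed.

Lemma clifford_transition (f : M -> C) i j x :
  (forall k, csmooth_on (chart_codom (A k)) (fun y => f (chart_inv (A k) y))) ->
  chart_dom (A i) x -> chart_dom (A j) x ->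
  clifford_cmul (spin_gam S) (frame_cgrad S j f (chart_coord (A j) x)) *m spin_trans S j
    i x =
  spin_trans S j i x *m clifford_cmul (spin_gam S)
    (frame_cgrad S i f (chart_coord (A i) x)).
Proof.
move=> sf ix jx; rewrite !clifford_cmulE !Re_frame_cgrad !Im_frame_cgrad.
have sRe : smooth_fun A (fun x => complex.Re (f x)) by move=> k; have [] := sf k.
have sIm : smooth_fun A (fun x => complex.Im (f x)) by move=> k; have [] := sf k.
rewrite mulmxDl mulmxDr -scalemxAl -scalemxAr.
congr (_ + _ *: _); apply/esym; apply: (spin_trans_lift (s0 := S) jx ix).
  exact: frame_grad_transition.
exact: frame_grad_transition.
Qed.

End Covariance.

(** * From the norm of the commutator to the gradient *)

Section GradientBound.
Context {R : realType} {M : ptopologicalType} {m : nat}.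
Context {A : smooth_atlas R M m} {g : riemannian_metric A}.
Variable S : spin_structure g.
Variable vol : {measure set (borel M) -> \bar R}.
Hypothesis volg : riemannian_volume g vol.
Hypothesis hausM : hausdorff_space M.
Local Notation C := R[i].
Variable f : M -> C.
Hypothesis sf : forall k, csmooth_on (chart_codom (A k)) (fun y => f (chart_inv (A k) y)).

Let W i (r : 'I_(spinor_rank m)) (y : 'rV[R]_m) : R :=
  sqn (clifford_cmul (spin_gam S) (frame_cgrad S i f y) *m delta_mx r 0).

Lemma smooth_frame_cgrad i a : csmooth_on (chart_codom (A i)) (fun y =>
  frame_cgrad S i f y a).
Proof.
have oi := @open_codom _ _ _ (A i).
apply: csmooth_on_sum => // mu; apply: csmooth_onM => //.
  exact: csmooth_on_real (frame_smooth S (i := i) a mu).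
exact: cpartial_smooth (sf i).
Qed.

Lemma continuous_clifford_sqn i r y : chart_codom (A i) y -> {for y, continuous (W i r)}.
Proof.
move=> iy; have oi := @open_codom _ _ _ (A i).
pose ent s y := \sum_a frame_cgrad S i f y a * spin_gam S a s r.
have sE s : csmooth_on (chart_codom (A i)) (ent s).
  apply: csmooth_on_sum => // a; apply: csmooth_onM => //.
    exact: smooth_frame_cgrad.
  exact: csmooth_on_cst.
have -> : W i r = fun y => \sum_s (complex.Re (ent s y) * complex.Re (ent s y) +
    complex.Im (ent s y) * complex.Im (ent s y)).
  apply/funext => z; apply: eq_bigr => s _; rewrite sqr_normcE !expr2.
  suff -> : (clifford_cmul (spin_gam S) (frame_cgrad S i f z) *m
    (delta_mx r 0 : 'cV[C]_(spinor_rank m))) s 0 = ent s z by [].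
  rewrite -colE mxE summxE; apply: eq_bigr => a _; by rewrite mxE.
apply: (@smooth_on_continuous _ _ (chart_codom (A i))) iy.
apply: (smooth_on_sum _ oi) => s; have [s1 s2] := sE s.
exact: (smooth_onD oi (smooth_onM oi s1 s1) (smooth_onM oi s2 s2)).
Qed.

Section BumpSpinor.
Variables (i : chart_index A) (y0 : 'rV[R]_m) (rho c : R) (r : 'I_(spinor_rank m)).
Hypothesis rho0 : 0 < rho.
Hypothesis ball_sub : forall y, `|y - y0| <= rho -> chart_codom (A i) y.

Let B := chart_bump (A := A) i y0 rho.

(** The constant basis spinor [r] of chart i, cut off by the bump and carried to chart j by the
    cocycle. Off chart i, where [spin_trans S j i x] has no meaning, the bump is 0. *)
Definition bump_spinor : @spinor_components R M m A := fun j x =>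
  real_complex R (c * B x) *: (spin_trans S j i x *m delta_mx r 0).

Lemma bump_spinor_smooth : smooth_spinor_c S bump_spinor.
Proof.
split.
- move=> j k x jx kx; rewrite /bump_spinor; have [ix|ix] := pselect (chart_dom (A i) x).
    by rewrite -scalemxAr mulmxA (spin_trans_cocycle S jx kx ix).
  by rewrite /B chart_bump_out// mulr0 rmorph0 !scale0r mulmx0.
- move=> j s.
  apply: (csmooth_on_ext (@open_codom _ _ _ (A j)) (F := fun y =>
    real_complex R (chart_bump (A := A) i y0 rho (chart_inv (A j) y)) *
     (real_complex R c * spin_trans S j i (chart_inv (A j) y) s r))).
    by move=> y _; rewrite mxE -colE mxE mulrCA mulrA -rmorphM.
  apply: csmooth_bump_mul => //.
  apply: csmooth_onM; [exact: open_overlap|exact: csmooth_on_cst|].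
  exact: spin_trans_smooth.
- exists (bump_support (A := A) i y0 rho); first exact: compact_bump_support.
  move=> j x jx Kx; rewrite /bump_spinor /B (chart_bump_supp rho0 Kx).
  by rewrite mulr0 rmorph0 scale0r.
Qed.

Lemma sqn_delta : sqn (delta_mx r 0 : 'cV[C]_(spinor_rank m)) = 1.
Proof.
rewrite /sqn (bigD1 r)//= big1 ?addr0 => [|s sr].
  by rewrite mxE !eqxx normc1 expr1n.
by rewrite mxE (negbTE sr) normc0 expr0n.
Qed.

Let normc_real (t : R) : normc (real_complex R t) ^+ 2 = t ^+ 2.
Proof. by rewrite sqr_normcE /= expr0n addr0. Qed.

Lemma sqn_bump_spinor j x : chart_dom (A j) x ->
  sqn (bump_spinor j x) = (c * B x) ^+ 2.
Proof.
move=> jx; rewrite /bump_spinor sqnZ normc_real.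
have [ix|ix] := pselect (chart_dom (A i) x); last first.
  by rewrite /B chart_bump_out// mulr0 expr0n mul0r.
by rewrite (sqn_spin _ (spin_trans_in S jx ix)) sqn_delta mulr1.
Qed.

(** [clifford_transition] moves the estimate from chart j, imposed by [chart_at] in the norm, to
    chart i, where [W] is bounded below. *)
Lemma sqn_commutator_bump_spinor (kappa : R) j x : chart_dom (A j) x ->
  (forall y, `|y - y0| < rho -> kappa <= W i r y) ->
  kappa * (c * B x) ^+ 2 <= sqn (dirac_commutator S f bump_spinor j x).
Proof.
move=> jx Wk; have [b0|b0] := eqVneq (B x) 0.
  by rewrite b0 mulr0 expr0n mulr0 sqn_ge0.
have ix : chart_dom (A i) x.
  by apply: contrapT => ix; move: b0; rewrite /B chart_bump_out// eqxx.
rewrite sqn_dirac_commutator//; last exact: (spinor_smooth bump_spinor_smooth).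
rewrite /bump_spinor -scalemxAr sqnZ normc_real mulrC ler_wpM2l ?sqr_ge0//.
rewrite mulmxA (clifford_transition S sf ix jx) -mulmxA
  (sqn_spin _ (spin_trans_in S jx ix)).
apply: Wk; apply: (coord_bump_supp rho0).
by move: b0; rewrite /B chart_bumpE.
Qed.

End BumpSpinor.

Lemma gradient_bound i y0 : (dirac_commutator_norm S vol f <= 1)%E ->
  chart_codom (A i) y0 -> \sum_a normc (frame_cgrad S i f y0 a) ^+ 2 <= 1.
Proof.
move=> D1 iy0; rewrite leNgt; apply/negP => big.
have [r Wr] := clifford_cmul_large (spin_gam S) (frame_cgrad S i f y0).
have {big} W1 : 1 < W i r y0 by exact: lt_le_trans big Wr.
(* A level strictly between 1 and W at y0: being above 1 yields the contradiction, being below W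
   persists near y0. *)
pose kappa := (1 + W i r y0) / 2.
have k1 : 1 < kappa by rewrite /kappa; lra.
have kW : kappa < W i r y0 by rewrite /kappa; lra.
have cdet : {for y0, continuous (fun y => Num.sqrt (\det (g i y)))}.
  apply: (@continuous_comp _ _ _ (fun y => \det (g i y)) Num.sqrt);
    last exact: sqrt_continuous.
  apply: continuous_det_at => a b.
  exact: smooth_on_continuous (metric_smooth g (i := i) a b) iy0.
set d0 := Num.sqrt (\det (g i y0)).
have d0p : 0 < d0 by rewrite sqrtr_gt0 (metric_det_gt0 S iy0).
(* The two bounds on the density keep the volumes of small cubes finite and positive. *)
have : \forall y \near y0, [/\ chart_codom (A i) y, kappa < W i r y,
    Num.sqrt (\det (g i y)) < d0 + 1 & d0 / 2 < Num.sqrt (\det (g i y))].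
  have N1 : \forall y \near y0, chart_codom (A i) y.
    by apply: open_nbhs_nbhs; split => //; exact: open_codom.
  have N2 : \forall y \near y0, kappa < W i r y.
    have cW := @continuous_clifford_sqn i r y0 iy0.
    by apply: (cvgr_gt _ cW).
  have N3 : \forall y \near y0, Num.sqrt (\det (g i y)) < d0 + 1.
    by apply: (cvgr_lt _ cdet); rewrite ltrDl.
  have N4 : \forall y \near y0, d0 / 2 < Num.sqrt (\det (g i y)).
    by apply: (cvgr_gt _ cdet); rewrite -/d0; lra.
  by apply: filterS (filterI (filterI N1 N2) (filterI N3 N4)) => y [[? ?] [? ?]].
move=> /nbhs_ballP[rho' /= rho'0 H].
have {}H y : `|y - y0| < rho' -> [/\ chart_codom (A i) y, kappa < W i r y,
    Num.sqrt (\det (g i y)) < d0 + 1 & d0 / 2 < Num.sqrt (\det (g i y))].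
  by move=> yr; apply: H; rewrite -ball_normE /= distrC.
(* Half of the radius, so that the closed cube also lies in the chart. *)
pose rho := rho' / 2.
have rho0 : 0 < rho by rewrite divr_gt0.
have rr : rho < rho' by rewrite /rho; lra.
have ball_sub y : `|y - y0| <= rho -> chart_codom (A i) y.
  by move=> yr; have [] := H y (le_lt_trans yr rr).
pose B := chart_bump (A := A) i y0 rho.
have cB : continuous B.
  by apply: smooth_fun_continuous; exact: smooth_chart_bump.
have mB : measurable_fun [set: borel M] (fun x : borel M => (B x ^+ 2)%:E).
  apply/measurable_EFinP; apply: measurable_borel_continuous => x.
  by apply: cvgM; exact: cB.
set I := (\int[vol]_x (B x ^+ 2)%:E)%E.
have mcube s : measurable (chart_cube i y0 s : set (borel M)).
  by apply: sub_sigma_algebra; exact: open_chart_cube.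
have I_fin : (I < +oo)%E.
  apply: (@le_lt_trans _ _ (vol (chart_cube i y0 rho'))); last first.
    apply: (@vol_chart_cube_fin _ _ _ _ _ _ volg i y0 rho' (d0 + 1)) => //.
      by rewrite addr_ge0// ltW.
    by move=> y /H[? _ /ltW ? _].
  rewrite -(setIT (chart_cube _ _ _)) -integral_indic//.
  apply: le_integral_any => x _; rewrite lee_fin ?sqr_ge0// indicE.
  case: (boolP (x \in _)) => [_|xn]; first by rewrite expr_le1// ?chart_bump_le1//
    chart_bump_ge0.
  suff -> : B x = 0 by rewrite expr0n.
  apply/eqP; apply: contrapT => /negP b0; move/negP: xn; apply; apply/mem_set.
  have ix : chart_dom (A i) x.
    by apply: contrapT => ix; move: b0; rewrite /B chart_bump_out// eqxx.
  split => //; apply: lt_trans rr; apply: (coord_bump_supp rho0).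
  by move: b0; rewrite /B chart_bumpE.
have I_gt0 : (0 < I)%E.
  pose b0 := coord_bump y0 rho y0 / 2.
  have b0p : 0 < b0 by rewrite divr_gt0// coord_bump_center.
  have cb : {for y0, continuous (coord_bump y0 rho)}.
    exact: (smooth_on_continuous (@coord_bump_smooth _ _ y0 rho) (Logic.I : setT y0)).
  have : \forall y \near y0, b0 < coord_bump y0 rho y.
    by apply: (cvgr_gt _ cb); rewrite /b0; have := coord_bump_center y0 rho0; lra.
  move=> /nbhs_ballP[s /= s0 sP].
  pose t := Num.min s rho'.
  have t0 : 0 < t by rewrite lt_min s0.
  have tP y : `|y - y0| < t -> b0 < coord_bump y0 rho y.
    rewrite lt_min => /andP[ys _]; apply: sP.
    by rewrite -ball_normE /= distrC.
  have vt : (0 < vol (chart_cube i y0 t))%E.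
    apply: (@vol_chart_cube_gt0 _ _ _ _ _ _ volg i y0 t (d0 / 2)) => //.
      by rewrite divr_gt0.
    by move=> y; rewrite lt_min => /andP[_ /H[? _ _ /ltW]].
  apply: (@lt_le_trans _ _ ((b0 ^+ 2)%:E * vol (chart_cube i y0 t))%E).
    by rewrite mule_gt0// lte_fin exprn_gt0.
  rewrite -(setIT (chart_cube _ _ _)) -integral_indic//.
  rewrite -ge0_integralZl_EFin//; last 2 first.
  - by apply/measurable_EFinP; exact: measurable_indic.
  - exact: sqr_ge0.
  apply: le_integral_any => x _; rewrite -EFinM lee_fin;
    first by rewrite mulr_ge0// sqr_ge0.
  rewrite indicE; case: (boolP (x \in _)) => [/set_mem [ix xt]|_];
    last by rewrite mulr0 sqr_ge0.
  rewrite mulr1 ler_sqr ?nnegrE ?chart_bump_ge0 ?(ltW b0p)//.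
  by rewrite /B chart_bumpE//; apply: ltW; exact: tP.
have IE : I = (fine I)%:E by rewrite fineK// ge0_fin_numE// ltW.
have fI : 0 < fine I by rewrite -lte_fin -IE.
(* Normalizes the bump, hence the spinor, in L^2. *)
pose c := Num.sqrt (fine I)^-1.
have cI : (\int[vol]_x ((c * B x) ^+ 2)%:E = 1)%E.
  under eq_integral do rewrite exprMn EFinM.
  rewrite ge0_integralZl_EFin//; last 2 first.
  - by move=> x _; rewrite lee_fin sqr_ge0.
  - exact: sqr_ge0.
  by rewrite -/I IE -EFinM sqr_sqrtr ?invr_ge0 ?(ltW fI)// mulVf// gt_eqF.
pose psi := bump_spinor i y0 rho c r.
have sp : smooth_spinor_c S psi by exact: bump_spinor_smooth.
have p1 : (spinor_L2norm vol psi <= 1)%E.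
  apply/spinor_L2norm_le1; rewrite -cI; apply: le_integral_any => x _.
    by rewrite lee_fin sqn_ge0.
  by rewrite lee_fin sqn_bump_spinor//; exact: chart_at_dom.
have : (spinor_L2norm vol (dirac_commutator S f psi) <= 1)%E.
  by apply: le_trans D1; apply: ereal_sup_ubound; exists psi.
(* The squared norm of [D, f] psi is at least kappa times the integral of (c B)^2, which is 1. *)
move=> /spinor_L2norm_le1; apply/negP; rewrite -ltNge.
apply: (@lt_le_trans _ _ kappa%:E); first by rewrite lte_fin.
rewrite -[leLHS]mule1 -cI -ge0_integralZl_EFin//.
- apply: le_integral_any => x _; rewrite -EFinM lee_fin.
    by rewrite mulr_ge0 ?sqr_ge0// (le_trans ler01 (ltW k1)).
  have Wk y : `|y - y0| < rho -> kappa <= W i r y.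
    by move=> yr; have [_ /ltW] := H y (lt_trans yr rr).
  exact: (sqn_commutator_bump_spinor c rho0 ball_sub (chart_at_dom A x) Wk).
- by move=> x _; rewrite lee_fin sqr_ge0.
- under eq_fun do rewrite exprMn EFinM.
  exact: measurable_funeM.
- exact: le_trans ler01 (ltW k1).
Qed.

End GradientBound.

(** * The two bounds *)

Section UpperBound.
Context {R : realType} {M : ptopologicalType} {m n : nat}.
Context {A : smooth_atlas R M m} {g : riemannian_metric A} (S : spin_structure g).
Variable vol : {measure set (borel M) -> \bar R}.
Hypothesis volg : riemannian_volume g vol.
Hypothesis hausM : hausdorff_space M.
Context (N : M -> 'rV[R]_n) (iso : isometric_embedding g N).
Hypothesis convN : convex_set (range N).
Local Notation C := R[i].

(** The real part of (p - i q) f, a rotation of the phase of f when p^2 + q^2 = 1. *)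
Definition phase_part (p q : R) (f : M -> C) (x : M) : R :=
  p * complex.Re (f x) + q * complex.Im (f x).

Lemma smooth_phase_part p q (f : M -> C) : C0_smooth A f -> smooth_fun A
  (phase_part p q f).
Proof.
move=> [_ sf] i; have [s1 s2] := sf i; have oi := @open_codom _ _ _ (A i).
exact: (smooth_onD oi (smooth_onZ p oi s1) (smooth_onZ q oi s2)).
Qed.

Lemma grad_le1_phase_part p q (f : M -> C) : C0_smooth A f ->
  (dirac_commutator_norm S vol f <= 1)%E -> p ^+ 2 + q ^+ 2 = 1 ->
  grad_le1 g (phase_part p q f).
Proof.
move=> [_ sf] D1 pq i y iy v. apply: (@lin_form_le _ _ _ _ _ S _ _ iy).
have bound := gradient_bound volg hausM sf D1 iy.
have [s1 s2] := sf i.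
pose zr := frame_grad S i y (chart_grad (fun x => complex.Re (f x)) i y).
pose zi := frame_grad S i y (chart_grad (fun x => complex.Im (f x)) i y).
have -> : frame_grad S i y (chart_grad (phase_part p q f) i y) = p *: zr + q *: zi.
  apply/rowP => a; rewrite !mxE !mulr_sumr -big_split; apply: eq_bigr => mu _ /=.
  have d1 := smooth_on_derivable (k := mu) s1 iy.
  have d2 := smooth_on_derivable (k := mu) s2 iy.
  rewrite /chart_grad /partial.
  rewrite (_ : (fun z => phase_part p q f (chart_inv (A i) z)) =
    p *: (fun z => complex.Re (f (chart_inv (A i) z))) + q *: (fun z =>
      complex.Im (f (chart_inv (A i) z)))) //.
  rewrite (deriveD (derivableZ (k := p) d1) (derivableZ (k := q) d2)) (deriveZ p d1)
    (deriveZ q d2).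
  by rewrite /GRing.scale /=; ring.
rewrite (le_trans _ bound)// dotE; apply: ler_sum => a _.
rewrite sqr_normcE.
have -> : complex.Re (frame_cgrad S i f y a) = zr 0 a by rewrite /zr -Re_frame_cgrad mxE.
have -> : complex.Im (frame_cgrad S i f y a) = zi 0 a by rewrite /zi -Im_frame_cgrad mxE.
have -> : (p *: zr + q *: zi) 0 a = p * zr 0 a + q * zi 0 a.
  by rewrite mxE; congr (_ + _); rewrite mxE.
(* Lagrange identity: (p^2 + q^2) (a^2 + b^2) - (p a + q b)^2 = (q a - p b)^2. *)
rewrite -[leRHS]mul1r -pq -subr_ge0.
rewrite (_ : _ - _ = (q * zr 0 a - p * zi 0 a) ^+ 2) ?sqr_ge0//; ring.
Qed.

Lemma phase_part_lipschitz p q (f : M -> C) : C0_smooth A f ->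
  (dirac_commutator_norm S vol f <= 1)%E -> p ^+ 2 + q ^+ 2 = 1 ->
  forall x y, `|phase_part p q f y - phase_part p q f x| <= enorm (N y - N x).
Proof.
move=> sf D1 pq x y.
have H a b := geodesic_dist_lower a b (smooth_phase_part p q sf)
  (grad_le1_phase_part sf D1 pq).
have H1 := H x y; have H2 := H y x.
move: H1 H2; rewrite !(geodesic_distE S iso convN) !lee_fin => H1 H2.
rewrite ler_norml H1 andbT lerNl opprB (le_trans H2)//.
by rewrite -opprB enormN.
Qed.

Variables mu1 mu2 : probability (borel M) R.
Hypothesis mom1 : finite_first_moment g mu1.
Hypothesis mom2 : finite_first_moment g mu2.

(** Reduced to the coordinates of N on each factor, to obtain measurability for the product of the
    Borel sigma-algebras. *)
Lemma measurable_embedding_dist :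
  measurable_fun setT (fun z : borel M * borel M => (enorm (N z.2 - N z.1))%:E).
Proof.
apply/measurable_EFinP.
rewrite (_ : (fun z => _) = Num.sqrt \o (fun z : borel M * borel M =>
  \sum_j (N z.2 0 j - N z.1 0 j) ^+ 2)); last first.
  by apply/funext => z; rewrite /= /enorm dotE; congr Num.sqrt; apply: eq_bigr => j _;
    rewrite !mxE expr2.
apply: measurableT_comp; first by apply: continuous_measurable_fun;
  exact: sqrt_continuous.
apply: measurable_sum => j; apply: measurable_funX.
have mN : measurable_fun [set: borel M] (fun x : borel M => N x 0 j).
  apply: measurable_borel_continuous => x.
  by apply: (@continuous_comp _ _ _ N (fun xi : 'rV[R]_n => xi 0 j));
    [exact: (continuous_embedding iso)|exact: coord_continuous].
by apply: measurable_funB; [exact: (measurableT_comp mN measurable_snd)|exact: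
  (measurableT_comp mN measurable_fst)].
Qed.

(** Both measures having mass 1, the difference of the means is the iterated integral of h x - h y.
    Each integral is compared by [le_integral_pos], and Tonelli gives the product measure. *)
Lemma lipschitz_transport (h : M -> R) : continuous h ->
  (forall x y, `|h y - h x| <= enorm (N y - N x)) ->
  ((\int[mu1]_x h x - \int[mu2]_x h x)%:E <= \int[mu1 \x mu2]_z geodesic_dist g z.1
    z.2)%E.
Proof.
move=> ch lh.
have i1 := integrable_lipschitz S iso convN mom1 ch lh.
have i2 := integrable_lipschitz S iso convN mom2 ch lh.
under [X in (_ <= X)%E]eq_integral do rewrite (geodesic_distE S iso convN).
rewrite (fubini_tonelli1 _ measurable_embedding_dist) /=; last first.
  by move=> z; rewrite lee_fin enorm_ge0.
have ic (mu : probability (borel M) R) c := finite_measure_integrable_cst mu c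
  (@measurableT _ (borel M)).
set H2 := \int[mu2]_x h x.
have E2 : (\int[mu2]_x (h x)%:E = H2%:E)%E by rewrite fineK// integrable_fin_num.
have E1 : (\int[mu1]_x (h x)%:E = (\int[mu1]_x h x)%:E)%E by rewrite fineK//
  integrable_fin_num.
have -> : ((\int[mu1]_x h x - H2)%:E = \int[mu1]_x ((h x)%:E - (cst H2 x)%:E))%E.
  rewrite integralB_EFin//; last exact: ic.
  rewrite E1 (integral_cst _ _ H2%:E)//.
  rewrite EFinB; congr (_ - _)%E; rewrite -[LHS]mule1; congr (_ * _)%E.
  by apply/esym; exact: (probability_setT mu1).
apply: le_integral_pos => x _; first by apply: integral_ge0 => y _;
  rewrite lee_fin enorm_ge0.
rewrite /fubini_F /=.
have -> : ((h x)%:E - H2%:E = \int[mu2]_y ((cst (h x) y)%:E - (h y)%:E))%E.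
  rewrite integralB_EFin//; last exact: ic.
  rewrite E2 (integral_cst _ _ (h x)%:E)//.
  congr (_ - _)%E; rewrite -[LHS]mule1; congr (_ * _)%E.
  by apply/esym; exact: (probability_setT mu2).
apply: le_integral_pos => y _; first by rewrite lee_fin enorm_ge0.
rewrite -EFinB lee_fin /= (le_trans (ler_norm _))// (le_trans (lh y x))//.
by rewrite -opprB enormN.
Qed.

Lemma spectral_distance_upper phi1 phi2 :
  state_measure phi1 mu1 -> state_measure phi2 mu2 ->
  (spectral_distance S vol phi1 phi2 <= \int[mu1 \x mu2]_z geodesic_dist g z.1 z.2)%E.
Proof.
move=> m1 m2; apply: ge_ereal_sup => _ [f [sf D1] <-].
have [cf _] := sf; rewrite (m1 f cf) (m2 f cf).
have lip p q pq := @phase_part_lipschitz p q f sf D1 pq.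
have cph p q : continuous (phase_part p q f).
  exact: smooth_fun_continuous (smooth_phase_part p q sf).
have ReE : (fun x => complex.Re (f x)) = phase_part 1 0 f.
  by apply/funext => x; rewrite /phase_part mul1r mul0r addr0.
have ImE : (fun x => complex.Im (f x)) = phase_part 0 1 f.
  by apply/funext => x; rewrite /phase_part mul1r mul0r add0r.
have iRe mu : finite_first_moment g mu -> mu.-integrable setT
  (EFin \o (fun x : borel M => complex.Re (f x))).
  move=> mom; rewrite ReE; apply: (integrable_lipschitz S iso convN mom (cph _ _)).
  by apply: lip; rewrite expr1n expr0n addr0.
have iIm mu : finite_first_moment g mu -> mu.-integrable setT
  (EFin \o (fun x : borel M => complex.Im (f x))).
  move=> mom; rewrite ImE; apply: (integrable_lipschitz S iso convN mom (cph _ _)).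
  by apply: lip; rewrite expr1n expr0n add0r.
set a1 := \int[mu1]_x complex.Re (f x); set b1 := \int[mu1]_x complex.Im (f x).
set a2 := \int[mu2]_x complex.Re (f x); set b2 := \int[mu2]_x complex.Im (f x).
have -> : Complex a1 b1 - Complex a2 b2 = Complex (a1 - a2) (b1 - b2) :> C by [].
set z : C := Complex _ _.
have [z0|z0] := eqVneq (normc z) 0.
  rewrite z0; apply: integral_ge0 => w _.
  by rewrite (geodesic_distE S iso convN) lee_fin enorm_ge0.
(* The phase of z, for which |z| = p Re z + q Im z: one real Lipschitz function carries the whole
   modulus. *)
pose p := (a1 - a2) / normc z; pose q := (b1 - b2) / normc z.
have zz : normc z ^+ 2 = (a1 - a2) ^+ 2 + (b1 - b2) ^+ 2 by rewrite sqr_normcE.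
have pq : p ^+ 2 + q ^+ 2 = 1.
  by rewrite /p /q !expr_div_n -mulrDl -zz divff// expf_neq0.
have phaseE (mu : probability (borel M) R) : finite_first_moment g mu ->
  \int[mu]_x phase_part p q f x =
  p * (\int[mu]_x complex.Re (f x)) + q * (\int[mu]_x complex.Im (f x)).
  move=> mom; have ir := iRe mu mom; have ii := iIm mu mom.
  rewrite -RintegralZl// -RintegralZl// -RintegralD//.
  - exact: (integrableZl measurableT p ir).
  - exact: (integrableZl measurableT q ii).
have -> : normc z = \int[mu1]_x phase_part p q f x - \int[mu2]_x phase_part p q f x.
  rewrite !phaseE// -/a1 -/a2 -/b1 -/b2.
  apply: (mulfI z0); rewrite -expr2 zz /p /q; field.
  exact: z0.
by apply: lipschitz_transport => //; exact: lip.
Qed.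

End UpperBound.

Section LowerBound.
Context {R : realType} {M : ptopologicalType} {m n : nat}.
Context {A : smooth_atlas R M m} {g : riemannian_metric A} (S : spin_structure g).
Variable vol : {measure set (borel M) -> \bar R}.
Context (N : M -> 'rV[R]_n) (iso : isometric_embedding g N).
Hypothesis convN : convex_set (range N).
Hypothesis complete : riemannian_complete g.
Local Notation C := R[i].

Definition damped_fun (u : 'rV[R]_n) (k : nat) (x : M) : R := damped u k.+1%:R^-1 (N x).

Let k0 (k : nat) : 0 < k.+1%:R^-1 :> R.
Proof. by rewrite invr_gt0 ltr0n. Qed.

Lemma smooth_damped_fun u k : smooth_fun A (damped_fun u k).
Proof. by apply: (smooth_comp_embedding iso); apply: smooth_damped; exact: ltW. Qed.

Lemma damped_fun_C0 u k : dot u u <= 1 ->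
  C0_smooth A (fun x => real_complex R (damped_fun u k x)).
Proof.
move=> u1; split; last by move=> i; exact: csmooth_on_real (@smooth_damped_fun u k i).
split.
- exact: (smooth_fun_continuous (@smooth_damped_fun u k)).
- by move=> x; exact: cst_continuous.
(* The radius is the threshold of [damped_small]; the set is compact since N is proper. *)
move=> e e0; exists [set x | `|N x| <= (k.+1%:R^-1 * e)^-1].
  exact: (@compact_embedding_ball _ _ _ _ _ _ S _ iso convN complete _).
move=> x /negP; rewrite -ltNge => H.
have -> : normc (real_complex R (damped_fun u k x)) = `|damped_fun u k x|.
  by rewrite /= expr0n addr0 sqrtr_sqr.
apply: damped_small => //.
exact: lt_le_trans H (norm_le_enorm _).
Qed.

Lemma damped_fun_norm_le1 u k : dot u u <= 1 ->
  (dirac_commutator_norm S vol (fun x => real_complex R (damped_fun u k x)) <= 1)%E.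
Proof.
move=> u1; apply: dirac_commutator_norm_le1; first exact: smooth_damped_fun.
apply: (grad_le1_comp_embedding iso); first by apply: smooth_damped; exact: ltW.
by move=> xi; apply: partial_damped_le1 => //; exact: ltW.
Qed.

(** The dominating function is |u.N|, integrable by the moment condition. *)
Lemma integral_damped_cvg (mu : probability (borel M) R) u : finite_first_moment g mu ->
  \int[mu]_x damped_fun u k x @[k --> \oo] --> dot u (barycenter N mu).
Proof.
move=> mom.
have idot := integrable_dot S iso convN mom u.
have mk k : measurable_fun [set: borel M] (fun x : borel M => (damped_fun u k x)%:E).
  apply/measurable_EFinP; apply: measurable_borel_continuous.
  exact: smooth_fun_continuous (@smooth_damped_fun u k).
have cv : \forall x \ae mu, setT x ->
    ((damped_fun u k x)%:E @[k --> \oo] --> (dot u (N x))%:E)%E.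
  by apply: aeW => x _; apply: cvg_EFin; [exact: nearW|exact: damped_cvg].
have bd : \forall x \ae mu, forall k, setT x ->
    (`|(damped_fun u k x)%:E| <= `|(dot u (N x))%:E|)%E.
  by apply: aeW => x k _; rewrite lee_fin; apply: damped_le; exact: ltW.
have [_ _ H] := dominated_convergence measurableT mk (measurable_int _ idot) cv
  (integrable_abse idot) bd.
move: H; rewrite (integral_dot S iso convN mom u) => H.
exact: fine_cvg H.
Qed.

Variables (phi1 phi2 : (M -> C) -> C) (mu1 mu2 : probability (borel M) R).
Hypothesis (m1 : state_measure phi1 mu1) (m2 : state_measure phi2 mu2).
Hypothesis (mom1 : finite_first_moment g mu1) (mom2 : finite_first_moment g mu2).

Lemma spectral_distance_dot u : dot u u <= 1 ->
  ((dot u (barycenter N mu1 - barycenter N mu2))%:E <= spectral_distance S vol phi1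
    phi2)%E.
Proof.
move=> u1; set X := spectral_distance _ _ _ _.
have H k : ((\int[mu1]_x damped_fun u k x - \int[mu2]_x damped_fun u k x)%:E <= X)%E.
  pose f x : C := real_complex R (damped_fun u k x).
  have [cf sf] := damped_fun_C0 k u1.
  have : ((normc (phi1 f - phi2 f))%:E <= X)%E.
    by apply: ereal_sup_ubound; exists f => //; split => //; exact: damped_fun_norm_le1.
  apply: le_trans; rewrite (m1 cf) (m2 cf) lee_fin.
  set b1 := \int[mu1]_x complex.Im _; set b2 := \int[mu2]_x complex.Im _.
  rewrite (le_trans (ler_norm _))// -sqrtr_sqr; apply: ler_wsqrtr.
  by rewrite lerDl sqr_ge0.
have cv : (\int[mu1]_x damped_fun u k x - \int[mu2]_x damped_fun u k x) @[k --> \oo] -->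
    dot u (barycenter N mu1 - barycenter N mu2).
  by rewrite dotDr dotNr; apply: cvgB; exact: integral_damped_cvg.
(* An infinite supremum leaves nothing to prove, and minus infinity is excluded by [H]. *)
case: X H => [s| |] H; last by have := H 0%N.
  rewrite lee_fin; apply: (ler_cvg_to cv (@cvg_cst _ s _ _ _)).
  by apply: nearW => k; rewrite -lee_fin.
by rewrite leey.
Qed.

(** The best u is w / |w|; when w = 0, the choice u = 0 gives nonnegativity. *)
Lemma spectral_distance_lower :
  ((enorm (barycenter N mu1 - barycenter N mu2))%:E <= spectral_distance S vol phi1
    phi2)%E.
Proof.
set w := _ - _; have [w0|w0] := eqVneq (enorm w) 0.
  have := @spectral_distance_dot 0; rewrite {1}/dot mul0mx mxE ler01 => /(_ isT).
  by rewrite /dot mul0mx mxE w0.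
have wp : 0 < enorm w by rewrite lt_neqAle eq_sym w0 enorm_ge0.
have := @spectral_distance_dot ((enorm w)^-1 *: w).
rewrite -/w !dotZl dotZr -enorm_sqr expr2 mulKf// mulVf// lexx => /(_ isT); exact.
Qed.

End LowerBound.

(** [mean_point] selects a point by [get], with a default value; the first two conclusions certify
    that it is the preimage of the barycenter. *)
Theorem proposition3p1 (R : realType) (m : nat) (M : ptopologicalType)
    (A : smooth_atlas R M m) (g : riemannian_metric A) (S : spin_structure g)
    (vol : {measure set (borel M) -> \bar R})
    (n : nat) (N : M -> 'rV[R]_n)
    (phi1 phi2 : (M -> R[i]) -> R[i]) (mu1 mu2 : probability (borel M) R)
    (M_hausdorff : hausdorff_space M)
    (M_second_countable : @second_countable M)
    (M_connected : connected [set: M])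
    (M_complete : riemannian_complete g)
    (vol_riemannian : riemannian_volume g vol)
    (N_isometric : isometric_embedding g N)
    (N_convex : convex_set (range N))
    (phi1_state : is_state phi1) (phi2_state : is_state phi2)
    (mu1_phi1 : state_measure phi1 mu1) (mu2_phi2 : state_measure phi2 mu2)
    (mu1_moment : finite_first_moment g mu1)
    (mu2_moment : finite_first_moment g mu2) :
  [/\ N (mean_point N mu1) = barycenter N mu1,
      N (mean_point N mu2) = barycenter N mu2,
      (geodesic_dist g (mean_point N mu1) (mean_point N mu2)
        <= spectral_distance S vol phi1 phi2)%E &
      (spectral_distance S vol phi1 phi2
        <= \int[mu1 \x mu2]_z geodesic_dist g z.1 z.2)%E ].
Proof.
have N1 := mean_pointE S N_isometric N_convex M_complete mu1_moment.
have N2 := mean_pointE S N_isometric N_convex M_complete mu2_moment.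
split=> //.
  rewrite (geodesic_distE S N_isometric N_convex) N1 N2 -opprB enormN.
  exact: spectral_distance_lower.
exact: (spectral_distance_upper S vol_riemannian M_hausdorff N_isometric N_convex
  mu1_moment mu2_moment mu1_phi1 mu2_phi2).
Qed.
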